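(* Let $1<p\le 2$, let $d\in\mathbb{N}$, and let $X$ be a closed infinite-dimensional subspace of $L_p(\mathbb{R}^d)$. Suppose $\{f_i,f_i'\}_{i\in\mathbb{N}}\subseteq X\times X'$ is an unconditional approximate Schauder frame of translates for $X$. The following are equivalent: (i) There is a seminormalized sequence $\{F_i'\}_{i\in\mathbb{N}}\subseteq X'$ such that $\{f_i,F_i'\}_{i\in\mathbb{N}}$ is an unconditional Schauder frame for $X$. (ii) There is $M_0>0$ such that $$\Big\|\sum_{i=1}^n a_if_i\Big\|\le M_0\Big(\sum_{i=1}^n|a_i|^p\Big)^{1/p}$$ for each $n\in\mathbb{N}$ and every finite set of scalars $\{a_i\}_{1\le i\le n}$. Under these (equivalent) conditions, $g\mapsto (f_i'(g))_{i\in\mathbb{N}}$ defines an isomorphism between $X$ and a complemented subspace of $\ell_p$. Thus, $X$ is isomorphic to $\ell_p$.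
   Context: Scalars are $\mathbb{K}\in\{\mathbb{R},\mathbb{C}\}$; $X'$ denotes the dual of $X$; an isomorphism is a bounded linear bijection with bounded inverse. For $\lambda\in\mathbb{R}^d$, $(T_\lambda f)(x)=f(x-\lambda)$. A sequence in a normed space is seminormalized if there are $0<r\le R<\infty$ such that all its terms have norm in $[r,R]$. A sequence $\{f_i,f_i'\}_{i\in\mathbb{N}}\subseteq X\times X'$ is a Schauder frame for $X$ if $g=\sum_{i=1}^\infty f_i'(g)f_i$ for all $g\in X$. It is an approximate Schauder frame for $X$ if $S(g)=\sum_{i=1}^\infty f_i'(g)f_i$ ($g\in X$) defines an isomorphism $S:X\to X$. In either case it is unconditional if the series converges unconditionally for each $g\in X$. Given a finite family $\{g_k\}_{1\le k\le k_0}\subset L_p(\mathbb{R}^d)$ of different, nonzero functions and a sequence $\{\lambda_i\}_{i\in\mathbb{N}}\subset\mathbb{R}^d$, a sequence $\{f_i\}_{i\in\mathbb{N}}$ is a sequence of translates of $\{g_k\}_{1\le k\le k_0}$ by $\{\lambda_i\}_{i\in\mathbb{N}}$ if for each $i$ there is $1\le k\le k_0$ with $f_i=T_{\lambda_i}g_k$. An (approximate) Schauder frame $\{f_i,f_i'\}_{i\in\mathbb{N}}$ for a subspace $X$ of $L_p(\mathbb{R}^d)$ is an (approximate) Schauder frame of translates if $\{f_i\}_{i\in\mathbb{N}}$ is a sequence of translates of finitely many such functions by some sequence in $\mathbb{R}^d$. *)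

(* Defs.v *)
From HB Require Import structures.
From mathcomp Require Import all_boot all_order all_algebra.
From mathcomp Require Import generic_quotient ring_quotient complex.
From mathcomp Require Import all_classical all_reals all_analysis measurable_realfun.

Set Implicit Arguments.
Unset Strict Implicit.
Unset Printing Implicit Defensive.

Import Order.TTheory GRing.Theory Num.Theory.
Import numFieldNormedType.Exports.

Local Open Scope classical_set_scope.
Local Open Scope ring_scope.

Section lebesgue_cons.
Local Open Scope ereal_scope.
Context (R : realType) (d : nat).
Notation Rm := (measurableTypeR R).
Variable m : {sigma_finite_measure set (d.-tuple Rm) -> \bar R}.

Definition tcons (z : Rm * d.-tuple Rm) : d.+1.-tuple Rm :=
  [the d.+1.-tuple Rm of z.1 :: z.2].

Let measurable_tcons : measurable_fun [set: Rm * d.-tuple Rm] tcons.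
Proof. exact: measurable_cons. Qed.

Definition lebesgue_cons : set (d.+1.-tuple Rm) -> \bar R :=
  pushforward (@lebesgue_measure R \x m) tcons.

Let mtcons A : measurable A -> measurable (tcons @^-1` A).
Proof. by move=> mA; rewrite -[X in measurable X]setTI; exact: measurable_tcons. Qed.

Let lebesgue_cons0 : lebesgue_cons set0 = 0.
Proof. by rewrite /lebesgue_cons /pushforward preimage_set0 measure0. Qed.

Let lebesgue_cons_ge0 A : 0 <= lebesgue_cons A.
Proof. exact: measure_ge0. Qed.

Let lebesgue_cons_sigma_additive : semi_sigma_additive lebesgue_cons.
Proof.
move=> F mF tF mUF; rewrite /lebesgue_cons /pushforward preimage_bigcup.
apply: measure_semi_sigma_additive.
- by move=> n; exact: mtcons.
- apply/trivIsetP => /= i j _ _ ij; rewrite -preimage_setI.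
  by move/trivIsetP : tF => /(_ _ _ _ _ ij) ->//; rewrite preimage_set0.
- by rewrite -preimage_bigcup; exact: mtcons.
Qed.

HB.instance Definition _ := isMeasure.Build _ _ _ lebesgue_cons
  lebesgue_cons0 lebesgue_cons_ge0 lebesgue_cons_sigma_additive.

Let tuncons (x : d.+1.-tuple Rm) : Rm * d.-tuple Rm :=
  (thead x, [tuple of behead x]).

Let measurable_tuncons : measurable_fun [set: d.+1.-tuple Rm] tuncons.
Proof.
apply: measurable_fun_pair; first exact: measurable_tnth.
exact: measurable_behead.
Qed.

Let lebesgue_cons_sigma_finite : sigma_finite [set: d.+1.-tuple Rm] lebesgue_cons.
Proof.
have /sigma_finiteP[F [FT ndF Foo]] := sigma_finiteT (@lebesgue_measure R).
have /sigma_finiteP[G [GT ndG Goo]] := sigma_finiteT m.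
exists (fun n => tuncons @^-1` (F n `*` G n)).
  apply/seteqP; split=> // x _.
  have [i _ Fi] : (\bigcup_i F i) (thead x) by rewrite -FT.
  have [j _ Gj] : (\bigcup_i G i) [tuple of behead x] by rewrite -GT.
  exists (maxn i j) => //; split => /=.
    by move: Fi; exact/subsetPset/ndF/leq_maxl.
  by move: Gj; exact/subsetPset/ndG/leq_maxr.
move=> n; have [mF Fn] := Foo n; have [mG Gn] := Goo n; split.
  rewrite -[X in measurable X]setTI; apply: measurable_tuncons => //.
  exact: measurableX.
rewrite /lebesgue_cons /pushforward -comp_preimage (_ : tuncons \o tcons = id).
  by rewrite preimage_id product_measure1E// lte_mul_pinfty// ge0_fin_numE.
apply/funext => -[x t] /=; rewrite /tuncons /tcons theadE; congr pair.
exact/val_inj.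
Qed.

HB.instance Definition _ := Measure_isSigmaFinite.Build _ _ _ lebesgue_cons
  lebesgue_cons_sigma_finite.

End lebesgue_cons.

(* Lebesgue measure on R^d: the d-fold product of the one-dimensional one,
   transported to tuples; lebesgue_tuple_box computes it on boxes. *)
Fixpoint lebesgue_tuple (R : realType) (d : nat) :
    {sigma_finite_measure set (d.-tuple (measurableTypeR R)) -> \bar R} :=
  if d isn't d'.+1 then
    @dirac _ (0.-tuple (measurableTypeR R)) [tuple] R
  else lebesgue_cons (lebesgue_tuple R d').

Lemma lebesgue_tuple_box (R : realType) (d : nat) (a b : 'I_d -> R) :
  (forall i, a i <= b i) ->
  lebesgue_tuple R d [set x | forall i, tnth x i \in `[a i, b i]] =
  (\prod_(i < d) (b i - a i))%:E.
Proof.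
elim: d a b => [|d IH] a b ab.
  rewrite big_ord0 /= diracE mem_set//=; by case.
rewrite /= /lebesgue_cons /pushforward.
rewrite [X in product_measure1 _ _ X](_ : _ = `[a ord0, b ord0] `*`
  [set x : d.-tuple (measurableTypeR R) | forall i, tnth x i \in `[a (lift ord0 i), b (lift ord0 i)]]); last first.
  apply/seteqP; split=> -[x t] /=.
    move=> h; split=> [|i]; first by have := h ord0.
    by have := h (lift ord0 i); rewrite tnthS.
  move=> [h0 h] i; have [j ->|->] := unliftP ord0 i; last exact: h0.
  by rewrite tnthS; exact: h.
rewrite product_measure1E//=.
- rewrite IH; last by move=> i.
  rewrite lebesgue_measure_itv/= lte_fin big_ord_recl EFinM.
  have := ab ord0; rewrite le_eqVlt => /predU1P[->|->]//.
  by rewrite ltxx subrr.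
- rewrite (_ : [set _ | _] = \bigcap_(i in [set: 'I_d]) ((@tnth d _ ^~ i) @^-1` `[a (lift ord0 i), b (lift ord0 i)])); last first.
    by apply/seteqP; split=> x h i; [move=> _; exact: h|exact: h].
  apply: fin_bigcap_measurable => // i _; rewrite -[X in measurable X]setTI.
  by apply: measurable_tnth => //.
Qed.

Variant scalar_kind := RealScalars | ComplexScalars.

Definition scalars (R : realType) (k : scalar_kind) : numFieldType :=
  match k with
  | RealScalars => R
  | ComplexScalars => R[i]
  end.

Section scalars.
Context (R : realType).
Implicit Type k : scalar_kind.

Definition scalar_of k : R -> scalars R k :=
  match k with
  | RealScalars => fun r => r
  | ComplexScalars => fun r => Complex r 0
  end.

Definition scalar_Re k : scalars R k -> R :=
  match k with
  | RealScalars => fun z => z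
  | ComplexScalars => fun z => complex.Re z
  end.

Definition scalar_Im k : scalars R k -> R :=
  match k with
  | RealScalars => fun=> 0
  | ComplexScalars => fun z => complex.Im z
  end.

(* The norm of R[i] takes its values in R[i]; modulus is its real part. *)
Definition modulus k (z : scalars R k) : R := scalar_Re `|z|.

Lemma modulusE k (z : scalars R k) :
  modulus z = Num.sqrt (scalar_Re z ^+ 2 + scalar_Im z ^+ 2).
Proof.
case: k z => /= z; rewrite /modulus/=; last by case: z.
by rewrite expr0n/= addr0 sqrtr_sqr.
Qed.

Lemma scalar_of_modulus k (z : scalars R k) : scalar_of k (modulus z) = `|z|.
Proof. by case: k z => [z|[]]; rewrite /modulus/= ?normr_id. Qed.

Lemma scalar_ofK k : cancel (scalar_of k) (@scalar_Re k).
Proof. by case: k. Qed.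

Lemma scalar_of_le k : {mono scalar_of k : x y / x <= y}.
Proof. by case: k => //= x y; rewrite lecE/= eqxx. Qed.

Lemma scalar_ofD k : {morph scalar_of k : x y / x + y}.
Proof. by case: k => //= x y; congr Complex; rewrite addr0. Qed.

Lemma scalar_ofM k : {morph scalar_of k : x y / x * y}.
Proof.
case: k => //= x y; apply/eqP; rewrite eq_complex/=.
by rewrite !mul0r mulr0 subr0 addr0 !eqxx.
Qed.

Lemma scalar_of0 k : scalar_of k 0 = 0. Proof. by case: k. Qed.

Lemma modulus_ge0 k (z : scalars R k) : 0 <= modulus z.
Proof. by rewrite modulusE sqrtr_ge0. Qed.

Lemma modulus0 k : modulus (0 : scalars R k) = 0.
Proof. by apply: (can_inj (@scalar_ofK k)); rewrite scalar_of_modulus normr0 scalar_of0. Qed.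

Lemma modulus_eq0 k (z : scalars R k) : modulus z = 0 -> z = 0.
Proof. by move=> z0; apply/normr0_eq0; rewrite -scalar_of_modulus z0 scalar_of0. Qed.

Lemma modulusD k (z w : scalars R k) : modulus (z + w) <= modulus z + modulus w.
Proof. by rewrite -(scalar_of_le k) scalar_ofD !scalar_of_modulus ler_normD. Qed.

Lemma modulusM k (z w : scalars R k) : modulus (z * w) = modulus z * modulus w.
Proof.
by apply: (can_inj (@scalar_ofK k)); rewrite scalar_ofM !scalar_of_modulus normrM.
Qed.

Lemma scalar_ReD k : {morph @scalar_Re k : x y / x + y}.
Proof. by case: k => //= -[? ?] []. Qed.
Lemma scalar_ImD k : {morph @scalar_Im k : x y / x + y}.
Proof. by case: k => /= [? ?|[? ?] []//]; rewrite addr0. Qed.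
Lemma scalar_ReM k (x y : scalars R k) : scalar_Re (x * y) =
  scalar_Re x * scalar_Re y - scalar_Im x * scalar_Im y.
Proof. by case: k x y => /= [? ?|[? ?] []//]; rewrite mulr0 subr0. Qed.
Lemma scalar_ImM k (x y : scalars R k) : scalar_Im (x * y) =
  scalar_Re x * scalar_Im y + scalar_Im x * scalar_Re y.
Proof. by case: k x y => /= [? ?|[? ?] []//]; rewrite mulr0 mul0r addr0. Qed.

End scalars.

Section Lp_functions.
Context d (T : measurableType d) (R : realType) (k : scalar_kind).
Variables (mu : {measure set T -> \bar R}) (p : R) (p1 : 1 <= p).
Local Notation K := (scalars R k).

Definition measurable_scalar_fun (f : T -> K) : Prop :=
  measurable_fun setT (@scalar_Re R k \o f) /\
  measurable_fun setT (@scalar_Im R k \o f).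

Definition eLp_norm (f : T -> K) : \bar R :=
  Lnorm mu p%:E (EFin \o (@modulus R k \o f)).

Definition is_Lp_fun (f : T -> K) : Prop :=
  measurable_scalar_fun f /\ (eLp_norm f < +oo)%E.

(* The unused argument lets unification recover the proof of 1 <= p, which the
   module structure needs, from the type of L_p functions. *)
Definition Lp_fun_pred (_ : 1 <= p) : {pred T -> K} := fun f => `[< is_Lp_fun f >].

Lemma measurable_modulus (f : T -> K) :
  measurable_scalar_fun f -> measurable_fun setT (@modulus R k \o f).
Proof.
move=> [mr mi]; rewrite (_ : _ \o f = fun x =>
  Num.sqrt ((@scalar_Re R k \o f) x ^+ 2 + (@scalar_Im R k \o f) x ^+ 2)).
  apply: (measurableT_comp (continuous_measurable_fun (@sqrt_continuous R))).
  by apply: measurable_funD; exact: measurable_funX.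
by apply/funext => x /=; rewrite modulusE.
Qed.

Lemma le_Lnorm (f g : T -> R) :
  measurable_fun setT f -> measurable_fun setT g ->
  (forall x, 0 <= f x <= g x) ->
  (Lnorm mu p%:E (EFin \o f) <= Lnorm mu p%:E (EFin \o g))%E.
Proof.
move=> mf mg fg; rewrite unlock /Lnorm /=.
have p0 : 0 <= p by rewrite (le_trans ler01).
have mpow (h : T -> R) : measurable_fun setT h ->
    measurable_fun setT (fun x => (`|h x| `^ p)%:E).
  move=> mh; apply/measurable_EFinP.
  apply: (@measurableT_comp _ _ _ _ _ _ (@powR R ^~ p)) => //.
  exact: measurableT_comp.
rewrite gt0_ler_poweR ?invr_ge0//.
- by rewrite in_itv/= leey andbT integral_ge0// => x _; rewrite lee_fin powR_ge0.
- by rewrite in_itv/= leey andbT integral_ge0// => x _; rewrite lee_fin powR_ge0.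
apply: ge0_le_integral => //.
- exact: mpow.
- exact: mpow.
move=> x _; have /andP[f0 fgx] := fg x.
by rewrite lee_fin ge0_ler_powR ?nnegrE// !ger0_norm// (le_trans f0).
Qed.

Lemma eLp_norm_ge0 (f : T -> K) : (0 <= eLp_norm f)%E.
Proof. exact: Lnorm_ge0. Qed.

Lemma eLp_norm_fin (f : T -> K) : is_Lp_fun f -> eLp_norm f \is a fin_num.
Proof. by move=> [_ fp]; rewrite ge0_fin_numE// eLp_norm_ge0. Qed.

Lemma measurable_scalar_funD (f g : T -> K) : measurable_scalar_fun f ->
  measurable_scalar_fun g -> measurable_scalar_fun (f \+ g).
Proof.
move=> [fr fi] [gr gi]; split.
- rewrite (_ : _ \o _ = (@scalar_Re R k \o f) \+ (@scalar_Re R k \o g)).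
    exact: measurable_funD.
  by apply/funext => x /=; rewrite scalar_ReD.
- rewrite (_ : _ \o _ = (@scalar_Im R k \o f) \+ (@scalar_Im R k \o g)).
    exact: measurable_funD.
  by apply/funext => x /=; rewrite scalar_ImD.
Qed.

Lemma measurable_scalar_funZ (a : K) (f : T -> K) : measurable_scalar_fun f ->
  measurable_scalar_fun (fun x => a * f x).
Proof.
move=> [fr fi]; split.
- rewrite (_ : _ \o _ = fun x => scalar_Re a * (@scalar_Re R k \o f) x
      - scalar_Im a * (@scalar_Im R k \o f) x).
    by apply: measurable_funB; exact: measurable_funM.
  by apply/funext => x /=; rewrite scalar_ReM.
- rewrite (_ : _ \o _ = fun x => scalar_Re a * (@scalar_Im R k \o f) x
      + scalar_Im a * (@scalar_Re R k \o f) x).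
    by apply: measurable_funD; exact: measurable_funM.
  by apply/funext => x /=; rewrite scalar_ImM.
Qed.

Lemma eLp_normD (f g : T -> K) : measurable_scalar_fun f ->
  measurable_scalar_fun g ->
  (eLp_norm (f \+ g)%R <= eLp_norm f + eLp_norm g)%E.
Proof.
move=> mf mg.
have mf' := measurable_modulus mf; have mg' := measurable_modulus mg.
apply: le_trans (minkowski_EFin mu mf' mg' p1).
apply: le_Lnorm.
- exact/measurable_modulus/measurable_scalar_funD.
- exact: measurable_funD.
- by move=> x /=; rewrite modulus_ge0 modulusD.
Qed.

Let p1E : (1 <= p%:E)%E. Proof. by rewrite lee_fin. Qed.

Lemma eLp_normZ (a : K) (f : T -> K) : is_Lp_fun f ->
  (eLp_norm (fun x => a * f x)%R = (modulus a)%:E * eLp_norm f)%E.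
Proof.
move=> [mf fp].
have absf : (@modulus R k \o f) \in Lfun mu p%:E.
  rewrite inE; apply/andP; split; rewrite inE//=.
  exact: measurable_modulus.
have := LnormZ (Lfun_Sub p1E absf) (modulus a).
rewrite (ger0_norm (modulus_ge0 a)) Lfun_valP => <-.
by congr Lnorm; apply/funext => x /=; rewrite modulusM.
Qed.

Lemma Lp_fun_submod_closed : submod_closed (Lp_fun_pred p1).
Proof.
split=> [|a f g /asboolP[mf fp] /asboolP[mg gp]]; apply/asboolP.
  split.
    by split; rewrite [X in measurable_fun _ X](_ : _ = cst 0)//;
      apply/funext => x /=; case: (k).
  rewrite /eLp_norm (_ : _ \o _ = cst 0%E) ?Lnorm0//.
    by rewrite gt_eqF// lte_fin (lt_le_trans ltr01).
  by apply/funext => x /=; rewrite modulus0.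
have mZ := measurable_scalar_funZ a mf.
split; first exact: (measurable_scalar_funD mZ mg).
apply: (le_lt_trans (eLp_normD mZ mg)).
by rewrite eLp_normZ// lte_add_pinfty// lte_mul_pinfty// lee_fin modulus_ge0.
Qed.

HB.instance Definition _ := GRing.isSubmodClosed.Build K (T -> K) (Lp_fun_pred p1)
  Lp_fun_submod_closed.

Record Lp_fun := MkLpFun { Lp_fun_val :> T -> K; _ : Lp_fun_val \in Lp_fun_pred p1 }.

HB.instance Definition _ := [isSub for Lp_fun_val].
HB.instance Definition _ := [Choice of Lp_fun by <:].
HB.instance Definition _ := [SubChoice_isSubLmodule of Lp_fun by <:].

End Lp_functions.

Section Lp_space.
Context d (T : measurableType d) (R : realType) (k : scalar_kind).
Variables (mu : {measure set T -> \bar R}) (p : R) (p1 : 1 <= p).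
Local Notation K := (scalars R k).
Local Notation V := (Lp_fun k mu p1).

Definition Lp_null : {pred V} := fun f => `[< {ae mu, forall x, f x = 0} >].

Lemma Lp_null_zmod_closed : zmod_closed Lp_null.
Proof.
split=> [|f g /asboolP f0 /asboolP g0]; apply/asboolP; first exact: aeW.
by apply: filterS2 f0 g0 => x fx gx; rewrite (_ : (f - g) x = f x - g x)// fx gx subr0.
Qed.

HB.instance Definition _ :=
  GRing.isZmodClosed.Build V Lp_null Lp_null_zmod_closed.

(* L_p(mu): p-integrable functions modulo equality almost everywhere. *)
Definition Lp : Type := @Quotient.quot V Lp_null.
HB.instance Definition _ := GRing.Zmodule.on Lp.

Definition Lp_class (f : V) : Lp := (\pi_Lp f)%qT.
Definition Lp_repr (x : Lp) : V := repr x.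

Lemma Lp_reprK : cancel Lp_repr Lp_class.
Proof. exact: reprK. Qed.

Lemma Lp_classP (f g : V) :
  Lp_class f = Lp_class g <-> {ae mu, forall x, f x = g x}.
Proof.
split=> [/eqP|fg].
  rewrite -[_ == _]Quotient.idealrBE => /asboolP.
  apply: filterS => x; rewrite (_ : (f - g) x = f x - g x)// => /eqP.
  by rewrite subr_eq0 => /eqP.
apply/eqP; rewrite -[_ == _]Quotient.idealrBE; apply/asboolP.
by apply: filterS fg => x fx; rewrite (_ : (f - g) x = f x - g x)// fx subrr.
Qed.

Lemma Lp_class_repr (f : V) : {ae mu, forall x, Lp_repr (Lp_class f) x = f x}.
Proof. by apply/Lp_classP; rewrite Lp_reprK. Qed.

Lemma Lp_classD : {morph Lp_class : f g / f + g}.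
Proof. by move=> f g; rewrite /Lp_class raddfD. Qed.

Lemma Lp_class0 : Lp_class 0 = 0.
Proof. by rewrite /Lp_class raddf0. Qed.

Definition Lp_scale (a : K) (x : Lp) : Lp := Lp_class (a *: Lp_repr x).

Lemma Lp_classZ a f : Lp_class (a *: f) = Lp_scale a (Lp_class f).
Proof.
apply/Lp_classP; apply: filterS (Lp_class_repr f) => x fx.
by rewrite -[RHS]/(a * Lp_repr (Lp_class f) x) fx.
Qed.

Let Lp_scaleA a b x : Lp_scale a (Lp_scale b x) = Lp_scale (a * b) x.
Proof. by rewrite [Lp_scale b x]/Lp_scale -Lp_classZ scalerA. Qed.
Let Lp_scale1 : left_id 1 Lp_scale.
Proof. by move=> x; rewrite /Lp_scale scale1r Lp_reprK. Qed.
Let Lp_scaleDr : right_distributive Lp_scale +%R.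
Proof.
move=> a x y; rewrite -[x]Lp_reprK -[y]Lp_reprK -Lp_classD.
by rewrite -!Lp_classZ scalerDr Lp_classD.
Qed.
Let Lp_scaleDl x : {morph Lp_scale^~ x : a b / a + b}.
Proof. by move=> a b; rewrite /Lp_scale scalerDl Lp_classD. Qed.

HB.instance Definition _ := GRing.Zmodule_isLmodule.Build K Lp
  Lp_scaleA Lp_scale1 Lp_scaleDr Lp_scaleDl.

Definition Lp_norm (x : Lp) : R := fine (eLp_norm mu p (Lp_repr x)).

Lemma Lp_funP (f : V) : is_Lp_fun mu p f.
Proof. by case: f => f /= /asboolP. Qed.

Lemma eLp_norm_eq (f g : V) : {ae mu, forall x, f x = g x} ->
  eLp_norm mu p f = eLp_norm mu p g.
Proof.
move=> fg; rewrite /eLp_norm unlock /Lnorm; congr (_ `^ _)%E.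
have mpow (h : V) :
    measurable_fun setT (fun x => `|(EFin \o (@modulus R k \o h)) x| `^ p)%E.
  apply/measurable_EFinP.
  apply: (@measurableT_comp _ _ _ _ _ _ (@powR R ^~ p)) => //.
  apply: measurableT_comp => //; apply: measurable_modulus.
  by have [] := Lp_funP h.
apply: ae_eq_integral => //.
by apply: filterS fg => x /= ->.
Qed.

Lemma Lp_norm_class f : Lp_norm (Lp_class f) = fine (eLp_norm mu p f).
Proof. by congr fine; apply: eLp_norm_eq; exact: Lp_class_repr. Qed.

Lemma Lp_normE (x : Lp) : (Lp_norm x)%:E = eLp_norm mu p (Lp_repr x).
Proof. by rewrite fineK// eLp_norm_fin//; exact: Lp_funP. Qed.

Lemma Lp_normD x y : Lp_norm (x + y) <= Lp_norm x + Lp_norm y.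
Proof.
rewrite -[x]Lp_reprK -[y]Lp_reprK -Lp_classD !Lp_norm_class.
have [mx _] := Lp_funP (Lp_repr x); have [my _] := Lp_funP (Lp_repr y).
rewrite -lee_fin EFinD !fineK; try by apply: eLp_norm_fin; exact: Lp_funP.
exact: eLp_normD.
Qed.

Lemma Lp_normZ a x : Lp_norm (a *: x) = modulus a * Lp_norm x.
Proof.
rewrite /Lp_norm [a *: x]/(Lp_scale a x) -/(Lp_norm _) Lp_norm_class.
by rewrite [eLp_norm _ _ _]eLp_normZ ?fineM//; try (apply: eLp_norm_fin);
  exact: Lp_funP.
Qed.

Lemma Lp_norm_eq0 x : Lp_norm x = 0 -> x = 0.
Proof.
move=> x0; rewrite -[x]Lp_reprK -Lp_class0; apply/Lp_classP.
have := Lp_normE x; rewrite x0 => /esym.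
move=> /Lnorm_eq0_eq0 h; have [mx _] := Lp_funP (Lp_repr x).
have : (EFin \o (@modulus R k \o Lp_repr x)) = cst 0%E %[ae mu].
  apply: h; last by rewrite lte_fin (lt_le_trans ltr01).
  by apply/measurable_EFinP; exact: measurable_modulus.
by apply: filterS => t /(_ I)[]; exact: modulus_eq0.
Qed.

(* The norm of a normed module over the scalars is scalar-valued, hence the
   injection scalar_of. *)
Let Lp_ler_normD (x y : Lp) : scalar_of k (Lp_norm (x + y)) <=
  scalar_of k (Lp_norm x) + scalar_of k (Lp_norm y).
Proof. by rewrite -scalar_ofD scalar_of_le Lp_normD. Qed.
Let Lp_normrZ (a : K) (x : Lp) :
  scalar_of k (Lp_norm (a *: x)) = `|a| * scalar_of k (Lp_norm x).
Proof. by rewrite Lp_normZ scalar_ofM scalar_of_modulus. Qed.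
Let Lp_normr0_eq0 (x : Lp) : scalar_of k (Lp_norm x) = 0 -> x = 0.
Proof.
rewrite -(scalar_of0 R k) => /(can_inj (@scalar_ofK _ _)); exact: Lp_norm_eq0.
Qed.

HB.instance Definition _ := Lmodule_isNormed.Build K Lp
  Lp_ler_normD Lp_normrZ Lp_normr0_eq0.

End Lp_space.

Coercion Lp_repr : Lp >-> Lp_fun.

Notation Rd R d := (d.-tuple (measurableTypeR R)).

(* Borel-measurable representatives suffice: every Lebesgue-measurable function
   agrees almost everywhere with a Borel one. *)
Notation LpRd R k d p1 := (@Lp _ (Rd R d) R k (lebesgue_tuple R d) _ p1).

(* Sequences indexed by nat; see ellp_eqP and ellp_normE. *)
Notation ellp R k p1 := (@Lp _ nat R k (@counting nat R) _ p1).

Lemma ellp_eqP (R : realType) (k : scalar_kind) (p : R) (p1 : 1 <= p)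
  (x y : ellp R k p1) : x = y <-> forall i, x i = y i.
Proof.
rewrite -{1}[x]Lp_reprK -{1}[y]Lp_reprK Lp_classP.
split=> [[A [_ A0 xyA]] i|xy]; last exact: aeW.
apply: contrapT => /xyA Ai; move: A0; rewrite /= /counting.
case: ifPn => [/asboolP fA /eqP|_ //].
rewrite eqe pnatr_eq0 finmap.cardfs_eq0 => /eqP A0.
by have := @in_fset_set _ A fA i; rewrite A0 inE mem_set.
Qed.

Lemma ellp_normE (R : realType) (k : scalar_kind) (p : R) (p1 : 1 <= p)
  (x : ellp R k p1) : ((Lp_norm x)%:E =
    (\sum_(i <oo) (modulus (x i) `^ p)%:E) `^ p^-1)%E.
Proof.
rewrite Lp_normE /eLp_norm Lnorm_counting ?(lt_le_trans ltr01)//.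
congr (_ `^ _)%E; apply: eq_eseriesr => i _ /=.
by rewrite ger0_norm ?modulus_ge0.
Qed.

Section subspaces.
Context (K : numFieldType) (V : normedModType K).

Record closed_subspace := ClosedSubspace {
  csub_set : set V;
  csub_set0 : csub_set 0;
  csub_setP : forall (a : K) x y,
    csub_set x -> csub_set y -> csub_set (a *: x + y);
  csub_closed : closed csub_set }.

Variable X : closed_subspace.

Definition csub_pred : {pred V} := fun x => `[< csub_set X x >].

Lemma csub_submod_closed : submod_closed csub_pred.
Proof.
split=> [|a x y /asboolP xX /asboolP yX]; apply/asboolP; first exact: csub_set0.
exact: csub_setP.
Qed.

HB.instance Definition _ :=
  GRing.isSubmodClosed.Build K V csub_pred csub_submod_closed.

(* The subspace as a normed module in its own right, with the induced norm. *)
Record csub_type := CSub { csub_val : V; _ : csub_val \in csub_pred }.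

HB.instance Definition _ := [isSub for csub_val].
HB.instance Definition _ := [Choice of csub_type by <:].
HB.instance Definition _ := [SubChoice_isSubLmodule of csub_type by <:].

Let csub_normD (x y : csub_type) :
  `|csub_val (x + y)| <= `|csub_val x| + `|csub_val y|.
Proof. exact: ler_normD. Qed.
Let csub_normZ a (x : csub_type) : `|csub_val (a *: x)| = `|a| * `|csub_val x|.
Proof. exact: normrZ. Qed.
Let csub_norm_eq0 (x : csub_type) : `|csub_val x| = 0 -> x = 0.
Proof. by move=> /normr0_eq0 x0; exact/val_inj. Qed.

HB.instance Definition _ :=
  Lmodule_isNormed.Build K csub_type csub_normD csub_normZ csub_norm_eq0.

End subspaces.

Coercion csub_type : closed_subspace >-> Sortclass.

Section operators.
Context (K : numFieldType).
Implicit Types U V W : normedModType K.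

Definition finite_dimensional V : Prop :=
  exists (n : nat) (v : 'I_n -> V),
    forall x, exists a : 'I_n -> K, x = \sum_(i < n) a i *: v i.

Definition bounded_op V W (T : V -> W) : Prop :=
  exists M : K, forall x, `|T x| <= M * `|x|.

Definition isomorphism V W (T : {linear V -> W}) : Prop :=
  bounded_op T /\
  exists T' : W -> V, [/\ cancel T T', cancel T' T & bounded_op T'].

Definition isomorphic V W : Prop := exists T : {linear V -> W}, isomorphism T.

Definition complemented V (Y : closed_subspace V) : Prop :=
  exists P : {linear V -> V}, [/\ bounded_op P,
    forall x, csub_set Y (P x) & forall y, csub_set Y y -> P y = y].

(* Every rearrangement of the series converges. *)
Definition unconditionally_convergent V (u : nat -> V) : Prop :=
  forall s : nat -> nat, bijective s -> cvgn (series (u \o s)).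

End operators.

Section frames.
Context (R : realType) (k : scalar_kind) (X : normedModType (scalars R k)).
Local Notation K := (scalars R k).

Record dual_space := Dual {
  dual_val :> {scalar X};
  dual_bounded : exists M : K, forall x, `|dual_val x| <= M * `|x| }.

(* The norm of X as a real number. *)
Definition rnorm (x : X) : R := scalar_Re `|x|.

(* The set is bounded above by dual_bounded, so sup is not a junk value. *)
Definition dual_norm (f : dual_space) : R :=
  sup [set modulus (f x) | x in [set x | rnorm x <= 1]].

Definition dual_seminormalized (F : nat -> dual_space) : Prop :=
  exists r s : R, 0 < r /\ r <= s /\ forall i, r <= dual_norm (F i) <= s.

Definition upper_lp_estimate (p : R) (f : nat -> X) : Prop :=
  exists M0 : R, 0 < M0 /\ forall (n : nat) (a : 'I_n -> K),
    rnorm (\sum_(i < n) a i *: f i) <=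
      M0 * (\sum_(i < n) modulus (a i) `^ p) `^ p^-1.

Variables (f : nat -> X) (f' : nat -> dual_space).

Definition frame_term (g : X) : nat -> X := fun i => f' i g *: f i.

Definition schauder_frame : Prop :=
  forall g, series (frame_term g) @ \oo --> g.

Definition approximate_schauder_frame : Prop :=
  exists S : {linear X -> X}, isomorphism S /\
    forall g, series (frame_term g) @ \oo --> S g.

Definition unconditional_frame : Prop :=
  forall g, unconditionally_convergent (frame_term g).

End frames.

Section translates.
Context (R : realType) (k : scalar_kind) (d : nat) (p : R) (p1 : 1 <= p).
Local Notation L := (LpRd R k d p1).

(* h = T_lambda g as classes. Functions are applied through representatives; the
   choice is immaterial since Lebesgue measure is translation invariant. *)
Definition is_translate (lambda : Rd R d) (g h : L) : Prop :=
  {ae lebesgue_tuple R d,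
    forall x, h x = g [tuple tnth x i - tnth lambda i | i < d]}.

Definition translates_of (k0 : nat) (g : 'I_k0 -> L) (lambda : nat -> Rd R d)
    (f : nat -> L) : Prop :=
  forall i, exists j, is_translate (lambda i) (g j) (f i).

Definition sequence_of_translates (f : nat -> L) : Prop :=
  exists (k0 : nat) (g : 'I_k0 -> L) (lambda : nat -> Rd R d),
    [/\ injective g, forall j, g j != 0 & translates_of g lambda f].

End translates.

(* Main.v *)
From HB Require Import structures.
Require Import Defs.
From mathcomp Require Import all_boot all_order all_algebra.
From mathcomp Require Import complex ring lra.
From mathcomp Require Import all_classical all_reals all_analysis measurable_realfun.

Set Implicit Arguments.
Unset Strict Implicit.
Unset Printing Implicit Defensive.

Import Order.TTheory GRing.Theory Num.Theory.
Import numFieldNormedType.Exports.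
Local Open Scope classical_set_scope.
Local Open Scope ring_scope.

(** Let (f, f') be the given unconditional approximate frame of X, a subspace of
L_p with 1 < p <= 2.

A frame with seminormalized functionals has an upper estimate. L_p satisfies
Clarkson's inequality, so it has type p with constant 1 (clarkson_type): the
average over signs of the p-th power of the norm of a signed sum is at most the
sum of the p-th powers of the norms. Choose vectors y j with F j (y j) = a j and
norm of the order of the modulus of a j. By orthogonality of signs, averaging the
expansions, with the signs e i as multipliers, of the signed sums of the y j gives
the sum of the a i f i (sign_sum_diagonal); the uniform boundedness principle
bounds each expansion, and type p bounds the average
(seminormalized_upper_estimate).

An upper estimate forces a lower estimate on the coordinates f' i g, and this is
where translates and 1 < p come in. For a nonzero function g, some box has a
nonzero integral of g, and translates of g by close vectors have nearly the same
integral over it; they do not cancel, so N of them have a sum of norm at least of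
order N (close_translates). The upper estimate allows only the power 1 / p of N,
which bounds the number of close translates (few_close_translates). Now take a small
cube on which g has mass: its translates overlap boundedly often, so at each point
the number of terms whose cube is active is bounded. Hence, up to a constant, the
sum of the p-th powers of the coefficients is at most the average over signs of the
p-th power of the norm of the signed sum (translates_lower_estimate). As the frame
is unconditional, its expansions satisfy
  sum_i |f' i g|^p <= C^p |g|^p          (frame_lower_estimate).

With both estimates, analysis T : X -> l_p and synthesis V : l_p -> X are bounded
and V T is the frame operator S. So T is an isomorphism onto a complemented
subspace of l_p (frame_complemented), which is isomorphic to l_p by Pelczynski's
theorem (complemented_isomorphic): a gliding hump argument embeds l_p as a
complemented subspace of X (complemented_copy), and a swindle with infinitely many
copies of l_p finishes (pelczynski_decomposition).

It remains to find a seminormalized sequence of functionals. Any bounded right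
inverse of V provides functionals, namely its coordinates, and the series then
converges unconditionally by the upper estimate alone. The right inverse T S^-1 is
bounded, but its coordinates may be small. Since X is isomorphic to l_p there is
room to change it, by an operator with values in the kernel of V, so that all
coordinates become bounded below (frame_seminormalized). *)

(** * Real-valued norms and bounded operators *)

Section real_norm.
Context (R : realType) (k : scalar_kind).
Local Notation K := (scalars R k).
Implicit Types (U V W : normedModType K).

Lemma scalar_of_lt : {mono @scalar_of R k : x y / x < y}.
Proof. by case: k => //= x y; rewrite ltcE/= eqxx. Qed.

Lemma rnorm_of V (x : V) : scalar_of k (rnorm x) = `|x|.
Proof.
have := normr_ge0 x; rewrite /rnorm; move: `|x|.
by case: (k) => //= -[a b]; rewrite lecE /= => /andP[/eqP -> _].
Qed.

Lemma modulusN (a : K) : modulus (- a) = modulus a.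
Proof. by rewrite /modulus normrN. Qed.

Lemma modulus1 : modulus (1 : K) = 1.
Proof. by rewrite /modulus normr1; case: (k). Qed.

Lemma modulus_nat n : modulus (n%:R : K) = n%:R.
Proof.
rewrite /modulus normr_nat; elim: n => [|n IH]; first by case: (k).
by rewrite -!natr1 scalar_ReD IH; case: (k).
Qed.

Lemma modulus_of (r : R) : modulus (scalar_of k r) = `|r|.
Proof.
by rewrite modulusE; case: (k) => /=; rewrite ?expr0n/= addr0 sqrtr_sqr.
Qed.

Lemma scalar_of1 : scalar_of k 1 = 1 :> K. Proof. by case: (k). Qed.

Lemma scalar_ofV (r : R) : scalar_of k r^-1 = (scalar_of k r)^-1 :> K.
Proof.
have [->|r0] := eqVneq r 0; first by rewrite invr0 scalar_of0 invr0.
have h : scalar_of k r * scalar_of k r^-1 = 1 :> K.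
  by rewrite -scalar_ofM divff// scalar_of1.
have r0' : scalar_of k r != 0 :> K.
  by apply/eqP => h0; move: h; rewrite h0 mul0r => /eqP; rewrite eq_sym oner_eq0.
by rewrite -[LHS]mul1r -{1}(mulVf r0') -mulrA h mulr1.
Qed.

Lemma modulusV (a : K) : modulus a^-1 = (modulus a)^-1.
Proof.
by apply: (can_inj (@scalar_ofK R k)); rewrite scalar_ofV !scalar_of_modulus normfV.
Qed.

Lemma modulus_gt0 (a : K) : a != 0 -> 0 < modulus a.
Proof.
move=> a0; rewrite lt_neqAle modulus_ge0 andbT eq_sym.
by apply: contra a0 => /eqP/modulus_eq0 ->.
Qed.

Lemma rnorm_ge0 V (x : V) : 0 <= rnorm x.
Proof. by rewrite -(scalar_of_le k) rnorm_of scalar_of0. Qed.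

Lemma rnormD V (x y : V) : rnorm (x + y) <= rnorm x + rnorm y.
Proof. by rewrite -(scalar_of_le k) scalar_ofD !rnorm_of ler_normD. Qed.

Lemma rnormZ V (a : K) (x : V) : rnorm (a *: x) = modulus a * rnorm x.
Proof.
apply: (can_inj (@scalar_ofK R k)).
by rewrite scalar_ofM scalar_of_modulus !rnorm_of normrZ.
Qed.

Lemma rnormN V (x : V) : rnorm (- x) = rnorm x.
Proof. by rewrite /rnorm normrN. Qed.

Lemma rnormBC V (x y : V) : rnorm (x - y) = rnorm (y - x).
Proof. by rewrite -rnormN opprB. Qed.

Lemma rnorm0 V : rnorm (0 : V) = 0.
Proof. by rewrite /rnorm normr0; case: (k). Qed.

Lemma rnorm_eq0 V (x : V) : rnorm x = 0 -> x = 0.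
Proof. by move=> x0; apply/normr0_eq0; rewrite -rnorm_of x0 scalar_of0. Qed.

Lemma rnorm_gt0 V (x : V) : x != 0 -> 0 < rnorm x.
Proof.
move=> x0; rewrite lt_neqAle rnorm_ge0 andbT eq_sym.
by apply: contra x0 => /eqP/rnorm_eq0 ->.
Qed.

Lemma rnorm_sum V I (r : seq I) (P : pred I) (F : I -> V) :
  rnorm (\sum_(i <- r | P i) F i) <= \sum_(i <- r | P i) rnorm (F i).
Proof.
elim/big_rec2: _ => [|i y x _ IH]; first by rewrite rnorm0.
by rewrite (le_trans (rnormD _ _))// lerD2l.
Qed.

Lemma modulus_sum I (r : seq I) (P : pred I) (F : I -> K) :
  modulus (\sum_(i <- r | P i) F i) <= \sum_(i <- r | P i) modulus (F i).
Proof.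
elim/big_rec2: _ => [|i y x _ IH]; first by rewrite modulus0.
by rewrite (le_trans (modulusD _ _))// lerD2l.
Qed.

(** The norm of a normed module takes values in its scalars. Convergence, Cauchy
sequences and completeness are phrased with its real value, so that real and
complex spaces are treated alike. *)
Definition rcvg V (u : nat -> V) (l : V) : Prop :=
  forall e : R, 0 < e -> exists N, forall n, (N <= n)%N -> rnorm (u n - l) < e.

Lemma rcvgP V (u : nat -> V) (l : V) : u @ \oo --> l <-> rcvg u l.
Proof.
split=> [/cvgrPdist_lt ul e e0|ul].
  have /ul[N _ uN] : (0 : K) < scalar_of k e by rewrite -(scalar_of0 R k) scalar_of_lt.
  by exists N => n /uN /=; rewrite rnormBC -rnorm_of scalar_of_lt.
apply/cvgrPdist_lt => e e0.
have eE : scalar_of k (scalar_Re e) = e.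
  move: e e0; case: (k) => //= -[a b].
  by rewrite ltcE /= => /andP[/eqP -> _].
have [|N uN] := ul (scalar_Re e).
  by rewrite -scalar_of_lt scalar_of0 eE.
by exists N => // n /= /uN; rewrite -(scalar_of_lt) eE rnorm_of distrC.
Qed.

Definition rcauchy V (u : nat -> V) : Prop := forall e : R, 0 < e ->
  exists N, forall m n, (N <= m)%N -> (N <= n)%N -> rnorm (u m - u n) < e.

Definition rcomplete V : Prop :=
  forall u : nat -> V, rcauchy u -> exists l, rcvg u l.

Lemma rcvg_cauchy V (u : nat -> V) l : rcvg u l -> rcauchy u.
Proof.
move=> ul e e0; have [|N uN] := ul (e / 2); first by rewrite divr_gt0.
exists N => m n /uN um /uN un.
rewrite -(subrKA l) (le_lt_trans (rnormD _ _))// [e]splitr ltrD//.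
by rewrite rnormBC.
Qed.

Lemma rcvg_le V (u : nat -> V) l y c N : rcvg u l ->
  (forall n, (N <= n)%N -> rnorm (u n - y) <= c) -> rnorm (l - y) <= c.
Proof.
move=> ul uc; apply/ler_addgt0Pl => e /ul[M uM].
rewrite -(subrKA (u (maxn M N))) (le_trans (rnormD _ _))// lerD//.
  by rewrite ltW// rnormBC uM// leq_maxl.
by apply: uc; rewrite leq_maxr.
Qed.

Lemma rcvg_unique V (u : nat -> V) l l' : rcvg u l -> rcvg u l' -> l = l'.
Proof.
move=> ul ul'; apply/eqP; rewrite -subr_eq0; apply/eqP/rnorm_eq0.
apply/eqP; rewrite eq_le rnorm_ge0 andbT; apply/ler_addgt0Pl => e e0.
rewrite addr0; have [N uN] := ul' e e0.
by apply: (rcvg_le ul) => n /uN/ltW; exact.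
Qed.

Lemma rcvgD V (u v : nat -> V) l l' : rcvg u l -> rcvg v l' ->
  rcvg (fun n => u n + v n) (l + l').
Proof.
move=> ul vl e e0; have e20 : 0 < e / 2 by rewrite divr_gt0.
have [N uN] := ul _ e20; have [M vM] := vl _ e20.
exists (maxn N M) => n; rewrite geq_max => /andP[/uN un /vM vn].
rewrite opprD addrACA (le_lt_trans (rnormD _ _))// [e]splitr ltrD//.
Qed.

Lemma rcvgZ V (u : nat -> V) l a : rcvg u l -> rcvg (fun n => a *: u n) (a *: l).
Proof.
move=> ul e e0; have [|N uN] := ul (e / (modulus a + 1)).
  by rewrite divr_gt0// ltr_wpDl// modulus_ge0.
have a1 : 0 < modulus a + 1 by rewrite ltr_wpDl// modulus_ge0.
exists N => n /uN; rewrite -scalerBr rnormZ ltr_pdivlMr// => h.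
apply: le_lt_trans h; rewrite mulrC ler_wpM2l ?rnorm_ge0// lerDl//.
Qed.

Definition linop V W (T : V -> W) := forall a x y, T (a *: x + y) = a *: T x + T y.

(** Linearity and boundedness are carried by a predicate on plain functions, so
that operators obtained by choice, as inverses or as pointwise limits need no
bundling. *)
Definition bop V W (T : V -> W) : Prop :=
  linop T /\ exists2 M : R, 0 <= M & forall x, rnorm (T x) <= M * rnorm x.

Lemma scalar_of_leM (M : K) (r s : R) :
  scalar_of k r <= M * scalar_of k s -> r <= scalar_Re M * s.
Proof.
by move: M; case: (k) => [//|[a b]] /=; rewrite lecE /= !mulr0 subr0 => /andP[].
Qed.

Lemma bounded_opP V W (T : V -> W) : bounded_op T <->
  exists2 M : R, 0 <= M & forall x, rnorm (T x) <= M * rnorm x.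
Proof.
split=> [[M TM]|[M M0 TM]]; last first.
  by exists (scalar_of k M) => x; rewrite -!rnorm_of -scalar_ofM scalar_of_le.
exists `|scalar_Re M|; first exact: normr_ge0.
move=> x; apply: (@le_trans _ _ (scalar_Re M * rnorm x)); last first.
  by rewrite ler_wpM2r ?rnorm_ge0// ler_norm.
by apply: scalar_of_leM; rewrite !rnorm_of.
Qed.

Section linop_theory.
Context (V W : normedModType K) (T : V -> W) (lT : linop T).
Lemma linop0 : T 0 = 0.
Proof. by have := lT (-1) 0 0; rewrite addr0 scaler0 scaleN1r addNr. Qed.
Lemma linopD x y : T (x + y) = T x + T y.
Proof. by have := lT 1 x y; rewrite !scale1r. Qed.
Lemma linopZ a x : T (a *: x) = a *: T x.
Proof. by have := lT a x 0; rewrite !addr0 linop0 addr0. Qed.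
Lemma linopN x : T (- x) = - T x.
Proof. by rewrite -scaleN1r linopZ scaleN1r. Qed.
Lemma linopB x y : T (x - y) = T x - T y.
Proof. by rewrite linopD linopN. Qed.
Lemma linop_sum I (r : seq I) (P : pred I) (F : I -> V) :
  T (\sum_(i <- r | P i) F i) = \sum_(i <- r | P i) T (F i).
Proof. by apply: (big_morph T linopD linop0). Qed.

Definition linop_linear : {linear V -> W} :=
  HB.pack T (GRing.isLinear.Build K V W *:%R T lT).
End linop_theory.

Lemma linear_linop V W (T : {linear V -> W}) : linop T.
Proof. by move=> a x y; rewrite linearP. Qed.

Lemma bop_id V : bop (@id V).
Proof. by split=> //; exists 1 => // x; rewrite mul1r. Qed.

Lemma bop_comp V W U (S : W -> U) (T : V -> W) :
  bop S -> bop T -> bop (fun x => S (T x)).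
Proof.
move=> [lS [M M0 SM]] [lT [N N0 TN]]; split=> [a x y|]; first by rewrite lT lS.
exists (M * N) => [|x]; first exact: mulr_ge0.
by rewrite (le_trans (SM _))// -mulrA ler_wpM2l.
Qed.

Lemma bopD V W (S T : V -> W) : bop S -> bop T -> bop (fun x => S x + T x).
Proof.
move=> [lS [M M0 SM]] [lT [N N0 TN]]; split=> [a x y|].
  by rewrite lS lT scalerDr addrACA.
exists (M + N) => [|x]; first exact: addr_ge0.
by rewrite (le_trans (rnormD _ _))// mulrDl lerD.
Qed.

Lemma bopZ V W (T : V -> W) (a : K) : bop T -> bop (fun x => a *: T x).
Proof.
move=> [lT [N N0 TN]]; split=> [b x y|].
  by rewrite lT scalerDr !scalerA mulrC.
exists (modulus a * N) => [|x]; first by rewrite mulr_ge0// modulus_ge0.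
by rewrite rnormZ -mulrA ler_wpM2l// modulus_ge0.
Qed.

Lemma bopB V W (S T : V -> W) : bop S -> bop T -> bop (fun x => S x - T x).
Proof.
move=> bS bT; have := bopD bS (bopZ (-1) bT).
by congr bop; apply/funext => x; rewrite scaleN1r.
Qed.

Lemma bop_sum V W I (r : seq I) (P : pred I) (T : I -> V -> W) :
  (forall i, P i -> bop (T i)) -> bop (fun x => \sum_(i <- r | P i) T i x).
Proof.
move=> bT; elim: r => [|i r IH].
  split=> [a x y|]; first by rewrite !big_nil scaler0 addr0.
  by exists 0 => // x; rewrite big_nil rnorm0 mul0r.
case Pi: (P i); last first.
  by rewrite (_ : (fun _ => _) = fun x => \sum_(j <- r | P j) T j x)//;
    apply/funext => x; rewrite big_cons Pi.
rewrite (_ : (fun _ => _) = fun x => T i x + \sum_(j <- r | P j) T j x).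
  by apply: bopD => //; exact: bT.
by apply/funext => x; rewrite big_cons Pi.
Qed.

Lemma bop_cvg V W (T : V -> W) u l : bop T -> rcvg u l ->
  rcvg (fun n => T (u n)) (T l).
Proof.
move=> [lT [M M0 TM]] ul e e0; have M1 : 0 < M + 1 by rewrite ltr_wpDl.
have [|N uN] := ul (e / (M + 1)); first by rewrite divr_gt0.
exists N => n /uN; rewrite ltr_pdivlMr// -(linopB lT) => h.
rewrite (le_lt_trans (TM _))// (le_lt_trans _ h)// mulrC ler_wpM2l ?rnorm_ge0//.
by rewrite lerDl.
Qed.

Lemma geometric_step V (u : nat -> V) (c : R) :
  (forall n, rnorm (u n.+1 - u n) <= c / 2 ^+ n) ->
  forall m n, (n <= m)%N -> rnorm (u m - u n) <= 2 * c / 2 ^+ n.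
Proof.
move=> uc m n nm; have c0 : 0 <= c.
  by have := uc 0%N; rewrite expr0 divr1; apply: le_trans; rewrite rnorm_ge0.
suff h : rnorm (u m - u n) <= 2 * c / 2 ^+ n - 2 * c / 2 ^+ m.
  by rewrite (le_trans h)// gerBl divr_ge0// mulr_ge0.
move: nm => /subnKC <-; elim: (m - n)%N => [|i IH].
  by rewrite addn0 !subrr rnorm0.
rewrite addnS -(subrKA (u (n + i)%N)) (le_trans (rnormD _ _))//.
rewrite (le_trans (lerD (uc _) IH))// exprS invfM.
have : 0 < (2 ^+ (n + i))^-1 :> R by rewrite invr_gt0 exprn_gt0.
by move: (_ ^-1) => z z0; nra.
Qed.

Lemma geometric_tail V (u : nat -> V) l (c : R) :
  (forall n, rnorm (u n.+1 - u n) <= c / 2 ^+ n) -> rcvg u l ->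
  forall n, rnorm (l - u n) <= 2 * c / 2 ^+ n.
Proof. by move=> uc ul n; apply: (rcvg_le (N := n) ul) => m; exact: geometric_step. Qed.

Lemma rcomplete_geometric V (u : nat -> V) (c : R) : rcomplete V ->
  (forall n, rnorm (u n.+1 - u n) <= c / 2 ^+ n) -> exists l, rcvg u l.
Proof.
move=> cV uc; apply: cV => e e0.
have c0 : 0 <= c.
  by have := uc 0%N; rewrite expr0 divr1; apply: le_trans; rewrite rnorm_ge0.
have [N cN] : exists N, 4 * c / 2 ^+ N < e.
  have /cvgrPdist_lt/(_ e e0)[N _ hN] : geometric (4 * c) (2^-1 : R) @ \oo --> 0.
    apply: cvg_geometric; rewrite ger0_norm ?invr_ge0// invf_lt1// ltr1n//.
  exists N; have := hN N (leqnn N); rewrite /= sub0r normrN.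
  by rewrite exprVn; apply: le_lt_trans; rewrite ler_norm.
have tail n : (N <= n)%N -> rnorm (u n - u N) <= 2 * c / 2 ^+ N.
  exact: geometric_step.
exists N => m n /tail hm /tail hn; rewrite -(subrKA (u N)).
rewrite rnormBC in hn; rewrite (le_lt_trans (rnormD _ _))//.
by apply: (le_lt_trans (lerD hm hn)); apply: le_lt_trans cN; lra.
Qed.

Lemma bop_inverse V W (T : V -> W) (c : R) : linop T -> 0 <= c ->
  (forall x, rnorm x <= c * rnorm (T x)) -> (forall y, exists x, T x = y) ->
  exists T' : W -> V, [/\ cancel T T', cancel T' T & bop T'].
Proof.
move=> lT c0 Tc /choice[T' T'K].
have inj : injective T.
  move=> x y Txy; apply/eqP; rewrite -subr_eq0; apply/eqP/rnorm_eq0/eqP.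
  rewrite eq_le rnorm_ge0 andbT (le_trans (Tc _))// linopB// Txy subrr.
  by rewrite rnorm0 mulr0.
exists T'; split=> //; first by move=> x; apply: inj; rewrite T'K.
split; last by exists c => // y; rewrite -{2}(T'K y).
by move=> a x y; apply: inj; rewrite lT !T'K.
Qed.

(** The solution of x + L x = y is the limit of the iteration x |-> y - L x,
which contracts by a factor 1/2. *)
Lemma bop_neumann V (L : V -> V) : rcomplete V -> linop L ->
  (forall x, rnorm (L x) <= rnorm x / 2) ->
  exists N : V -> V, [/\ cancel (fun x => x + L x) N,
    cancel N (fun x => x + L x) & bop N].
Proof.
move=> cV lL L2; apply: (@bop_inverse _ _ _ 2) => //.
- by move=> a x y; rewrite lL scalerDr addrACA.
- move=> x; have := rnormD (x + L x) (- L x); rewrite addrK rnormN.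
  by have := L2 x; lra.
move=> y; pose u := fix u n := if n is m.+1 then y - L (u m) else 0.
have [|x ux] := @rcomplete_geometric V u (rnorm y) cV.
  elim=> [|n IH].
    by rewrite /= linop0// !subr0 expr0 divr1.
  rewrite [u n.+2]/= [X in _ - X]/= opprD addrACA subrr add0r -opprD rnormN.
  by rewrite -linopB// (le_trans (L2 _))// exprSr invfM mulrA ler_wpM2r// invr_ge0.
exists x; have bL : bop L by split=> //; exists 2^-1 => // z; rewrite mulrC.
apply: (@rcvg_unique _ (fun n => u n.+1 + L (u n))); last first.
  by move=> e e0; exists 0%N => n _; rewrite /= subrK subrr rnorm0.
apply: rcvgD; last exact: bop_cvg.
by move=> e /ux[N uN]; exists N => n /leqW/uN.
Qed.

End real_norm.

(** * The uniform boundedness principle *)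

Section uniform_boundedness.
Context (R : realType) (k : scalar_kind).
Local Notation K := (scalars R k).
Implicit Types (U V W : normedModType K).

(** A proof without Baire category: of x + w and x - w, at least one has an image
under an operator T of norm at least that of T w. So if the family is unbounded,
one moves the centre of a ball of radius r by r to a point where the norm of
some member of the family exceeds n, and shrinks the ball so far that this
member varies by at most 1 on a concentric ball of twice the new radius. The
radii at least halve, so the limit of the centres lies in all the balls of twice
the radius, and there the family is unbounded. *)
Lemma uniform_boundedness V W (I : Type) (F : I -> V -> W) : rcomplete V ->
  (forall i, bop (F i)) ->
  (forall x, exists B, forall i, rnorm (F i x) <= B) ->
  exists2 C : R, 0 <= C & forall i x, rnorm (F i x) <= C * rnorm x.
Proof.
move=> cV bF ptF; apply: contrapT => unbounded.
have large (C : R) : 0 <= C -> exists i x, C * rnorm x < rnorm (F i x).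
  move=> C0; apply: contrapT => h; apply: unbounded; exists C => // i x.
  by rewrite leNgt; apply/negP => FC; apply: h; exists i, x.
have step (s : nat * (V * R)) : exists t : V * R, 0 < s.2.2 ->
    [/\ rnorm (t.1 - s.2.1) <= s.2.2, 0 < t.2, t.2 <= s.2.2 / 2 &
      exists i, s.1%:R < rnorm (F i t.1) /\
        forall y, rnorm y <= 2 * t.2 -> rnorm (F i y) <= 1].
  case: s => n [x r] /=; have [r0|] := boolP (0 < r); last by exists (x, r).
  have [|i [z]] := large (n%:R / r); first by rewrite divr_ge0// ltW.
  have [lF [M M0 FM]] := bF i => Fz.
  have z0 : 0 < rnorm z.
    apply: rnorm_gt0; apply: contraTneq Fz => ->.
    by rewrite linop0// !rnorm0 mulr0 ltxx.
  pose w := scalar_of k (r / rnorm z) *: z.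
  have rw : rnorm w = r.
    by rewrite rnormZ modulus_of ger0_norm ?divr_ge0 ?ltW// divfK// gt_eqF.
  have Fw : n%:R < rnorm (F i w).
    rewrite linopZ// rnormZ modulus_of ger0_norm ?divr_ge0 ?ltW//.
    move: Fz; rewrite -(ltr_pM2l (divr_gt0 r0 z0)); apply: le_lt_trans.
    rewrite le_eqVlt; apply/orP; left; apply/eqP; field.
    by rewrite !gt_eqF.
  pose r' := Order.min (r / 2) (1 / (2 * (M + 1))).
  have M1 : 0 < M + 1 by rewrite ltr_wpDl.
  have r'0 : 0 < r' by rewrite lt_min !divr_gt0// mulr_gt0.
  have small y : rnorm y <= 2 * r' -> rnorm (F i y) <= 1.
    move=> yr; rewrite (le_trans (FM _))//.
    have : r' <= 1 / (2 * (M + 1)) by rewrite ge_min lexx orbT.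
    rewrite ler_pdivlMr ?mulr_gt0// => h; have := rnorm_ge0 y; nra.
  have r'2 : r' <= r / 2 by rewrite ge_min lexx.
  have [h|h] := ltP n%:R (rnorm (F i (x + w))).
    by exists (x + w, r') => _ /=; split=> //; [rewrite addrAC subrr add0r rw|exists i].
  exists (x - w, r') => _ /=; split=> //.
    by rewrite addrAC subrr add0r rnormN rw.
  exists i; split=> //; rewrite ltNge; apply/negP => h'.
  have := rnormD (F i (x + w)) (- F i (x - w)).
  rewrite rnormN -linopB// opprB [x + w + _]addrC addrA subrK [F i (w + w)]linopD// => h2.
  have e2 : rnorm (F i w + F i w) = 2 * rnorm (F i w).
    by rewrite -mulr2n -scaler_nat rnormZ modulus_nat.
  have h3 := lerD h h'; lra.
have [next nextP] := choice step.
pose s := fix s n : V * R := if n is m.+1 then next (m, s m) else (0, 1).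
have s0 n : 0 < (s n).2.
  by elim: n => [|n IH] //=; have [] := nextP (n, s n) IH.
have sP n := nextP (n, s n) (s0 n).
have s2 n : (s n).2 <= 1 / 2 ^+ n.
  elim: n => [|n IH] /=; first by rewrite expr0 divr1.
  have [_ _ h _] := sP n; rewrite (le_trans h)// exprSr invfM mulrA.
  by rewrite ler_wpM2r// invr_ge0.
have [|x sx] := @rcomplete_geometric _ _ V (fun n => (s n).1) 1 cV.
  by move=> n; have [h _ _ _] := sP n; exact: le_trans h (s2 n).
have xs n : rnorm (x - (s n).1) <= 2 * (s n).2.
  apply: (@rcvg_le _ _ _ (fun n => (s n).1) _ _ _ n sx) => m /subnKC <-.
  suff : rnorm ((s (n + (m - n))%N).1 - (s n).1) <=
      2 * (s n).2 - 2 * (s (n + (m - n))%N).2.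
    by move/le_trans; apply; rewrite gerBl mulr_ge0// ltW.
  elim: (m - n)%N => [|i IH]; first by rewrite addn0 !subrr rnorm0.
  have [h1 _ h2 _] := sP (n + i)%N; rewrite addnS -(subrKA (s (n + i)%N).1).
  rewrite (le_trans (rnormD _ _))//.
  by move: h1 h2 IH => /=; set a := rnorm _; set b := rnorm _; lra.
have [B FB] := ptF x.
have [_ _ _ [i [Fi small]]] := sP `|Num.ceil (B + 1)|%N.
have := FB i; apply/negP; rewrite -ltNge.
have [lF _] := bF i.
have h1 := small _ (xs _.+1).
have h2 : B + 1 <= `|Num.ceil (B + 1)|%N%:R.
  rewrite -[X in _ <= X](mulr1z) -pmulrn natr_absz (le_trans (ceil_ge _))//.
  by rewrite ler_int ler_norm.
move: h1 Fi; set t := next _; rewrite -/t /= -/t linopB// => h1 Fi.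
have := rnormD (F i x) (- (F i x - F i t.1)).
rewrite rnormN opprB addrCA subrr addr0 => h3.
have : B + 1 < rnorm (F i t.1) by apply: le_lt_trans Fi.
lra.
Qed.

End uniform_boundedness.

(** * Unconditional convergence and averages over signs *)

Lemma block_index (N : nat -> nat) : N 0%N = 0%N -> (forall j, (N j < N j.+1)%N) ->
  forall i, exists j, (N j <= i < N j.+1)%N.
Proof.
move=> N0 NS i; have [m iN] : exists m, (i < N m)%N.
  exists i.+1; elim: i => [|i IH]; first by rewrite (leq_ltn_trans _ (NS 0%N)).
  by rewrite (leq_ltn_trans IH).
elim: m iN => [|j IH]; first by rewrite N0 ltn0.
by case: (leqP (N j) i) => [h1 h2|/IH//]; exists j; rewrite h1.
Qed.

Lemma block_index_unique (N : nat -> nat) : (forall j, (N j < N j.+1)%N) ->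
  forall i j j', (N j <= i < N j.+1)%N -> (N j' <= i < N j'.+1)%N -> j = j'.
Proof.
move=> NS i; have Nmon : {homo N : m n / (m <= n)%N}.
  by apply: homo_leq => // [a b c|j]; [exact: leq_trans|exact: ltnW].
suff H a b : (N a <= i < N a.+1)%N -> (N b <= i < N b.+1)%N -> (a <= b)%N.
  by move=> j j' h h'; apply/eqP; rewrite eqn_leq (H _ _ h h') (H _ _ h' h).
move=> /andP[h _] /andP[_ h']; rewrite leqNgt; apply/negP => /Nmon h2.
by have := leq_ltn_trans (leq_trans h2 h) h'; rewrite ltnn.
Qed.

Section unconditional.
Context (R : realType) (k : scalar_kind) (V : normedModType (scalars R k)).
Variable u : nat -> V.

(** If for every N some finite sum over indices beyond N has norm more than 1, then
bringing forward, in successive blocks, index sets with such sums gives a divergent rearrangement. *)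
Lemma unconditional_small_tails : unconditionally_convergent u ->
  exists N, forall n (P : pred nat), rnorm (\sum_(N <= i < n | P i) u i) <= 1.
Proof.
move=> uc; apply: contrapT => large.
have /choice[n_ /choice[P_ nP]] : forall N, exists n, exists P : pred nat,
    1 < rnorm (\sum_(N <= i < n | P i) u i).
  move=> N; apply: contrapT => h; apply: large; exists N => n P.
  by rewrite leNgt; apply/negP => nP; apply: h; exists n, P.
have n_gt N : (N < n_ N)%N.
  rewrite ltnNge; apply/negP => h; have := nP N.
  by rewrite big_geq// rnorm0 ltr10.
pose N := fix N j := if j is i.+1 then n_ (N i) else 0%N.
have NS j : (N j < N j.+1)%N by exact: n_gt.
have [J JP] := choice (block_index (erefl : N 0%N = 0%N) NS).
pose w j := let r := iota (N j) (N j.+1 - N j) in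
  [seq i <- r | P_ (N j) i] ++ [seq i <- r | predC (P_ (N j)) i].
have wperm j : perm_eq (w j) (iota (N j) (N j.+1 - N j)) by apply/permPl/perm_filterC.
have wsize j : size (w j) = (N j.+1 - N j)%N.
  by rewrite (perm_size (wperm j)) size_iota.
have wmem j i : (i \in w j) = (N j <= i < N j.+1)%N.
  by rewrite (perm_mem (wperm j)) mem_iota subnKC// ltnW.
have wuniq j : uniq (w j) by rewrite (perm_uniq (wperm j)) iota_uniq.
pose s i := nth 0%N (w (J i)) (i - N (J i)).
pose s' i := (N (J i) + index i (w (J i)))%N.
have sJ i : (N (J i) <= s i < N (J i).+1)%N.
  by rewrite -wmem mem_nth// wsize ltn_sub2r; have /andP[] := JP i.
have s'J i : (N (J i) <= s' i < N (J i).+1)%N.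
  by rewrite leq_addr -ltn_subRL -wsize index_mem wmem JP.
have JsE i : J (s i) = J i by exact: (block_index_unique NS (JP _) (sJ i)).
have Js'E i : J (s' i) = J i by exact: (block_index_unique NS (JP _) (s'J i)).
have bs : bijective s.
  exists s' => i.
    rewrite /s' JsE /s index_uniq ?wuniq//.
      by rewrite subnKC//; have /andP[] := JP i.
    by rewrite wsize ltn_sub2r; have /andP[] := JP i.
  by rewrite /s Js'E /s' addKn nth_index// wmem JP.
have /cvg_ex[l /rcvgP/rcvg_cauchy/(_ 1 ltr01)[M sM]] := uc s bs.
have NM : (M <= N M)%N by elim: (M) => // i /leq_ltn_trans; apply.
pose c := size [seq i <- iota (N M) (N M.+1 - N M) | P_ (N M) i].
have cle : (c <= N M.+1 - N M)%N.
  by rewrite /c size_filter (leq_trans (count_size _ _))// size_iota.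
have := sM (N M + c)%N (N M) (leq_trans NM (leq_addr _ _)) NM.
rewrite sub_series_geq ?leq_addr//; apply/negP; rewrite -leNgt ltW//.
rewrite (_ : \sum_(N M <= i < N M + c) _ = \sum_(N M <= i < N M.+1 | P_ (N M) i) u i).
  exact: nP.
rewrite -[in RHS]big_filter /index_iota addKn.
rewrite -{1}[N M]addn0 iotaDl big_map [RHS](big_nth 0%N) /index_iota subn0 -/c.
rewrite !big_seq; apply: eq_bigr => i; rewrite mem_iota add0n => /andP[_ ic] /=.
have JM : J (N M + i)%N = M.
  apply: (block_index_unique NS (JP _)); rewrite leq_addr/= -ltn_subRL.
  exact: leq_trans ic cle.
by rewrite /s JM addKn nth_cat ic.
Qed.

(** In particular, the sums over subsets of the initial segments are bounded,
since at most N terms lie outside the tail. *)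
Lemma unconditional_bounded : unconditionally_convergent u ->
  exists B, forall n (P : pred nat), rnorm (\sum_(i < n | P i) u i) <= B.
Proof.
move=> /unconditional_small_tails[N NP].
exists (\sum_(i < N) rnorm (u i) + 1) => n P.
rewrite (big_ord_widen_cond (n + N)%N P u) ?leq_addr//.
rewrite -(big_mkord (fun i => P i && (i < n)%N)) (@big_cat_nat _ _ _ N)//= ?leq_addl//.
rewrite (le_trans (rnormD _ _))// lerD//.
rewrite (le_trans (rnorm_sum _ _ _))// big_mkord big_mkcond/=.
by apply: ler_sum => i _; case: ifP => // _; rewrite rnorm_ge0.
Qed.

End unconditional.

Section sign_sums.

Definition scons (b : bool) (e : nat -> bool) : nat -> bool :=
  fun i => if i is j.+1 then e j else b.

(** The sum of Phi over the choices of the signs indexed by i < n, encoded by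
booleans; an expectation over signs, without the normalization by 2^n. *)
Fixpoint sign_sum (V : nmodType) (n : nat) (Phi : (nat -> bool) -> V) : V :=
  if n is m.+1 then
    sign_sum m (fun e => Phi (scons true e)) + sign_sum m (fun e => Phi (scons false e))
  else Phi xpred0.

Lemma eq_sign_sum (V : nmodType) n (Phi Psi : (nat -> bool) -> V) :
  Phi =1 Psi -> sign_sum n Phi = sign_sum n Psi.
Proof. by move=> /funext ->. Qed.

Lemma sign_sumD (V : nmodType) n (Phi Psi : (nat -> bool) -> V) :
  sign_sum n (fun e => Phi e + Psi e) = sign_sum n Phi + sign_sum n Psi.
Proof. by elim: n Phi Psi => [//|n IH] Phi Psi /=; rewrite !IH addrACA. Qed.

Lemma sign_sum_cst (V : nmodType) n (c : V) : sign_sum n (fun=> c) = c *+ 2 ^ n.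
Proof.
by elim: n => [//|n IH] /=; rewrite !IH -mulrnDr addnn -mul2n expnS.
Qed.

Lemma sign_sum_morph (V W : nmodType) (h : V -> W) n Phi :
  {morph h : x y / x + y} ->
  h (sign_sum n Phi) = sign_sum n (fun e => h (Phi e)).
Proof. by move=> hD; elim: n Phi => [//|n IH] Phi /=; rewrite hD !IH. Qed.

Lemma sign_sum_le (R : numDomainType) n (Phi Psi : (nat -> bool) -> R) :
  (forall e, Phi e <= Psi e) -> sign_sum n Phi <= sign_sum n Psi.
Proof.
elim: n Phi Psi => [|n IH] Phi Psi h /=; first exact: h.
by apply: lerD; apply: IH => e; exact: h.
Qed.

Context (R : realType) (k : scalar_kind).
Local Notation K := (scalars R k).
Implicit Types V : normedModType K.

Definition signed V (b : bool) (x : V) : V := if b then - x else x.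

Lemma rnorm_sign_sum V n (Phi : (nat -> bool) -> V) :
  rnorm (sign_sum n Phi) <= sign_sum n (fun e => rnorm (Phi e)).
Proof.
elim: n Phi => [//|n IH] Phi /=.
by rewrite (le_trans (rnormD _ _))//; apply: lerD; exact: IH.
Qed.

(** Orthogonality of signs: only the diagonal of a matrix survives the sum over
the signs of its conjugates by diagonal sign matrices. *)
Lemma sign_sum_diagonal V n (b : nat -> nat -> V) :
  sign_sum n (fun e => \sum_(i < n) \sum_(j < n) signed (e i) (signed (e j) (b i j)))
  = (\sum_(i < n) b i i) *+ 2 ^ n.
Proof.
elim: n b => [|n IH] b /=; first by rewrite !big_ord0.
pose c e := \sum_(i < n) \sum_(j < n) signed (e i) (signed (e j) (b i.+1 j.+1)).
pose r e := \sum_(j < n) signed (e j) (b 0%N j.+1 + b j.+1 0%N).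
have h s e : \sum_(i < n.+1) \sum_(j < n.+1)
    signed (scons s e i) (signed (scons s e j) (b i j)) =
    b 0%N 0%N + signed s (r e) + c e.
  rewrite big_ord_recl big_ord_recl/= -!addrA; congr (_ + _).
    by case: s; rewrite /= ?opprK.
  under [X in _ + X]eq_bigr do rewrite big_ord_recl/=.
  rewrite big_split/= addrA; congr (_ + _).
  rewrite (_ : signed s (r e) = \sum_(j < n) signed s (signed (e j) (b 0%N j.+1 + b j.+1 0%N))).
    rewrite -big_split/=; apply: eq_bigr => i _.
    by case: s; case: (e i); rewrite /= ?opprD ?opprK.
  by case: s => //=; rewrite /r sumrN.
rewrite (eq_sign_sum n (h true)) (eq_sign_sum n (h false)) -sign_sumD.
rewrite (@eq_sign_sum _ n _ (fun e => (b 0%N 0%N + b 0%N 0%N) + (c e + c e))); last first.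
  by move=> e /=; rewrite addrACA; congr (_ + _); rewrite addrACA addNr addr0.
rewrite sign_sumD sign_sum_cst sign_sumD (IH (fun i j => b i.+1 j.+1)).
by rewrite big_ord_recl -!mulr2n -!mulrnA -expnS -expnSr mulrnDl.
Qed.

Definition clarkson V (p : R) : Prop := forall x y : V,
  rnorm (x + y) `^ p + rnorm (x - y) `^ p <= 2 * (rnorm x `^ p + rnorm y `^ p).

(** Clarkson's inequality iterates to the statement that the space has type p
with constant 1. *)
Lemma clarkson_type V (p : R) n (x : V) (y : nat -> V) : clarkson V p ->
  sign_sum n (fun e => rnorm (x + \sum_(i < n) signed (e i) (y i)) `^ p) <=
  (rnorm x `^ p + \sum_(i < n) rnorm (y i) `^ p) *+ 2 ^ n.
Proof.
move=> cl; elim: n x y => [|n IH] x y /=; first by rewrite !big_ord0 !addr0.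
have h (b : bool) : sign_sum n (fun e => rnorm (x +
      \sum_(i < n.+1) signed (scons b e i) (y i)) `^ p) <=
    (rnorm (x + signed b (y 0%N)) `^ p + \sum_(i < n) rnorm (y i.+1) `^ p) *+ 2 ^ n.
  rewrite (@eq_sign_sum _ n _ (fun e => rnorm (x + signed b (y 0%N) +
      \sum_(i < n) signed (e i) (y i.+1)) `^ p)).
    exact: (IH _ (fun i => y i.+1)).
  by move=> e; rewrite big_ord_recl/= addrA.
apply: (le_trans (lerD (h true) (h false))) => /=.
rewrite -mulrnDl expnS mulrnA lerMn2r expn_eq0/=.
by rewrite big_ord_recl/=; have := cl x (y 0%N); rewrite mulr2n; lra.
Qed.

End sign_sums.

(** * Dual norms and the upper estimate *)

Section powers.
Context (R : realType).
Implicit Types x y p : R.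

Lemma powR_midpoint x y p : 1 <= p -> 0 <= x -> 0 <= y ->
  ((x + y) / 2) `^ p <= (x `^ p + y `^ p) / 2.
Proof.
move=> p1 x0 y0; have h01 : 0 <= (2^-1 : R) <= 1.
  by rewrite invr_ge0 invf_le1//= ler0n ler1n.
have /= := convex_powR p1 (Itv01 (proj1 (andP h01)) (proj2 (andP h01))).
move=> /(_ x y); rewrite !inE /= !in_itv /= !andbT => /(_ x0 y0).
move=> h; rewrite convRE [X in X `^ _ <= _]convRE /= /unstable.onem in h.
have e : (1 - 2^-1 : R) = 2^-1 by lra.
rewrite e in h; move: h.
by rewrite -!mulrDr ![2^-1 * _]mulrC.
Qed.

Lemma powRVK x p : 0 <= x -> p != 0 -> (x `^ p^-1) `^ p = x.
Proof. by move=> x0 p0; rewrite -powRrM mulVf// powRr1. Qed.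

Lemma powR_mulr x p : (p == 0) = false -> 0 <= x -> x `^ p = x * x `^ (p - 1).
Proof. by move=> p0 x0; rewrite -{2}(powRr1 x0) -powRD addrC subrK// p0. Qed.

Lemma powR_mono p x y : 0 < p -> 0 <= x -> 0 <= y -> (x `^ p <= y `^ p) = (x <= y).
Proof.
move=> p0 x0 y0; apply/idP/idP; last by move=> xy; rewrite ge0_ler_powR// ltW.
rewrite leNgt [in X in _ -> X]leNgt; apply: contraNN => yx.
by rewrite gt0_ltr_powR.
Qed.

Lemma le_root p x y z : 0 < p -> 0 <= x -> 0 <= y -> 0 <= z ->
  x `^ p <= y `^ p * z -> x <= y * z `^ p^-1.
Proof.
move=> p0 x0 y0 z0; rewrite -(powR_mono p0)// ?mulr_ge0 ?powR_ge0//.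
by rewrite powRM ?powR_ge0// powRVK// gt_eqF.
Qed.

Lemma sign_sum_jensen p n (phi : (nat -> bool) -> R) : 1 <= p ->
  (forall e, 0 <= phi e) ->
  (sign_sum n phi / 2 ^+ n) `^ p <= sign_sum n (fun e => phi e `^ p) / 2 ^+ n.
Proof.
move=> p1; elim: n phi => [|n IH] phi phi0 /=; first by rewrite expr0 !divr1.
have phin (b : bool) : 0 <= sign_sum n (fun e => phi (scons b e)) / 2 ^+ n.
  rewrite divr_ge0 ?exprn_ge0//.
  have := @sign_sum_le R n (fun=> 0) _ (fun e => phi0 (scons b e)).
  by rewrite sign_sum_cst mul0rn.
have E (a b : R) : (a + b) / 2 ^+ n.+1 = (a / 2 ^+ n + b / 2 ^+ n) / 2.
  by rewrite exprSr; field; rewrite expf_neq0.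
rewrite !E (le_trans (powR_midpoint p1 (phin _) (phin _)))//.
rewrite ler_pM2r ?invr_gt0// lerD//; exact: IH.
Qed.

Lemma powR_sum_le p n (a : nat -> R) : 0 < p -> (forall i, 0 <= a i) ->
  forall i, (i < n)%N -> a i <= (\sum_(j < n) a j `^ p) `^ p^-1.
Proof.
move=> p0 a0 i ilt; rewrite -[a i]mul1r -[X in _ <= X]mul1r.
have h : a i `^ p <= \sum_(j < n) a j `^ p.
  rewrite (bigD1 (Ordinal ilt))//= lerDl sumr_ge0// => j _; exact: powR_ge0.
rewrite mul1r; apply: le_root => //; last by rewrite powR1 mul1r.
by rewrite sumr_ge0// => j _; exact: powR_ge0.
Qed.

Lemma sum_half_powers n : \sum_(i < n) (2^-1 : R) ^+ i <= 2.
Proof.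
suff -> : \sum_(i < n) (2^-1 : R) ^+ i = 2 - 2 * 2^-1 ^+ n.
  by rewrite gerBl mulr_ge0// exprn_ge0// invr_ge0.
elim: n => [|n IH]; first by rewrite big_ord0 expr0 mulr1 subrr.
by rewrite big_ord_recr/= IH exprS; field.
Qed.

End powers.

Section frames.
Context (R : realType) (k : scalar_kind) (X : normedModType (scalars R k)).
Local Notation K := (scalars R k).

Lemma dual_linop (F : dual_space X) a x y : F (a *: x + y) = a * F x + F y.
Proof. by rewrite linearP. Qed.

Lemma dual_sum (F : dual_space X) I (r : seq I) (P : pred I) (x : I -> X) :
  F (\sum_(i <- r | P i) x i) = \sum_(i <- r | P i) F (x i).
Proof. by rewrite raddf_sum. Qed.

Lemma dual_bound (F : dual_space X) :
  exists2 M : R, 0 <= M & forall x, modulus (F x) <= M * rnorm x.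
Proof.
case: F => F [M FM] /=; exists `|scalar_Re M|; first exact: normr_ge0.
move=> x; apply: (@le_trans _ _ (scalar_Re M * rnorm x)).
  by apply: scalar_of_leM; rewrite scalar_of_modulus rnorm_of.
by rewrite ler_wpM2r ?rnorm_ge0// ler_norm.
Qed.

Lemma dual_norm_has_sup (F : dual_space X) :
  has_sup [set modulus (F x) | x in [set x | rnorm x <= 1]].
Proof.
split; first by exists (modulus (F 0)), 0 => //=; rewrite rnorm0.
have [M M0 FM] := dual_bound F; exists M => _ [x /= x1 <-].
by rewrite (le_trans (FM _))// -[X in _ <= X]mulr1 ler_wpM2l.
Qed.

Lemma dual_norm_attained (F : dual_space X) r : r < dual_norm F ->
  exists2 x, rnorm x <= 1 & r < modulus (F x).
Proof.
move=> rF; have [|_ [x /= x1 <-] h] := @sup_adherent R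
  [set modulus (F x) | x in [set x | rnorm x <= 1]] (dual_norm F - r) _ (dual_norm_has_sup F).
  by rewrite subr_gt0.
by exists x => //; move: h; rewrite opprB addrCA subrr addr0.
Qed.

Lemma dual_norm_ge (F : dual_space X) x : modulus (F x) <= dual_norm F * rnorm x.
Proof.
have [->|x0] := eqVneq x 0.
  by rewrite linear0 rnorm0 mulr0 modulus0.
have rx := rnorm_gt0 x0.
rewrite -ler_pdivrMr//; apply: sup_upper_bound; first exact: dual_norm_has_sup.
exists (scalar_of k (rnorm x)^-1 *: x) => /=.
  by rewrite rnormZ modulus_of ger0_norm ?invr_ge0 ?(ltW rx)// mulVf ?gt_eqF//.
by rewrite linearZ/= modulusM modulus_of ger0_norm ?invr_ge0 ?(ltW rx)// mulrC.
Qed.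

Lemma dual_norm_le (F : dual_space X) M : 0 <= M ->
  (forall x, modulus (F x) <= M * rnorm x) -> dual_norm F <= M.
Proof.
move=> M0 FM; apply: ge_sup; first by case: (dual_norm_has_sup F).
move=> _ [x /= x1 <-]; rewrite (le_trans (FM _))//.
by rewrite -[X in _ <= X]mulr1 ler_wpM2l.
Qed.

Lemma mk_dual (F : X -> K) M : (forall a x y, F (a *: x + y) = a * F x + F y) ->
  (forall x, modulus (F x) <= M * rnorm x) ->
  exists F' : dual_space X, F' = F :> (X -> K).
Proof.
move=> lF FM.
pose L : {scalar X} := HB.pack F (GRing.isLinear.Build K X K *%R F lF).
have bL : exists M : K, forall x, `|L x| <= M * `|x|.
  exists (scalar_of k M) => x.
  by rewrite -scalar_of_modulus -rnorm_of -scalar_ofM scalar_of_le.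
by exists (Dual bL).
Qed.

Variables (f : nat -> X) (F : nat -> dual_space X).

(** The uniform boundedness principle turns unconditional convergence into a
bound for all sign multipliers of the frame expansion. *)
Lemma frame_sign_bound : rcomplete X -> unconditional_frame f F ->
  exists2 C, 0 <= C & forall n (e : nat -> bool) g,
    rnorm (\sum_(i < n) signed (e i) (F i g *: f i)) <= C * rnorm g.
Proof.
move=> cX uF; have [||C C0 FC] := @uniform_boundedness R k X X (nat * (nat -> bool))
  (fun ne g => \sum_(i < ne.1) signed (ne.2 i) (F i g *: f i)) cX.
- move=> [n e]; apply: bop_sum => i _ /=.
  have bF : bop (fun x => F i x *: f i).
    split=> [a x y|]; first by rewrite dual_linop scalerDl scalerA.
    have [M M0 FM] := dual_bound (F i); exists (M * rnorm (f i)) => [|x].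
      by rewrite mulr_ge0// rnorm_ge0.
    by rewrite rnormZ mulrAC ler_wpM2r// rnorm_ge0.
  case: (e i) => //=; have := bopZ (-1) bF.
  by congr bop; apply/funext => x; rewrite scaleN1r.
- move=> g; have [B gB] := unconditional_bounded (uF g).
  exists (B + B) => -[n e] /=.
  rewrite (bigID (fun i : 'I_n => e i))/= (le_trans (rnormD _ _))// lerD//.
    rewrite (eq_bigr (fun i : 'I_n => - (F i g *: f i))); last by move=> i ->.
    by rewrite sumrN rnormN; exact: (gB n e).
  rewrite (eq_bigr (fun i : 'I_n => F i g *: f i)); last by move=> i /negbTE ->.
  exact: (gB n (fun i => ~~ e i)).
by exists C => // n e g; exact: (FC (n, e) g).
Qed.

(** Averaging over signs the expansions, with sign multipliers, of the signed
combinations of almost norming vectors x j recovers the sum of the a i f i,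
while type p controls these combinations by the l_p norm of the
coefficients. *)
Lemma seminormalized_upper_estimate p r : 1 <= p -> clarkson X p -> rcomplete X ->
  unconditional_frame f F -> 0 < r -> (forall i, r <= dual_norm (F i)) ->
  upper_lp_estimate p f.
Proof.
move=> p1 cl cX uF r0 rF; have [C C0 FC] := frame_sign_bound cX uF.
have p0 : 0 < p by rewrite (lt_le_trans _ p1).
have /choice[x xP] i : exists x, rnorm x <= 1 /\ r / 2 < modulus (F i x).
  have [|x x1 Fx] := @dual_norm_attained (F i) (r / 2); last by exists x.
  by apply: lt_le_trans (rF i); rewrite ltr_pdivrMr// ltr_pMr// ltr1n.
exists (C * (2 / r) + 1); split.
  by rewrite ltr_wpDl// mulr_ge0// divr_ge0// ltW.
move=> n a0; pose a j := oapp a0 0 (insub j).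
have aE (i : 'I_n) : a0 i = a i by rewrite /a valK.
rewrite (eq_bigr (fun i : 'I_n => a i *: f i)); last by move=> i _; rewrite aE.
rewrite (eq_bigr (fun i : 'I_n => modulus (a i) `^ p)); last first.
  by move=> i _; rewrite aE.
pose y j := (a j / F j (x j)) *: x j.
have Fx0 j : F j (x j) != 0.
  apply/eqP => h; have [_] := xP j; rewrite h modulus0; apply/negP.
  by rewrite -leNgt divr_ge0// ltW.
have yle j : rnorm (y j) <= 2 / r * modulus (a j).
  rewrite rnormZ modulusM modulusV; have [x1 Fx] := xP j.
  have h : (modulus (F j (x j)))^-1 <= 2 / r.
    by rewrite -[2 / r]invf_div lef_pV2 ?posrE ?divr_gt0// ?modulus_gt0// ltW.
  rewrite mulrAC [2 / r * _]mulrC -mulrA [X in _ * X]mulrC mulrA.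
  by rewrite -[X in _ <= X]mulr1 ler_pM ?rnorm_ge0 ?mulr_ge0 ?invr_ge0 ?modulus_ge0//
    ler_wpM2l// modulus_ge0.
pose Y (e : nat -> bool) := \sum_(j < n) signed (e j) (y j).
set S := rnorm _.
have S1 : S <= C * (sign_sum n (fun e => rnorm (Y e)) / 2 ^+ n).
  rewrite mulrA ler_pdivlMr ?exprn_gt0// /S.
  have -> : rnorm (\sum_(i < n) a i *: f i) * 2 ^+ n =
      rnorm ((\sum_(i < n) a i *: f i) *+ 2 ^ n).
    rewrite -scaler_nat rnormZ mulrC; congr (_ * _).
    by rewrite -natrX modulus_nat.
  have := sign_sum_diagonal n (fun i j => F i (y j) *: f i).
  rewrite (eq_bigr (fun i : 'I_n => a i *: f i)); last first.
    by move=> i _; rewrite /y linearZ/= divfK.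
  move=> <-; apply: le_trans (rnorm_sign_sum _ _) _.
  rewrite (@sign_sum_morph _ _ (fun z => C * z)); last by move=> ? ?; rewrite mulrDr.
  apply: sign_sum_le => e; apply: le_trans (FC n e (Y e)).
  rewrite le_eqVlt; apply/orP; left; apply/eqP; congr rnorm.
  apply: eq_bigr => i _; rewrite /Y dual_sum scaler_suml.
  case: (e i) => /=; rewrite -?sumrN; apply: eq_bigr => j _;
    by case: (e j); rewrite /= ?linearN ?scaleNr ?opprK.
have T := clarkson_type n 0 y cl.
rewrite rnorm0 powR0 ?gt_eqF// add0r in T.
have Y0 e : 0 <= rnorm (Y e) by exact: rnorm_ge0.
have mean_le : sign_sum n (fun e => rnorm (Y e)) / 2 ^+ n <=
    2 / r * (\sum_(i < n) modulus (a i) `^ p) `^ p^-1.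
  apply: le_root => //.
  - rewrite divr_ge0 ?exprn_ge0//.
    have := @sign_sum_le R n (fun=> 0) _ Y0.
    by rewrite sign_sum_cst mul0rn.
  - by rewrite divr_ge0// ltW.
  - by rewrite sumr_ge0// => i _; exact: powR_ge0.
  rewrite (le_trans (sign_sum_jensen n p1 Y0))//.
  rewrite ler_pdivrMr ?exprn_gt0//.
  rewrite (eq_sign_sum n (Psi := fun e =>
      rnorm (0 + \sum_(i < n) signed (e i) (y i)) `^ p)); last first.
    by move=> e; rewrite add0r.
  rewrite (le_trans T)// -natrX mulr_natr lerMn2r expn_eq0/=.
  rewrite mulr_sumr; apply: ler_sum => i _.
  rewrite -powRM ?modulus_ge0 ?divr_ge0 ?(ltW r0)//.
  rewrite powR_mono ?rnorm_ge0//; last first.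
    by rewrite mulr_ge0 ?modulus_ge0// divr_ge0// ltW.
rewrite (le_trans S1)// (le_trans (ler_wpM2l C0 mean_le))//.
have := powR_ge0 (\sum_(i < n) modulus (a i) `^ p) p^-1.
by set Z := _ `^ p^-1; lra.
Qed.

End frames.

(** * Clarkson's inequality in L_p *)

Section scalar_inequalities.
Context (R : realType) (k : scalar_kind).
Local Notation K := (scalars R k).
Implicit Types (a b : K) (p : R).

Lemma powR_superadditive (x y q : R) : 1 <= q -> 0 <= x -> 0 <= y ->
  x `^ q + y `^ q <= (x + y) `^ q.
Proof.
move=> q1 x0 y0; have q0 : (q == 0) = false by rewrite gt_eqF// (lt_le_trans _ q1).
have mono z : 0 <= z -> z <= x + y -> z * z `^ (q - 1) <= z * (x + y) `^ (q - 1).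
  move=> z0 zxy; rewrite ler_wpM2l//.
  by rewrite ge0_ler_powR ?subr_ge0 ?nnegrE ?addr_ge0.
rewrite !(powR_mulr q0) ?addr_ge0// mulrDl lerD ?mono ?lerDl ?lerDr//.
Qed.

Lemma scalar_ReN (z : K) : scalar_Re (- z) = - scalar_Re z.
Proof. by case: (k) z => //= -[]. Qed.

Lemma scalar_ImN (z : K) : scalar_Im (- z) = - scalar_Im z.
Proof. by case: (k) z => [?|[]//] /=; rewrite oppr0. Qed.

Lemma modulus_parallelogram a b :
  modulus (a + b) ^+ 2 + modulus (a - b) ^+ 2 =
  2 * (modulus a ^+ 2 + modulus b ^+ 2).
Proof.
rewrite !modulusE !sqr_sqrtr ?addr_ge0 ?sqr_ge0//.
rewrite !scalar_ReD !scalar_ImD scalar_ReN scalar_ImN; ring.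
Qed.

(** The parallelogram identity bounds the left side through the convexity and the
superadditivity of the power 2 / p. *)
Lemma modulus_clarkson p a b : 0 < p -> p <= 2 ->
  modulus (a + b) `^ p + modulus (a - b) `^ p <=
  2 * (modulus a `^ p + modulus b `^ p).
Proof.
move=> p0 p2; pose q := 2 / p.
have q1 : 1 <= q by rewrite /q ler_pdivlMr// mul1r.
have pq (c : K) : (modulus c `^ p) `^ q = modulus c ^+ 2.
  rewrite -powRrM /q mulrCA divff ?gt_eqF// mulr1.
  by rewrite -powR_mulrn// modulus_ge0.
have P0 (c : K) : 0 <= modulus c `^ p by exact: powR_ge0.
suff : (modulus (a + b) `^ p + modulus (a - b) `^ p) / 2 <=
       modulus a `^ p + modulus b `^ p by lra.
rewrite -(@powR_mono _ q) ?(lt_le_trans _ q1)// ?divr_ge0 ?addr_ge0//.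
rewrite (le_trans (powR_midpoint q1 (P0 _) (P0 _)))//.
rewrite !pq modulus_parallelogram mulrC mulKf//.
by rewrite -!pq powR_superadditive.
Qed.

End scalar_inequalities.

Section Lp_facts.
Context d (T : measurableType d) (R : realType) (k : scalar_kind).
Variables (mu : {measure set T -> \bar R}) (p : R) (p1 : 1 <= p).
Local Notation K := (scalars R k).
Local Notation L := (@Lp _ T R k mu p p1).

Definition energy (f : T -> K) : \bar R := (\int[mu]_t (modulus (f t) `^ p)%:E)%E.

Lemma Lp_rnorm (x : L) : rnorm x = Lp_norm x.
Proof. exact: scalar_ofK. Qed.

Lemma measurable_Lp (x : L) : measurable_scalar_fun x.
Proof. by have [] := Lp_funP (Lp_repr x). Qed.

Lemma measurable_modulus_powR (f : T -> K) : measurable_scalar_fun f ->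
  measurable_fun setT (fun t => modulus (f t) `^ p).
Proof.
move=> mf; apply: (@measurableT_comp _ _ _ _ _ _ (@powR R ^~ p)) => //.
exact: measurable_modulus.
Qed.

Lemma eLp_norm_energy (f : T -> K) : (eLp_norm mu p f `^ p)%E = energy f.
Proof.
rewrite poweR_Lnorm ?gt_eqF ?(lt_le_trans ltr01)//.
by apply: eq_integral => t _ /=; rewrite ger0_norm// modulus_ge0.
Qed.

Lemma rnorm_energy (x : L) : (rnorm x `^ p)%:E = energy x.
Proof. by rewrite -eLp_norm_energy -Lp_normE Lp_rnorm. Qed.

Lemma eq_ae_energy (f g : T -> K) : measurable_scalar_fun f ->
  measurable_scalar_fun g -> {ae mu, forall t, f t = g t} -> energy f = energy g.
Proof.
move=> mf mg fg; apply: ae_eq_integral => //.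
- exact/measurable_EFinP/measurable_modulus_powR.
- exact/measurable_EFinP/measurable_modulus_powR.
- by apply: filterS fg => t /= ->.
Qed.

Lemma is_Lp_funE (f : T -> K) : measurable_scalar_fun f -> (energy f < +oo)%E ->
  is_Lp_fun mu p f.
Proof.
move=> mf fe; split=> //; rewrite -eLp_norm_energy in fe.
by apply: lty_poweRy fe; rewrite gt_eqF// (lt_le_trans ltr01).
Qed.

Lemma mk_Lp (f : T -> K) : measurable_scalar_fun f -> (energy f < +oo)%E ->
  exists x : L, {ae mu, forall t, x t = f t}.
Proof.
move=> mf fe; have fL : f \in Lp_fun_pred mu p1 by apply/asboolP; exact: is_Lp_funE.
exists (Lp_class (MkLpFun fL)); exact: Lp_class_repr.
Qed.

Lemma Lp_addE (x y : L) : {ae mu, forall t, Lp_repr (x + y) t = x t + y t}.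
Proof.
apply: filterS (Lp_class_repr (Lp_repr x + Lp_repr y)) => t.
by rewrite Lp_classD !Lp_reprK.
Qed.

Lemma Lp_scaleE (a : K) (x : L) : {ae mu, forall t, Lp_repr (a *: x) t = a * x t}.
Proof. exact: Lp_class_repr. Qed.

Lemma Lp_oppE (x : L) : {ae mu, forall t, Lp_repr (- x) t = - x t}.
Proof. by apply: filterS (Lp_scaleE (-1) x) => t; rewrite scaleN1r mulN1r. Qed.

Lemma Lp_subE (x y : L) : {ae mu, forall t, Lp_repr (x - y) t = x t - y t}.
Proof. by apply: filterS2 (Lp_addE x (- y)) (Lp_oppE y) => t -> ->. Qed.

Lemma measurable_scalar_funB (f g : T -> K) : measurable_scalar_fun f ->
  measurable_scalar_fun g -> measurable_scalar_fun (fun t => f t - g t).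
Proof.
move=> mf mg; have := measurable_scalar_funD mf (measurable_scalar_funZ (-1) mg).
by congr measurable_scalar_fun; apply/funext => t /=; rewrite mulN1r.
Qed.

Lemma rnormB_energy (x y : L) :
  (rnorm (x - y) `^ p)%:E = energy (fun t => x t - y t).
Proof.
rewrite rnorm_energy; apply: eq_ae_energy; [exact: measurable_Lp| |exact: Lp_subE].
by apply: measurable_scalar_funB; exact: measurable_Lp.
Qed.

Lemma rnormD_energy (x y : L) :
  (rnorm (x + y) `^ p)%:E = energy (fun t => x t + y t).
Proof.
rewrite rnorm_energy; apply: eq_ae_energy; [exact: measurable_Lp| |exact: Lp_addE].
by apply: measurable_scalar_funD; exact: measurable_Lp.
Qed.

Lemma Lp_clarkson : p <= 2 -> clarkson L p.
Proof.
move=> p2 x y; have p0 : 0 < p by rewrite (lt_le_trans ltr01).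
have mm (f : T -> K) : measurable_scalar_fun f ->
    measurable_fun setT (fun t => (modulus (f t) `^ p)%:E).
  by move=> mf; exact/measurable_EFinP/measurable_modulus_powR.
have nn (f : T -> K) t : setT t -> (0 <= (modulus (f t) `^ p)%:E)%E.
  by rewrite lee_fin powR_ge0.
have mx := measurable_Lp x; have my := measurable_Lp y.
have mD := measurable_scalar_funD mx my; have mB := measurable_scalar_funB mx my.
rewrite -lee_fin EFinD EFinM (EFinD (rnorm x `^ p)) rnormD_energy rnormB_energy !rnorm_energy.
rewrite /energy -ge0_integralD//; [|exact: nn|exact: mm|exact: nn|exact: mm].
rewrite -ge0_integralD//; [|exact: nn|exact: mm|exact: nn|exact: mm].
rewrite -ge0_integralZl//; last first.
- by move=> t _; rewrite adde_ge0// lee_fin powR_ge0.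
- by apply: emeasurable_funD; exact: mm.
apply: ge0_le_integral => //.
- by move=> t _; rewrite adde_ge0// lee_fin powR_ge0.
- by apply: emeasurable_funD; exact: mm.
- by apply: measurable_funeM; apply: emeasurable_funD; exact: mm.
by move=> t _; rewrite -!EFinD -EFinM lee_fin modulus_clarkson.
Qed.

End Lp_facts.

(** * Completeness of L_p *)

Section scalar_limits.
Context (R : realType).

Lemma real_complete : rcomplete (R^o : normedModType (scalars R RealScalars)).
Proof.
move=> u cu; have /cvg_ex[l ul] : cvgn (u : nat -> R^o).
  apply/cauchy_cvgP/cauchy_exP => e e0; have [N uN] := cu e e0.
  exists (u N); exists N => // n /= Nn; rewrite -ball_normE /ball_ /=.
  exact: (uN _ _ (leqnn N) Nn).
by exists l; apply/(@rcvgP R RealScalars (R^o)).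
Qed.

Lemma real_geometric (u : nat -> R) (c : R) :
  (forall n, `|u n.+1 - u n| <= c / 2 ^+ n) ->
  exists2 l : R, u @ \oo --> l & forall n, `|l - u n| <= 2 * c / 2 ^+ n.
Proof.
move=> uc; have [l ul] := @rcomplete_geometric R RealScalars (R^o) u c real_complete uc.
exists l; first by apply/(@rcvgP R RealScalars (R^o)).
exact: (@geometric_tail R RealScalars (R^o) u l c uc ul).
Qed.

Lemma nneseries_le (u : nat -> \bar R) (M : \bar R) : (forall n, 0 <= u n)%E ->
  (forall n, \sum_(0 <= i < n) u i <= M)%E -> (\sum_(i <oo) u i <= M)%E.
Proof.
move=> u0 uM; apply: lime_le; first by apply: is_cvg_nneseries => n _ _; exact: u0.
by near=> n; exact: uM.
Unshelve. all: by end_near. Qed.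

Variable k : scalar_kind.
Local Notation K := (scalars R k).

Definition scalar_mk (a b : R) : K :=
  match k return scalars R k with
  | RealScalars => a
  | ComplexScalars => Complex a b
  end.

Lemma modulus_Re (z : K) : `|scalar_Re z| <= modulus z.
Proof. by rewrite modulusE -sqrtr_sqr ler_sqrt ?addr_ge0 ?sqr_ge0// lerDl sqr_ge0. Qed.

Lemma modulus_Im (z : K) : `|scalar_Im z| <= modulus z.
Proof. by rewrite modulusE -sqrtr_sqr ler_sqrt ?addr_ge0 ?sqr_ge0// lerDr sqr_ge0. Qed.

Lemma modulus_le_ReIm (z : K) : modulus z <= `|scalar_Re z| + `|scalar_Im z|.
Proof.
rewrite modulusE -[X in _ <= X]ger0_norm ?addr_ge0// -sqrtr_sqr.
rewrite ler_sqrt ?sqr_ge0// sqrrD !real_normK ?num_real// addrAC lerDl.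
by rewrite mulrn_wge0// mulr_ge0.
Qed.

Lemma scalar_Re_mk a b : scalar_Re (scalar_mk a b) = a.
Proof. by rewrite /scalar_mk; case: (k). Qed.

Lemma measurable_scalar_mk d (T : measurableType d) (f g : T -> R) :
  measurable_fun setT f -> measurable_fun setT g ->
  measurable_scalar_fun (fun t => scalar_mk (f t) (g t)).
Proof.
move=> mf mg; split.
  by rewrite (_ : _ \o _ = f)//; apply/funext => t /=; rewrite scalar_Re_mk.
by rewrite /scalar_mk; case: (k); [exact: (@measurable_cst _ _ _ _ setT (0 : R))|exact: mg].
Qed.

End scalar_limits.

Section riesz_fischer.
Context d (T : measurableType d) (R : realType) (k : scalar_kind).
Variables (mu : {measure set T -> \bar R}) (p : R) (p1 : 1 <= p).
Local Notation K := (scalars R k).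
Local Notation L := (@Lp _ T R k mu p p1).

(** The weighted sum S of the p-th powers of the increments has finite
integral. Wherever S is finite the sequence converges geometrically, and a
constant times S dominates the p-th power of the distance to the limit; this
domination is trivial where S is infinite. *)
Lemma Lp_geometric_complete (v : nat -> L) :
  (forall n, rnorm (v n.+1 - v n) `^ p <= (2^-1 ^+ n) `^ p * 2^-1 ^+ n) ->
  exists x : L, rcvg v x.
Proof.
move=> vstep; have p0 : 0 < p by rewrite (lt_le_trans ltr01).
have half0 n : 0 <= (2^-1 : R) ^+ n by rewrite exprn_ge0// invr_ge0.
pose w n : T -> K := fun t => v n.+1 t - v n t.
have mv n := measurable_Lp (v n).
have mw n : measurable_scalar_fun (w n) by exact: measurable_scalar_funB.
pose u n t : \bar R := (((2 ^+ n) `^ p)%:E * (modulus (w n t) `^ p)%:E)%E.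
have u0 n t : (0 <= u n t)%E by rewrite /u -EFinM lee_fin mulr_ge0 ?powR_ge0.
have mu_ n : measurable_fun setT (u n).
  by apply: measurable_funeM; apply/measurable_EFinP; exact: measurable_modulus_powR.
pose S t := (\sum_(n <oo) u n t)%E.
have S0 t : (0 <= S t)%E by exact: nneseries_ge0.
have mS : measurable_fun setT S by exact: ge0_emeasurable_sum.
have iS : (\int[mu]_t S t <= 2%:E)%E.
  rewrite integral_nneseries//; apply: nneseries_le => [n|n].
    by apply: integral_ge0 => t _; exact: u0.
  have geo : (\sum_(0 <= i < n) (2^-1 ^+ i : R)%:E <= 2%:E)%E.
    by rewrite sumEFin lee_fin big_mkord sum_half_powers.
  apply: le_trans geo; apply: lee_sum => i _.
  rewrite ge0_integralZl//; last first.
  - by move=> t _; rewrite lee_fin powR_ge0.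
  - by apply/measurable_EFinP; exact: measurable_modulus_powR.
  rewrite -/(energy mu p (w i)) -(rnormB_energy (v i.+1) (v i)) -EFinM lee_fin.
  rewrite (le_trans (ler_wpM2l (powR_ge0 _ _) (vstep i)))// mulrA -powRM//.
  by rewrite -exprMn divff// expr1n powR1 mul1r.
pose G := [set t | (S t < +oo)%E].
have mG : measurable G.
  rewrite [G](_ : _ = setT `&` S @^-1` [set` Interval (BLeft 0%E) (BLeft +oo%E)]).
    by apply: mS => //; exact: emeasurable_itv.
  by apply/seteqP; split=> t /=; rewrite in_itv/= S0/=; [|case].
pose C t := (fine (S t)) `^ p^-1.
have C0 t : 0 <= C t by exact: powR_ge0.
have wC t n : G t -> modulus (w n t) <= C t / 2 ^+ n.
  move=> Gt; rewrite ler_pdivlMr ?exprn_gt0// -[C t]mul1r; apply: le_root => //.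
  - by rewrite mulr_ge0// modulus_ge0.
  - exact: fine_ge0.
  rewrite powR1 mul1r powRM ?modulus_ge0// mulrC -lee_fin fineK ?ge0_fin_numE//.
  rewrite EFinM; have := @nneseries_lim_ge R (fun i => u i t) xpredT 0 n.+1 (fun i _ _ => u0 i t).
  by apply: le_trans; rewrite big_nat_recr//= leeDr// sume_ge0// => i _; exact: u0.
have lim_part (q : K -> R) : (forall x y, q (x - y) = q x - q y) ->
    (forall z, `|q z| <= modulus z) ->
    (forall n, measurable_fun setT (fun t => q (v n t))) ->
    exists2 f : T -> R, measurable_fun setT f &
      forall t, G t -> forall n, `|f t - q (v n t)| <= 2 * C t / 2 ^+ n.
  move=> qB q1 mq; have q0 : q 0 = 0 by rewrite -(subrr 0) qB subrr.
  pose h n t := q (v n t) * \1_G t.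
  have hstep : forall t n, `|h n.+1 t - h n t| <= C t / 2 ^+ n.
    move=> t n.
    rewrite /h -mulrBl -qB; have [tG|tG] := boolP (t \in G).
      by rewrite indicE tG mulr1 (le_trans (q1 _))// wC// -inE.
    by rewrite indicE (negbTE tG) mulr0 normr0 divr_ge0.
  have /choice[f fP] : forall t, exists l : R, h ^~ t @ \oo --> l /\
      forall n, `|l - h n t| <= 2 * C t / 2 ^+ n.
    by move=> t; have [l ? ?] := real_geometric (hstep t); exists l.
  exists f.
    apply: (@measurable_fun_cvg _ _ _ _ h) => [n|t _]; last by have [] := fP t.
    by apply: measurable_funM.
  move=> t Gt n; have [_ /(_ n)] := fP t.
  by rewrite /h indicE mem_set// mulr1.
have [fr mfr frP] : exists2 f : T -> R, measurable_fun setT f &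
    forall t, G t -> forall n, `|f t - scalar_Re (v n t)| <= 2 * C t / 2 ^+ n.
  apply: lim_part; [by move=> x y; rewrite scalar_ReD scalar_ReN|exact: modulus_Re|].
  by move=> n; have [] := mv n.
have [fi mfi fiP] : exists2 f : T -> R, measurable_fun setT f &
    forall t, G t -> forall n, `|f t - scalar_Im (v n t)| <= 2 * C t / 2 ^+ n.
  apply: lim_part; [by move=> x y; rewrite scalar_ImD scalar_ImN|exact: modulus_Im|].
  by move=> n; have [] := mv n.
pose F t : K := scalar_mk k (fr t) (fi t).
have mF : measurable_scalar_fun F by exact: measurable_scalar_mk.
have FP t n : G t -> modulus (F t - v n t) <= 4 * C t / 2 ^+ n.
  move=> Gt; rewrite (le_trans (modulus_le_ReIm _))//.
  rewrite (_ : 4 * C t / 2 ^+ n = 2 * C t / 2 ^+ n + 2 * C t / 2 ^+ n); last by field; rewrite expf_neq0.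
  apply: lerD; first by rewrite scalar_ReD scalar_ReN scalar_Re_mk; exact: frP.
  rewrite scalar_ImD scalar_ImN; have := fiP t Gt n.
  rewrite /F /scalar_mk; case: (k) (v n t) => //= z _.
  by rewrite subrr normr0 divr_ge0// mulr_ge0.
have eF n : (energy mu p (fun t => (F t - v n t)%R) <= ((4 / 2 ^+ n) `^ p * 2)%:E)%E.
  apply: (@le_trans _ _ (\int[mu]_t (((4 / 2 ^+ n) `^ p)%:E * S t))%E).
    apply: ge0_le_integral => //.
    - by move=> t _; rewrite lee_fin powR_ge0.
    - apply/measurable_EFinP; apply: measurable_modulus_powR.
      exact: measurable_scalar_funB.
    - exact: measurable_funeM.
    move=> t _; have [Gt|/negP] := boolP (S t < +oo)%E; last first.
      rewrite ltey => /negP/negPn/eqP ->; by rewrite gt0_muley ?leey.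
    rewrite -(fineK (_ : S t \is a fin_num)) ?ge0_fin_numE// -EFinM lee_fin.
    rewrite -[fine (S t)](@powRVK _ _ p) ?fine_ge0 ?gt_eqF// -powRM ?divr_ge0 ?exprn_ge0//.
    rewrite powR_mono ?modulus_ge0 ?mulr_ge0 ?divr_ge0 ?exprn_ge0 ?powR_ge0//.
      by rewrite mulrAC FP.
    exact: powR_ge0.
  rewrite ge0_integralZl ?lee_fin ?powR_ge0//.
  by rewrite EFinM lee_wpmul2l// lee_fin powR_ge0.
have [y yF] : exists y : L, {ae mu, forall t, y t = F t - v 0%N t}.
  apply: mk_Lp; first exact: measurable_scalar_funB.
  by apply: le_lt_trans (eF 0%N) _; rewrite ltry.
exists (y + v 0%N) => e e0.
have bound n : rnorm (v n - (y + v 0%N)) <= 8 / 2 ^+ n.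
  rewrite rnormBC; apply: (@le_trans _ _ (4 / 2 ^+ n * 2 `^ p^-1)).
    apply: le_root => //; first exact: rnorm_ge0.
    rewrite -lee_fin rnormB_energy; apply: le_trans (eF n).
    rewrite le_eqVlt; apply/orP; left; apply/eqP; apply: eq_ae_energy.
    - by apply: measurable_scalar_funB => //; exact: measurable_Lp.
    - exact: measurable_scalar_funB.
    by apply: filterS2 yF (Lp_addE y (v 0%N)) => t yt ->; rewrite yt subrK.
  rewrite mulrAC ler_wpM2r ?invr_ge0 ?exprn_ge0//.
  have : 2 `^ p^-1 <= 2 `^ 1 :> R.
    by rewrite ler_powR ?ler1n// invf_le1.
  by rewrite powRr1//; lra.
have [N hN] : exists N, forall n, (N <= n)%N -> 8 / 2 ^+ n < e.
  have /cvgrPdist_lt/(_ e e0)[N _ hN] : geometric 8 (2^-1 : R) @ \oo --> 0.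
    by apply: cvg_geometric; rewrite ger0_norm ?invr_ge0// invf_lt1// ltr1n.
  exists N => n /hN; rewrite /= sub0r normrN exprVn.
  by apply: le_lt_trans; rewrite ler_norm.
by exists N => n /hN; apply: le_lt_trans.
Qed.

(** The theorem of Riesz and Fischer: along a subsequence, the increments of a
Cauchy sequence decrease as fast as the geometric case requires. *)
Lemma Lp_complete : rcomplete L.
Proof.
move=> u cu; have p0 : 0 < p by rewrite (lt_le_trans ltr01).
pose del n : R := ((2^-1 ^+ n) `^ p * 2^-1 ^+ n) `^ p^-1.
have half0 n : 0 < (2^-1 : R) ^+ n by rewrite exprn_gt0.
have del0 n : 0 < del n by rewrite powR_gt0// mulr_gt0// powR_gt0.
have /choice[N NP] n := cu _ (del0 n).
pose s := fix s n := if n is m.+1 then maxn (s m).+1 (N n) else N 0%N.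
have sS n : (s n < s n.+1)%N by rewrite leq_maxl.
have sid n : (n <= s n)%N by elim: n => // n /leq_ltn_trans; apply.
have sN n : (N n <= s n)%N by case: n => // n; rewrite leq_maxr.
have [|x xP] := @Lp_geometric_complete (u \o s).
  move=> n; have h : rnorm (u (s n.+1) - u (s n)) <= del n.
    by rewrite ltW// NP// (leq_trans (sN n))// ltnW.
  rewrite (le_trans (ge0_ler_powR (ltW p0) _ _ h)) ?nnegrE ?rnorm_ge0 ?(ltW (del0 n))//.
  by rewrite powRVK ?gt_eqF// mulr_ge0 ?powR_ge0// ltW.
exists x => e e0; have e20 : 0 < e / 2 by rewrite divr_gt0.
have [M MP] := cu _ e20; have [J JP] := xP _ e20.
pose m := maxn J M; have Jm : (J <= m)%N by rewrite leq_maxl.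
have Mm : (M <= s m)%N by rewrite (leq_trans _ (sid m))// leq_maxr.
exists M => n Mn; rewrite -(subrKA (u (s m))) (le_lt_trans (rnormD _ _))//.
by rewrite [e]splitr ltrD//; [exact: MP|exact: JP].
Qed.

End riesz_fischer.

Section closed_subspaces.
Context (R : realType) (k : scalar_kind) (V : normedModType (scalars R k)).
Variable X : closed_subspace V.

Lemma csub_rnorm (x : X) : rnorm x = rnorm (csub_val x).
Proof. by []. Qed.

Lemma csub_valP (x : X) : csub_set X (csub_val x).
Proof. by case: x => x /= /asboolP. Qed.

Lemma csub_complete : rcomplete V -> rcomplete X.
Proof.
move=> cV u cu; have [|l ul] := cV (fun n => csub_val (u n)).
  by move=> e /cu[N uN]; exists N => m n /uN h /h.
have Xl : csub_set X l.
  apply: (closed_cvg (csub_set X) _ _ (u_ := fun n => csub_val (u n)) (F := \oo)).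
  - exact: csub_closed.
  - by apply: nearW => n; exact: csub_valP.
  - exact/rcvgP.
by exists (CSub (asboolT Xl)).
Qed.

Lemma csub_clarkson p : clarkson V p -> clarkson X p.
Proof. by move=> cV x y; exact: cV. Qed.

End closed_subspaces.

(** * Translations and boxes in R^d *)

Section translations.
Context (R : realType).
Local Notation Rm := (measurableTypeR R).

Definition tr d (l x : Rd R d) : Rd R d := [tuple tnth x i - tnth l i | i < d].

Lemma tnth_tr d (l x : Rd R d) i : tnth (tr l x) i = tnth x i - tnth l i.
Proof. by rewrite tnth_mktuple. Qed.

Lemma measurable_tr d (l : Rd R d) : measurable_fun setT (tr l).
Proof.
apply/measurable_fun_tnthP => i.
rewrite (_ : _ \o _ = fun x => tnth x i - tnth l i); last first.
  by apply/funext => x /=; rewrite tnth_tr.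
by apply: measurable_funB => //; exact: measurable_tnth.
Qed.

Lemma lebesgue_measure_translation (c : R) (A : set R) : measurable A ->
  lebesgue_measure ((fun x => x - c) @^-1` A) = lebesgue_measure A.
Proof.
have mf : measurable_fun [set: Rm] (fun x : Rm => x - c : Rm).
  exact: measurable_funB.
pose phi : {mfun Rm >-> Rm} := HB.pack (fun x : Rm => x - c : Rm)
  (isMeasurableFun.Build _ _ _ _ _ mf).
move=> mA; have /= := @lebesgue_measure_unique R
  (pushforward (@lebesgue_measure R) phi) _ _ mA.
move=> -> // X [[a b] _ <-] /=; rewrite /pushforward.
rewrite (_ : phi @^-1` _ = `]a + c, b + c]%classic).
  by rewrite !lebesgue_measure_itv/= !lte_fin ltrD2r -!EFinB opprD addrACA subrr addr0.
by apply/seteqP; split=> x /=; rewrite !in_itv/= ltrBrDr lerBlDr.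
Qed.

(** Peeling off the first coordinate exhibits the translated measure as a product
measure, which is determined by its values on rectangles. *)
Lemma lebesgue_tuple_translation d (l : Rd R d) (A : set (Rd R d)) : measurable A ->
  lebesgue_tuple R d (tr l @^-1` A) = lebesgue_tuple R d A.
Proof.
elim: d l A => [|d IH] l A mA.
  rewrite (_ : tr l @^-1` A = A)//; apply/seteqP; split=> x /=;
    by rewrite (tuple0 (tr l x)) (tuple0 x).
pose m := lebesgue_tuple R d.
pose l0 := tnth l ord0; pose l' : Rd R d := [tuple tnth l (lift ord0 i) | i < d].
pose t (z : Rm * Rd R d) : Rm * Rd R d := (z.1 - l0, tr l' z.2).
have mt : measurable_fun setT t.
  apply: measurable_fun_pair; first exact: measurable_funB.
  by apply: measurableT_comp => //; exact: measurable_tr.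
pose phi : {mfun (Rm * Rd R d)%type >-> (Rm * Rd R d)%type} := HB.pack t
  (isMeasurableFun.Build _ _ _ _ _ mt).
have mAc : measurable (@tcons R d @^-1` A).
  by rewrite -[X in measurable X]setTI; apply: measurable_cons.
rewrite /= /lebesgue_cons /pushforward -comp_preimage.
rewrite (_ : tr l \o @tcons R d = @tcons R d \o t); last first.
  apply/funext => -[x y] /=; apply: eq_from_tnth => i; rewrite tnth_tr.
  have [j ->|->] := unliftP ord0 i.
    by rewrite !tnthS /= !tnth_mktuple.
  by rewrite !tnth0.
rewrite comp_preimage.
apply/esym; apply: (@product_measure_unique _ _ _ _ R lebesgue_measure m
  (pushforward (lebesgue_measure \x m)%E phi)) => //.
move=> B C mB mC; rewrite /pushforward.
transitivity ((lebesgue_measure \x m)%E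
    (((fun x => x - l0) @^-1` B) `*` (tr l' @^-1` C))) => //.
rewrite [LHS]product_measure1E.
- congr (_ * _)%E; [exact: lebesgue_measure_translation|exact: IH].
- by rewrite -[X in measurable X]setTI; apply: measurable_funB.
- by rewrite -[X in measurable X]setTI; apply: measurable_tr.
Qed.

Lemma ge0_integral_translation d (l : Rd R d) (F : Rd R d -> \bar R) :
  measurable_fun setT F -> (forall x, 0 <= F x)%E ->
  (\int[lebesgue_tuple R d]_x F (tr l x) = \int[lebesgue_tuple R d]_x F x)%E.
Proof.
move=> mF F0; have mt := measurable_tr l.
pose phi : {mfun Rd R d >-> Rd R d} := HB.pack (tr l)
  (isMeasurableFun.Build _ _ _ _ _ mt).
rewrite [RHS](eq_measure_integral (pushforward (lebesgue_tuple R d) phi)).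
  by rewrite ge0_integral_pushforward.
by move=> A mA _; exact/esym/lebesgue_tuple_translation.
Qed.

Lemma integral_translation d (l : Rd R d) (F : Rd R d -> \bar R) :
  measurable_fun setT F ->
  (\int[lebesgue_tuple R d]_x F (tr l x) = \int[lebesgue_tuple R d]_x F x)%E.
Proof.
move=> mF; rewrite integralE [RHS]integralE.
congr (_ - _)%E.
- rewrite -(ge0_integral_translation l (measurable_funepos mF) (funepos_ge0 F)).
  by apply: eq_integral => x _; rewrite !funeposE.
- rewrite -(ge0_integral_translation l (measurable_funeneg mF) (funeneg_ge0 F)).
  by apply: eq_integral => x _; rewrite !funenegE.
Qed.

End translations.

Section boxes.
Context (R : realType) (d : nat).
Local Notation Rm := (measurableTypeR R).
Local Notation mu := (lebesgue_tuple R d).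

Definition box (a b : 'I_d -> R) : set (Rd R d) :=
  [set x | forall i, tnth x i \in `[a i, b i]].

Lemma measurable_box a b : measurable (box a b).
Proof.
rewrite (_ : box a b = \bigcap_(i in [set: 'I_d]) ((@tnth d _ ^~ i) @^-1` `[a i, b i])).
  apply: fin_bigcap_measurable => // i _; rewrite -[X in measurable X]setTI.
  exact: measurable_tnth.
by apply/seteqP; split=> x h i; [move=> _; exact: h|exact: h].
Qed.

Lemma box_fin a b : (mu (box a b) < +oo)%E.
Proof.
have [ab|] := pselect (forall i, a i <= b i).
  by rewrite lebesgue_tuple_box// ltry.
move=> /existsNP[i /negP]; rewrite -ltNge => ba.
rewrite (_ : box a b = set0) ?measure0//; apply/seteqP; split=> // x /(_ i).
by rewrite in_itv/= => /andP[h /(le_trans h)]; rewrite leNgt ba.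
Qed.

Lemma box_null a b i : b i <= a i -> mu (box a b) = 0%E.
Proof.
move=> ba; have [ab|] := pselect (forall i, a i <= b i).
  rewrite lebesgue_tuple_box// (bigD1 i)//= (_ : b i - a i = 0) ?mul0r//.
  by apply/eqP; rewrite subr_eq0 eq_le ba ab.
move=> /existsNP[j /negP]; rewrite -ltNge => baj.
rewrite (_ : box a b = set0) ?measure0//; apply/seteqP; split=> // x /(_ j).
by rewrite in_itv/= => /andP[h /(le_trans h)]; rewrite leNgt baj.
Qed.

Definition boxes : set (set (Rd R d)) := [set B | exists a b, B = box a b].

Lemma boxI a b a' b' : box a b `&` box a' b' =
  box (fun i => Order.max (a i) (a' i)) (fun i => Order.min (b i) (b' i)).
Proof.
apply/seteqP; split=> x /=.
  move=> [h h'] i; have := h i; have := h' i; rewrite !in_itv/=.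
  by rewrite ge_max le_min => /andP[-> ->] /andP[-> ->].
move=> h; split=> i; have := h i; rewrite !in_itv/= ge_max le_min.
  by move=> /andP[/andP[-> _] /andP[-> _]].
by move=> /andP[/andP[_ ->] /andP[_ ->]].
Qed.

Lemma boxes_setI_closed : setI_closed boxes.
Proof. by move=> _ _ [a [b ->]] [a' [b' ->]]; rewrite boxI; do 2 eexists. Qed.

Lemma tnth_bounded (x : Rd R d) : exists N : nat, forall j, `|tnth x j| <= N%:R.
Proof.
pose M := \sum_(j < d) `|tnth x j|; exists `|Num.ceil M|%N => j.
apply: (@le_trans _ _ M); first by rewrite /M (bigD1 j)//= lerDl sumr_ge0.
rewrite -[X in _ <= X](mulr1z) -pmulrn natr_absz (le_trans (ceil_ge _))//.
by rewrite ler_int ler_norm.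
Qed.

(** A half-space is a countable union of boxes: one face is fixed and the others
move to infinity. *)
Lemma measurable_boxesE : @measurable _ (Rd R d) = <<s boxes >>.
Proof.
apply/seteqP; split; last first.
  apply: smallest_sub; first exact: sigma_algebra_measurable.
  by move=> _ [a [b ->]]; exact: measurable_box.
apply: smallest_sub; first exact: smallest_sigma_algebra.
move=> A hA; have [i0 [B mB <-]] : exists i : 'I_d,
    preimage_set_system setT ((@tnth d Rm) ^~ i) measurable A.
  move: hA; elim/big_rec: _ => [//|i S _ IH [h|/IH//]]; by exists i.
have {}mB : (@RGenCInfty.G R).-sigma.-measurable B by rewrite -RGenCInfty.measurableE.
pose c := fun x : Rd R d => tnth x i0.
have : preimage_set_system setT c ((@RGenCInfty.G R).-sigma.-measurable) (setT `&` c @^-1` B).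
  by exists B.
rewrite -g_sigma_preimageE; apply: smallest_sub; first exact: smallest_sigma_algebra.
move=> _ [_ [r ->] <-]; rewrite setTI.
pose a N (j : 'I_d) : R := if j == i0 then r else - N%:R.
rewrite (_ : _ @^-1` _ = \bigcup_N box (a N) (fun=> N%:R)).
  apply: sigma_algebra_bigcup => N; apply: sub_gen_smallest.
  by do 2 eexists.
apply/seteqP; split=> x /=; last first.
  by move=> [N _ /(_ i0)]; rewrite /a eqxx !in_itv/= andbT => /andP[].
rewrite in_itv/= andbT => rx.
have [N xN] := tnth_bounded x; exists N => // j; move: (xN j).
rewrite ler_norml in_itv/= => /andP[h ->]; rewrite andbT /a.
by case: ifP => // /eqP ->.
Qed.

End boxes.

(** * Integrals over boxes *)

Section local_integrability.
Context d (T : measurableType d) (R : realType) (k : scalar_kind).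
Variables (mu : {measure set T -> \bar R}) (p : R) (p1 : 1 <= p).
Local Notation L := (@Lp _ T R k mu p p1).

Lemma ler_threshold (t z : R) : 0 < t -> 0 <= z ->
  z <= t + t `^ (1 - p) * z `^ p.
Proof.
move=> t0 z0; have [zt|tz] := leP z t.
  by rewrite (le_trans zt)// lerDl mulr_ge0// powR_ge0.
have zp : z = z `^ (1 - p) * z `^ p.
  by rewrite -powRD subrK ?powRr1// oner_eq0.
rewrite {1}zp (@le_trans _ _ (t `^ (1 - p) * z `^ p))//; last by rewrite lerDr ltW.
rewrite ler_wpM2r ?powR_ge0//.
have E w : w `^ (1 - p) = (w `^ (p - 1))^-1 by rewrite -powRN opprB.
have z0' : 0 < z by exact: lt_trans tz.
rewrite !E lef_pV2 ?posrE ?powR_gt0//.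
by apply: ge0_ler_powR; rewrite ?subr_ge0// ?nnegrE ltW.
Qed.

(** A threshold at height t turns the L_p norm into a bound for L_1 norms over
sets of finite measure; optimizing over t replaces Hoelder's inequality. *)
Lemma Lp_local_bound (F : L) (D : set T) (t : R) : measurable D -> 0 < t ->
  (\int[mu]_(x in D) (modulus (F x))%:E <=
   t%:E * mu D + (t `^ (1 - p) * rnorm F `^ p)%:E)%E.
Proof.
move=> mD t0; have mF := measurable_Lp F.
have mFp : measurable_fun setT (fun x => (modulus (F x) `^ p)%:E).
  exact/measurable_EFinP/measurable_modulus_powR.
apply: (@le_trans _ _ (\int[mu]_(x in D) (cst t%:E x +
    (t `^ (1 - p))%:E * (modulus (F x) `^ p)%:E))%E).
  apply: ge0_le_integral => //.
  - by move=> x _; rewrite lee_fin modulus_ge0.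
  - apply/measurable_funTS/measurable_EFinP; exact: measurable_modulus.
  - apply: emeasurable_funD => //; apply: measurable_funeM; exact: measurable_funTS.
  by move=> x _; rewrite /= -EFinM -EFinD lee_fin ler_threshold// modulus_ge0.
rewrite ge0_integralD//; last 3 first.
- by move=> x _; rewrite /= lee_fin ltW.
- by move=> x _; rewrite mule_ge0 ?lee_fin ?powR_ge0.
- by apply: measurable_funeM; exact: measurable_funTS.
rewrite integral_cst// leeD2l// EFinM rnorm_energy.
rewrite ge0_integralZl ?lee_fin ?powR_ge0//; last 2 first.
- exact: measurable_funTS.
- by move=> x _; rewrite lee_fin powR_ge0.
rewrite lee_wpmul2l ?lee_fin ?powR_ge0//; apply: ge0_subset_integral => //.
by move=> x _; rewrite lee_fin powR_ge0.
Qed.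

End local_integrability.

Section box_determination.
Context (R : realType) (d : nat).
Local Notation mu := (lebesgue_tuple R d).
Variable h : Rd R d -> R.
Hypotheses (mh : measurable_fun setT h)
  (h_box : forall a b, (\int[mu]_(x in box a b) `|(h x)%:E| < +oo)%E).

Lemma integrable_box a b : mu.-integrable (box a b) (EFin \o h).
Proof.
apply/integrableP; split; last exact: h_box.
by apply/measurable_EFinP; exact: measurable_funTS.
Qed.

(** Boxes form a pi-system that generates the Borel sets, so a locally
integrable function with vanishing integrals over boxes vanishes. *)
Lemma box_integral_neq0 : ~ {ae mu, forall x, h x = 0} ->
  exists a b, (\int[mu]_(x in box a b) (h x)%:E <> 0)%E.
Proof.
move=> hn0; apply: contrapT => /forallNP box0.
have {}box0 a b : (\int[mu]_(x in box a b) (h x)%:E = 0)%E.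
  by apply: contrapT => ab; apply: (box0 a); exists b.
apply: hn0; pose C (N : nat) : set (Rd R d) := box (fun=> - (N%:R : R)) (fun=> N%:R).
have mC N : measurable (C N) by exact: measurable_box.
have int0 N S : measurable S -> (\int[mu]_(x in S `&` C N) (h x)%:E = 0)%E.
  have iC := integrable_box (fun=> - (N%:R : R)) (fun=> N%:R).
  rewrite measurable_boxesE; move: S; apply: dynkin_induction.
  - exact: measurable_boxesE.
  - exact: boxes_setI_closed.
  - by rewrite setTI box0.
  - by move=> _ [a [b ->]]; rewrite boxI box0.
  - move=> S mS S0; have := box0 (fun=> - (N%:R : R)) (fun=> N%:R).
    rewrite -/(C N) -[in X in X = _ -> _](setTI (C N)) -(setvU S) setIUl.
    rewrite integral_setU ?S0 ?adde0//.
    + by apply: measurableI => //; exact: measurableC.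
    + exact: measurableI.
    + by apply/measurable_EFinP; exact: measurable_funTS.
    + apply/disj_setPS => x [[nS _] [xS _]]; exact: nS.
  - move=> F mF tF F0; rewrite setI_bigcupl integral_bigcup.
    + by apply: eseries0 => i _ _; exact: F0.
    + exact: trivIset_setIr.
    + by move=> i; exact: measurableI.
    + apply: (integrableS (mC N)) iC; last by move=> x [i _ []].
      by apply: bigcupT_measurable => i; exact: measurableI.
have aeC N : {ae mu, forall x, C N x -> h x = 0}.
  have : ae_eq mu (C N) (EFin \o h) (cst 0%E).
    apply: integral_ae_eq => //; first exact: integrable_box.
    move=> E EC mE; rewrite integral0 -(int0 N E mE); congr integral.
    by apply/seteqP; split=> // x Ex; split=> //; exact: EC.
  by apply: filterS => x /= hx /hx [].
have := ae_foralln aeC; apply: filterS => x hx.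
have [N xN] := tnth_bounded x; apply: (hx N) => j.
by move: (xN j); rewrite ler_norml in_itv/=.
Qed.

Lemma box_integral_lt a b : (\int[mu]_(x in box a b) (h x)%:E <> 0)%E ->
  forall i, a i < b i.
Proof.
move=> h0 i; rewrite ltNge; apply/negP => ba; apply: h0.
apply: null_set_integral; [exact: measurable_box| |exact: box_null ba].
by apply/measurable_EFinP; exact: measurable_funTS.
Qed.

End box_determination.

Section box_shells.
Context (R : realType) (d : nat).
Local Notation mu := (lebesgue_tuple R d).

(** A neighbourhood of the boundary of a box. *)
Definition shell (a b : 'I_d -> R) (e : R) : set (Rd R d) :=
  box (fun i => a i - e) (fun i => b i + e) `\` box (fun i => a i + e) (fun i => b i - e).

Lemma measurable_shell a b e : measurable (shell a b e).
Proof. by apply: measurableD; exact: measurable_box. Qed.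

(** The measure of a shell is P(e) - P(- e) for a polynomial P, hence small with
e. *)
Lemma shell_small (a b : 'I_d -> R) (eta : R) : (forall i, a i < b i) -> 0 < eta ->
  exists2 e, 0 < e & (mu (shell a b e) <= eta%:E)%E.
Proof.
move=> ab eta0.
pose P : {poly R} := \prod_(i < d) ((b i - a i)%:P + 2 *: 'X).
have PE e : P.[e] = \prod_(i < d) (b i - a i + 2 * e).
  by rewrite horner_prod; apply: eq_bigr => i _; rewrite !hornerE.
have eta20 : 0 < eta / 2 by rewrite divr_gt0.
have /cvgrPdist_lt/(_ _ eta20)/nbhs_ballP[r /= r0 rP] := @continuous_horner R P 0.
have [m m0 mP] : exists2 m, 0 < m & forall i, m <= b i - a i.
  exists (\big[Order.min/1]_(i < d) (b i - a i)); last by move=> i; rewrite bigmin_le_cond.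
  by apply: lt_bigmin => // i _; rewrite subr_gt0.
pose e := Order.min (r / 2) (m / 2).
have e0 : 0 < e by rewrite lt_min !divr_gt0.
have er : e < r by rewrite gt_min ltr_pdivrMr// ltr_pMr// ltr1n.
have em i : 2 * e <= b i - a i.
  have : e <= m / 2 by rewrite ge_min lexx orbT.
  by have := mP i; lra.
exists e => //; rewrite measureD; [|exact: measurable_box|exact: measurable_box|exact: box_fin].
rewrite setIidr; last first.
  move=> x h i; have := h i; rewrite !in_itv/= => /andP[h1 h2].
  by apply/andP; split; lra.
have bm (a' b' : 'I_d -> R) : (forall i, a' i <= b' i) ->
    mu (box a' b') = (\prod_(i < d) (b' i - a' i))%:E.
  exact: lebesgue_tuple_box.
rewrite [X in (X - _)%E]bm ?[X in (_ - X)%E]bm.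
- rewrite -EFinB lee_fin.
  have -> : \prod_(i < d) (b i + e - (a i - e)) = P.[e].
    by rewrite PE; apply: eq_bigr => i _; ring.
  have -> : \prod_(i < d) (b i - e - (a i + e)) = P.[- e].
    by rewrite PE; apply: eq_bigr => i _; ring.
  have h1 : `|P.[0] - P.[e]| < eta / 2.
    by apply: rP; rewrite -ball_normE /ball_/= sub0r normrN gtr0_norm.
  have h2 : `|P.[0] - P.[- e]| < eta / 2.
    by apply: rP; rewrite -ball_normE /ball_/= sub0r opprK gtr0_norm.
  by move: h1 h2; rewrite !ltr_norml; lra.
- by move=> i; have := em i; lra.
- by move=> i; have := em i; lra.
Qed.

Lemma box_translate_shell a b (e : R) (u x : Rd R d) :
  (forall i, `|tnth u i| <= e) -> box a b (tr u x) -> ~ box a b x -> shell a b e x.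
Proof.
move=> ue bux nbx; split=> [i|bx].
  have := bux i; rewrite tnth_tr !in_itv/=; have := ue i; rewrite ler_norml.
  by move=> /andP[h1 h2] /andP[h3 h4]; apply/andP; split; lra.
apply: nbx => i; have := bx i; rewrite !in_itv/=; have := ue i.
move=> /(le_trans (normr_ge0 _)) e0 /andP[h1 h2]; apply/andP; split; lra.
Qed.

Lemma box_shell_translate a b (e : R) (u x : Rd R d) :
  (forall i, `|tnth u i| <= e) -> box a b x -> ~ box a b (tr u x) -> shell a b e x.
Proof.
move=> ue bx nbx; split=> [i|bix].
  have := bx i; rewrite !in_itv/=; have := ue i.
  by move=> /(le_trans (normr_ge0 _)) e0 /andP[h1 h2]; apply/andP; split; lra.
apply: nbx => i; have := bix i; rewrite tnth_tr !in_itv/=; have := ue i.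
by rewrite ler_norml => /andP[h1 h2] /andP[h3 h4]; apply/andP; split; lra.
Qed.

End box_shells.

(** * Absence of cancellation between close translates *)

Lemma powR_small (R : realType) (p C e : R) : 1 < p -> 0 <= C -> 0 < e ->
  exists2 t, 0 < t & t `^ (1 - p) * C <= e.
Proof.
move=> p1 C0 e0; have C1 : 0 < C + 1 by rewrite ltr_wpDl.
have p10 : 0 < p - 1 by rewrite subr_gt0.
exists (((C + 1) / e) `^ (p - 1)^-1); first by rewrite powR_gt0// divr_gt0.
rewrite -[1 - p]opprB powRN powRVK ?gt_eqF ?divr_ge0 ?(ltW C1) ?(ltW e0)// invf_div mulrAC.
by rewrite ler_pdivrMr// mulrDr mulr1 lerDl ltW.
Qed.

Section indicators.
Context d (T : measurableType d) (R : realType) (mu : {measure set T -> \bar R}).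
Variables (D : set T) (h : T -> R) (mD : measurable D).

Let patch_indic : (EFin \o h) \_ D = (fun x => (\1_D x * h x)%:E).
Proof.
apply/funext => x; rewrite patchE indicE.
by case: ifP => _; rewrite ?mul1r ?mul0r.
Qed.

Lemma integral_indicM : (\int[mu]_x (\1_D x * h x)%:E = \int[mu]_(x in D) (h x)%:E)%E.
Proof. by rewrite [RHS]integral_mkcond patch_indic. Qed.

Lemma integrable_indicM : mu.-integrable D (EFin \o h) ->
  mu.-integrable setT (fun x => (\1_D x * h x)%:E).
Proof. by rewrite integrable_mkcond// patch_indic. Qed.

End indicators.

Section separation.
Context (R : realType) (k : scalar_kind) (d : nat) (p : R) (p1 : 1 < p).
Local Notation K := (scalars R k).
Local Notation L := (LpRd R k d (ltW p1)).
Local Notation mu := (lebesgue_tuple R d).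

(** What the real part, the imaginary part and their negatives have in common. *)
Definition real_part (q : K -> R) : Prop :=
  [/\ {morph q : x y / x + y}, forall z, `|q z| <= modulus z &
      forall F : Rd R d -> K, measurable_scalar_fun F ->
        measurable_fun setT (fun x => q (F x))].

Lemma real_partN q : real_part q -> real_part (fun z => - q z).
Proof.
move=> [qD q1 mq]; split=> [x y|z|F mF]; first by rewrite qD opprD.
  by rewrite normrN.
by apply: measurableT_comp => //; exact: mq.
Qed.

Lemma real_part_integrable q (g : L) (D : set (Rd R d)) : real_part q ->
  measurable D -> (mu D < +oo)%E -> mu.-integrable D (EFin \o (fun x => q (g x))).
Proof.
move=> [_ q1 mq] mD muD; apply/integrableP; split.
  by apply/measurable_EFinP/measurable_funTS; exact: mq (measurable_Lp g).
apply: (@le_lt_trans _ _ (\int[mu]_(x in D) (modulus (g x))%:E)%E).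
  apply: ge0_le_integral => //.
  - apply/measurableT_comp => //; apply/measurable_EFinP/measurable_funTS.
    exact: mq (measurable_Lp g).
  - apply/measurable_funTS/measurable_EFinP; exact: measurable_modulus (measurable_Lp g).
  - by move=> x _; rewrite lee_fin.
apply: le_lt_trans; first exact: (Lp_local_bound (p1 := ltW p1) g mD ltr01).
by rewrite mul1e lte_add_pinfty// ltry.
Qed.

Lemma real_part_neq0 (g : L) : g != 0 -> exists2 q, real_part q &
  ~ {ae mu, forall x, q (g x) = 0}.
Proof.
move=> g0; have rRe : real_part (@scalar_Re R k).
  split; [exact: scalar_ReD|exact: modulus_Re|by move=> F []].
have rIm : real_part (@scalar_Im R k).
  split; [exact: scalar_ImD|exact: modulus_Im|by move=> F []].
have [Re0|] := pselect {ae mu, forall x, scalar_Re (g x) = 0}; last first.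
  by exists (@scalar_Re R k).
exists (@scalar_Im R k) => // Im0; move: g0; apply/negP; rewrite negbK; apply/eqP.
rewrite -[g]Lp_reprK -(Lp_class0 _ _ (ltW p1)); apply/Lp_classP.
apply: filterS2 Re0 Im0 => x Re0 Im0; apply: modulus_eq0.
by rewrite modulusE Re0 Im0 expr0n/= addr0 sqrtr0.
Qed.

Lemma real_part_box (g : L) : g != 0 -> exists q a b I, [/\ real_part q,
  forall i, a i < b i, 0 < I & (\int[mu]_(x in box a b) (q (g x))%:E = I%:E)%E].
Proof.
move=> /real_part_neq0[q rq qg0].
have iq a b := real_part_integrable g rq (measurable_box a b) (box_fin a b).
have mqg : measurable_fun setT (fun x => q (g x)).
  by case: rq => _ _; apply; exact: measurable_Lp.
have bq a b : (\int[mu]_(x in box a b) `|(q (g x))%:E| < +oo)%E.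
  by have /integrableP[] := iq a b.
have [a [b ab0]] := box_integral_neq0 mqg bq qg0.
have ab := box_integral_lt mqg ab0.
have /fineK Ifin := integrable_fin_num (measurable_box a b) (iq a b).
set I := fine _ in Ifin; rewrite /= in Ifin.
have [I0|I0|I0] := ltgtP 0 I; last by rewrite -Ifin -I0 in ab0.
  by exists q, a, b, I; split.
exists (fun z => - q z), a, b, (- I); split=> //; first exact: real_partN.
  by rewrite oppr_gt0.
rewrite EFinN Ifin; under eq_integral do rewrite EFinN.
by rewrite (integralN (integrable_add_def (measurable_box a b) (iq a b))).
Qed.

Lemma tr_tr (l m x : Rd R d) : tr (tr l m) (tr l x) = tr m x.
Proof. by apply: eq_from_tnth => i; rewrite !tnth_tr; ring. Qed.

Lemma Lp_sum_ae n (P : pred nat) (f : nat -> L) :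
  {ae mu, forall x, Lp_repr (\sum_(i < n | P i) f i) x = \sum_(i < n | P i) f i x}.
Proof.
elim: n => [|n IH].
  have : {ae mu, forall x, Lp_repr (Lp_class 0 : L) x = 0} by exact: Lp_class_repr.
  by apply: filterS => x; rewrite !big_ord0 Lp_class0.
case Pn : (P n); last first.
  apply: filterS IH => x IH.
  have -> : \sum_(i < n.+1 | P i) f i = \sum_(i < n | P i) f i.
    by rewrite big_mkcond big_ord_recr/= Pn addr0 -big_mkcond.
  by rewrite IH [RHS]big_mkcond big_ord_recr/= Pn addr0 -big_mkcond.
apply: filterS2 IH (Lp_addE (\sum_(i < n | P i) f i) (f n)) => x IH.
have -> : \sum_(i < n.+1 | P i) f i = \sum_(i < n | P i) f i + f n.
  by rewrite big_mkcond big_ord_recr/= Pn -big_mkcond.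
by move=> ->; rewrite IH [RHS]big_mkcond big_ord_recr/= Pn -big_mkcond.
Qed.

(** A box over which a real part of g has a nonzero integral I detects any
translate of g by a sufficiently small vector, with the same sign and half of
the integral: there is no cancellation in a sum of N such translates, whose
L_1 norm over the box is at least N I / 2. *)
Lemma close_translates (g : L) : g != 0 -> exists e c beta : R, [/\ 0 < e, 0 < c, 0 <= beta &
  forall n (P : pred nat) (l : nat -> Rd R d) (f : nat -> L) (l0 : Rd R d),
  (forall i, P i -> is_translate (l i) g (f i)) ->
  (forall i, P i -> forall j, `|tnth l0 j - tnth (l i) j| <= e) ->
  forall t, 0 < t -> c * (\sum_(i < n | P i) 1) <=
    t * beta + t `^ (1 - p) * rnorm (\sum_(i < n | P i) f i) `^ p].
Proof.
move=> /real_part_box[q [a [b [I [rq ab I0 qI]]]]].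
have [qD q1 mq] := rq; pose B := box a b.
have mB : measurable B by exact: measurable_box.
have I20 : 0 < I / 2 by rewrite divr_gt0.
have I40 : 0 < I / 4 by rewrite divr_gt0.
have [t t0 tI] := powR_small p1 (powR_ge0 (rnorm g) p) I40.
have [e e0 eI] := shell_small ab (divr_gt0 I40 t0).
pose S := shell a b e; have mS : measurable S by exact: measurable_shell.
have muS : (mu S < +oo)%E by rewrite (le_lt_trans eI)// ltry.
have shellI : (\int[mu]_(x in S) `|(q (g x))%:E| <= (I / 2)%:E)%E.
  apply: (@le_trans _ _ (\int[mu]_(x in S) (modulus (g x))%:E)%E).
    apply: ge0_le_integral => //.
    - apply/measurableT_comp => //; apply/measurable_EFinP/measurable_funTS.
      exact: mq (measurable_Lp g).
    - apply/measurable_funTS/measurable_EFinP; exact: measurable_modulus (measurable_Lp g).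
    - by move=> x _; rewrite lee_fin.
  apply: le_trans; first exact: (Lp_local_bound (p1 := ltW p1) g mS t0).
  rewrite (_ : I / 2 = t * (I / 4 / t) + I / 4); last by field; rewrite gt_eqF.
  by rewrite EFinD leeD ?lee_fin// EFinM lee_wpmul2l// lee_fin ltW.
exists e, (I / 2), (fine (mu B)); split=> //; first exact: fine_ge0.
move=> n P l f l0 fl le_e s s0.
pose h x := q (g x); have mh : measurable_fun setT h by exact: mq (measurable_Lp g).
pose psi i x := \1_B (tr (tr (l i) l0) x) * h x.
pose phi i x := psi i (tr (l i) x).
pose B' := tr l0 @^-1` B.
have mtr l1 (D : set (Rd R d)) : measurable D -> measurable (tr l1 @^-1` D).
  by move=> mD; rewrite -[X in measurable X]setTI; exact: measurable_tr.
have iB l1 : mu.-integrable (tr l1 @^-1` B) (EFin \o h).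
  apply: real_part_integrable => //; first exact: mtr.
  by rewrite lebesgue_tuple_translation// box_fin.
have psiE i x : psi i x = \1_(tr (tr (l i) l0) @^-1` B) x * h x by [].
have ipsi i : mu.-integrable setT (EFin \o psi i).
  exact: (integrable_indicM (mtr (tr (l i) l0) B mB) (iB (tr (l i) l0))).
have mphi i : measurable_fun setT (phi i).
  apply: (measurableT_comp (f := psi i)); last exact: measurable_tr.
  by have /integrableP[/measurable_EFinP] := ipsi i.
have iphi i : mu.-integrable setT (EFin \o phi i).
  apply/integrableP; split; first exact/measurable_EFinP.
  have /integrableP[mpsi] := ipsi i; apply: le_lt_trans.
  rewrite -(integral_translation (l i) (F := fun x => `|(EFin \o psi i) x|%E))//.
  exact: measurableT_comp.
(* Moving the box by at most e changes the integral of h by at most the integral of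
its absolute value over the shell. *)
have phi_ge i : P i -> ((I / 2)%:E <= \int[mu]_x (phi i x)%:E)%E.
  move=> Pi; rewrite (integral_translation (l i) (F := EFin \o psi i)); last first.
    by have /integrableP[] := ipsi i.
  have iBh : mu.-integrable setT (EFin \o (fun x => \1_B x * h x)).
    by apply: integrable_indicM => //; exact: real_part_integrable (box_fin a b).
  have iSh : mu.-integrable setT (EFin \o (fun x => \1_S x * `|h x|)).
    apply: (integrable_indicM (h := fun x => `|h x|)) => //.
    by have := integrable_abse (real_part_integrable g rq mS muS).
  apply: (@le_trans _ _ (\int[mu]_x ((\1_B x * h x)%:E - (\1_S x * `|h x|)%:E))%E).
    rewrite integralB_EFin// !integral_indicM// qI.
    rewrite (_ : (I / 2)%:E = I%:E - (I / 2)%:E)%E; last by rewrite -EFinB; congr EFin; field.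
    by rewrite leeB.
  apply: le_integral => //; first exact: integrableB.
  move=> x _; rewrite -EFinB lee_fin /psi.
  have ue j : `|tnth (tr (l i) l0) j| <= e by rewrite tnth_tr le_e.
  rewrite !indicE; set u := tr (l i) l0.
  have hx : `|h x| >= h x /\ `|h x| >= - h x by rewrite ler_norm -normrN ler_norm.
  have [Bu|Bu] := boolP (tr u x \in B); have [Bx|Bx] := boolP (x \in B) => /=.
  - by rewrite !mul1r gerBl mulr_ge0.
  - rewrite (_ : x \in S = true) ?mul1r ?mul0r; first by rewrite sub0r; lra.
    apply/mem_set; apply: (box_translate_shell ue); first exact: set_mem.
    by move=> /mem_set; apply/negP.
  - rewrite (_ : x \in S = true) ?mul1r ?mul0r; first by lra.
    apply/mem_set; apply: (box_shell_translate ue); first exact: set_mem.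
    by move=> /mem_set; apply/negP.
  - by rewrite !mul0r sub0r oppr_le0 mulr_ge0.
set F : L := \sum_(i < n | P i) f i.
have sum_ge : ((I / 2 * (\sum_(i < n | P i) 1))%:E <=
    \int[mu]_x (\sum_(i < n | P i) (phi i x)%:E))%E.
  rewrite integral_sum//; last by move=> i; exact: iphi.
  rewrite mulr_sumr -sumEFin; apply: lee_sum => i Pi; rewrite mulr1; exact: phi_ge.
rewrite -lee_fin; apply: (le_trans sum_ge).
have q0 : q 0 = 0 by apply: (@addrI _ (q 0)); rewrite -qD !addr0.
have FE : {ae mu, forall x, setT x -> (\sum_(i < n | P i) (phi i x)%:E = (\1_B' x * q (F x))%:E)%E}.
  have tae : {ae mu, forall x, forall i : nat, P i -> f i x = g (tr (l i) x)}.
    apply: ae_foralln => i; case Pi : (P i); last exact: aeW.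
    by apply: filterS (fl i Pi) => x fx _.
  apply: filterS2 (Lp_sum_ae n P f) tae => x Fx fx _.
  rewrite sumEFin; congr EFin; rewrite Fx (big_morph q qD q0) mulr_sumr.
  by apply: eq_bigr => i Pi; rewrite /phi /psi tr_tr /h fx.
have mB' : measurable B' by exact: mtr.
have mqF : measurable_fun setT (fun x => q (F x)) by exact: mq (measurable_Lp F).
rewrite (ae_eq_integral (fun x => (\1_B' x * q (F x))%:E)) //; last 2 first.
- have /integrableP[] := integrable_sum measurableT (index_enum 'I_n) (P := fun i => P i)
    (h := fun (i : 'I_n) x => (phi i x)%:E) (fun i _ => iphi i).
  by [].
- by apply/measurable_EFinP; apply: measurable_funM.
have muB' : mu B' = mu B by exact: lebesgue_tuple_translation.
have muBfin : (mu B < +oo)%E by exact: box_fin.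
have muB'fin : (mu B' < +oo)%E by rewrite muB'.
rewrite integral_indicM//; apply: (@le_trans _ _ (\int[mu]_(x in B') (modulus (F x))%:E)%E).
  apply: le_integral => //.
  - exact: (real_part_integrable F rq mB' muB'fin).
  - apply/integrableP; split.
      apply/measurable_funTS/measurable_EFinP; exact: measurable_modulus (measurable_Lp F).
    under eq_integral do rewrite gee0_abs ?lee_fin ?modulus_ge0//.
    apply: le_lt_trans; first exact: (Lp_local_bound (p1 := ltW p1) F mB' ltr01).
    by rewrite mul1e lte_add_pinfty// ltry.
  - by move=> x _; rewrite lee_fin (le_trans (ler_norm _)).
apply: le_trans; first exact: (Lp_local_bound (p1 := ltW p1) F mB' s0).
by rewrite EFinD [(s * _)%:E]EFinM fineK ?ge0_fin_numE// [X in (_ * X + _)%E](_ : _ = mu B).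
Qed.

End separation.

(** * The lower estimate for translates of one function *)

Section sign_max.
Context (R : realType) (k : scalar_kind) (V : normedModType (scalars R k)).

Lemma sign_sum_ge n p (w : V) (z : nat -> V) : 1 <= p ->
  rnorm w `^ p *+ 2 ^ n <=
  sign_sum n (fun e => rnorm (w + \sum_(i < n) signed (e i) (z i)) `^ p).
Proof.
move=> p1; have p0 : 0 < p by rewrite (lt_le_trans ltr01).
elim: n w z => [|n IH] w z /=; first by rewrite big_ord0 addr0.
have h (b : bool) : rnorm (w + signed b (z 0%N)) `^ p *+ 2 ^ n <= sign_sum n (fun e =>
    rnorm (w + \sum_(i < n.+1) signed (scons b e i) (z i)) `^ p).
  rewrite (@eq_sign_sum _ n _ (fun e => rnorm (w + signed b (z 0%N) +
      \sum_(i < n) signed (e i) (z i.+1)) `^ p)).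
    exact: (IH _ (fun i => z i.+1)).
  by move=> e; rewrite big_ord_recl/= addrA.
apply: le_trans (lerD (h true) (h false)); rewrite /= -mulrnDl expnS mulrnA lerMn2r.
rewrite expn_eq0/=; set u := w - z 0%N; set v := w + z 0%N.
suff : rnorm w `^ p <= (rnorm u `^ p + rnorm v `^ p) / 2 by rewrite mulr2n; lra.
apply: le_trans (powR_midpoint p1 (rnorm_ge0 _) (rnorm_ge0 _)).
rewrite powR_mono ?rnorm_ge0 ?divr_ge0 ?addr_ge0 ?rnorm_ge0//.
have uv : u + v = 2%:R *: w.
  by rewrite /u /v addrACA addNr addr0 scaler_nat mulr2n.
have -> : rnorm w = rnorm (u + v) / 2.
  by rewrite uv rnormZ (modulus_nat _ k 2) mulrC mulKf// pnatr_eq0.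
rewrite ler_pM2r ?invr_gt0//.
exact: rnormD.
Qed.

(** Averaging over the signs other than the j-th one leaves w + z j and w - z j,
whose difference is twice z j. *)
Lemma sign_sum_term n p (w : V) (z : nat -> V) j : 1 <= p -> (j < n)%N ->
  rnorm (z j) `^ p *+ 2 ^ n <=
  sign_sum n (fun e => rnorm (w + \sum_(i < n) signed (e i) (z i)) `^ p).
Proof.
move=> p1; elim: n w z j => [//|n IH] w z [_|j jn] /=.
  have h (b : bool) : rnorm (w + signed b (z 0%N)) `^ p *+ 2 ^ n <= sign_sum n (fun e =>
      rnorm (w + \sum_(i < n.+1) signed (scons b e i) (z i)) `^ p).
    rewrite (@eq_sign_sum _ n _ (fun e => rnorm (w + signed b (z 0%N) +
        \sum_(i < n) signed (e i) (z i.+1)) `^ p)).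
      exact: (sign_sum_ge n _ (fun i => z i.+1)).
    by move=> e; rewrite big_ord_recl/= addrA.
  apply: le_trans (lerD (h true) (h false)); rewrite /= -mulrnDl expnS mulrnA lerMn2r.
  rewrite expn_eq0/=; have := @sign_sum_ge 1 p (z 0%N) (fun=> w) p1.
  by rewrite /= !big_ord1 /= addrC -(rnormN (z 0%N - w)) opprB [z 0%N + w]addrC expn1 addrC.
have h (b : bool) : rnorm (z j.+1) `^ p *+ 2 ^ n <= sign_sum n (fun e =>
    rnorm (w + \sum_(i < n.+1) signed (scons b e i) (z i)) `^ p).
  rewrite (@eq_sign_sum _ n _ (fun e => rnorm (w + signed b (z 0%N) +
      \sum_(i < n) signed (e i) (z i.+1)) `^ p)).
    exact: (IH _ (fun i => z i.+1)).
  by move=> e; rewrite big_ord_recl/= addrA.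
by apply: le_trans (lerD (h true) (h false)); rewrite -mulrnDr addnn -mul2n -expnS.
Qed.

End sign_max.

Section overlap.
Context (R : realType) (k : scalar_kind) (d : nat) (p : R) (p1 : 1 < p).
Local Notation K := (scalars R k).
Local Notation L := (LpRd R k d (ltW p1)).
Local Notation mu := (lebesgue_tuple R d).

(** The cells of a countable grid cover the space, so g cannot vanish almost
everywhere on each of them. *)
Lemma small_cell (g : L) (e : R) : g != 0 -> 0 < e ->
  exists (Q : set (Rd R d)) (c : R), [/\ measurable Q,
  forall x y j, Q x -> Q y -> `|tnth x j - tnth y j| <= e, 0 < c &
  (\int[mu]_(x in Q) (modulus (g x) `^ p)%:E = c%:E)%E].
Proof.
move=> g0 e0; pose lo (z : d.-tuple int) j : R := (tnth z j)%:~R * e.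
pose cell z := box (lo z) (fun j => lo z j + e).
have mcell z : measurable (cell z) by exact: measurable_box.
have mgp : measurable_fun setT (fun x => (modulus (g x) `^ p)%:E).
  by apply/measurable_EFinP/measurable_modulus_powR; exact: measurable_Lp.
have diam z x y j : cell z x -> cell z y -> `|tnth x j - tnth y j| <= e.
  move=> /(_ j) + /(_ j); rewrite !in_itv/= ler_norml => /andP[? ?] /andP[? ?].
  by apply/andP; split; lra.
have int_fin z : (\int[mu]_(x in cell z) (modulus (g x) `^ p)%:E < +oo)%E.
  apply: (@le_lt_trans _ _ (energy mu p g)).
    by apply: ge0_subset_integral => // x _; rewrite lee_fin powR_ge0.
  by rewrite -rnorm_energy ltry.
have int_ge0 z : (0 <= \int[mu]_(x in cell z) (modulus (g x) `^ p)%:E)%E.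
  by apply: integral_ge0 => x _; rewrite lee_fin powR_ge0.
have [z z0] : exists z, (\int[mu]_(x in cell z) (modulus (g x) `^ p)%:E != 0)%E.
  apply: contrapT => /forallNP h; move: g0; apply/negP; rewrite negbK; apply/eqP.
  have cell0 z : {ae mu, forall x, cell z x -> g x = 0}.
    have : ae_eq mu (cell z) (fun x => (modulus (g x) `^ p)%:E) (cst 0%E).
      apply/ae_eq_integral_abs => //; first exact: measurable_funTS.
      have /negP/negPn/eqP <- := h z; apply: eq_integral => x _.
      by rewrite gee0_abs// lee_fin powR_ge0.
    apply: filterS => x /= hx /hx [] /eqP; rewrite powR_eq0 => /andP[/eqP/modulus_eq0->//].
  rewrite -[g]Lp_reprK -(Lp_class0 _ _ (ltW p1)); apply/Lp_classP.
  have : {ae mu, forall x, forall n : nat, forall z, unpickle n = Some z -> cell z x -> g x = 0}.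
    apply: ae_foralln => n; case: (unpickle n) => [z|]; last exact: aeW.
    by apply: filterS (cell0 z) => x hx _ [<-].
  apply: filterS => x hx; pose z := [tuple Num.floor (tnth x j / e) | j < d].
  apply: (hx (pickle z) z); first by rewrite pickleK.
  move=> j; rewrite in_itv/= /lo tnth_mktuple.
  have /andP[h1 h2] := floor_itv (tnth x j / e).
  rewrite -ler_pdivlMr// h1/=.
  rewrite -[X in _ + X]mul1r -mulrDl -ler_pdivrMr//.
  by move: h2; rewrite intrD => /ltW.
exists (cell z), (fine (\int[mu]_(x in cell z) (modulus (g x) `^ p)%:E)); split=> //.
- exact: diam.
- by rewrite fine_gt0// int_fin andbT lt_neqAle eq_sym z0 int_ge0.
- by rewrite fineK// ge0_fin_numE.
Qed.

Lemma ae_sign_sum n (Phi Psi : (nat -> bool) -> Rd R d -> R) :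
  (forall e, {ae mu, forall x, Phi e x = Psi e x}) ->
  {ae mu, forall x, sign_sum n (Phi^~ x) = sign_sum n (Psi^~ x)}.
Proof.
elim: n Phi Psi => [|n IH] Phi Psi h /=; first exact: h.
have := IH _ _ (fun e => h (scons true e)); have := IH _ _ (fun e => h (scons false e)).
by apply: filterS2 => x -> ->.
Qed.

Lemma integral_sign_sum n (Phi : (nat -> bool) -> Rd R d -> R) (r : (nat -> bool) -> R) :
  (forall e, measurable_fun setT (Phi e)) -> (forall e x, 0 <= Phi e x) ->
  (forall e, (\int[mu]_x (Phi e x)%:E = (r e)%:E)%E) ->
  measurable_fun setT (fun x => sign_sum n (Phi^~ x)) /\
  (\int[mu]_x (sign_sum n (Phi^~ x))%:E = (sign_sum n r)%:E)%E.
Proof.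
elim: n Phi r => [|n IH] Phi r mP P0 Pr /=; first by split.
have [m1 i1] := IH _ _ (fun e => mP (scons true e)) (fun e => P0 (scons true e))
  (fun e => Pr (scons true e)).
have [m2 i2] := IH _ _ (fun e => mP (scons false e)) (fun e => P0 (scons false e))
  (fun e => Pr (scons false e)).
have ge0 b x : (0 <= (sign_sum n (fun e => Phi (scons b e) x))%:E)%E.
  rewrite lee_fin; have := @sign_sum_le R n (fun=> 0) _ (fun e => P0 (scons b e) x).
  by rewrite sign_sum_cst mul0rn.
split; first exact: measurable_funD.
rewrite EFinD -i1 -i2 -ge0_integralD//; exact/measurable_EFinP.
Qed.

Variables (g : L) (g0 : g != 0) (f : nat -> L) (l : nat -> Rd R d) (P : pred nat).
Hypothesis fP : forall i, P i -> is_translate (l i) g (f i).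
Variables (M : R) (M0 : 0 <= M).
Hypothesis upper : forall n (Q : pred nat),
  rnorm (\sum_(i < n | Q i) f i) `^ p <= M * (\sum_(i < n | Q i) 1).

(** A sum of N close translates has norm at least of order N, by the absence of
cancellation, and at most of order N to the power 1 / p, by the upper estimate.
As 1 < p, this bounds N. *)
Lemma few_close_translates : exists e N : R, [/\ 0 < e, 0 <= N &
  forall n (Q : pred nat) (l0 : Rd R d), (forall i, Q i -> P i) ->
  (forall i, Q i -> forall j, `|tnth l0 j - tnth (l i) j| <= e) ->
  \sum_(i < n | Q i) 1 <= N].
Proof.
have [e [c [beta [e0 c0 beta0 close]]]] := close_translates g0.
(* This t lets the left side absorb the term that comes from the upper estimate. *)
have [t t0 tM] := powR_small p1 M0 (divr_gt0 c0 (ltr0Sn R 1)).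
exists e, (2 * t * beta / c); split=> //.
  by rewrite divr_ge0 ?mulr_ge0// ltW.
move=> n Q l0 QP Ql; have := close n Q l f l0 (fun i Qi => fP (QP i Qi)) Ql t t0.
set S := \sum_(i < n | Q i) 1.
have S0 : 0 <= S by exact: sumr_ge0.
move=> h; rewrite ler_pdivlMr//.
have h1 : t `^ (1 - p) * rnorm (\sum_(i < n | Q i) f i) `^ p <= c / 2 * S.
  rewrite (le_trans (ler_wpM2l (powR_ge0 _ _) (upper n Q)))// mulrA.
  by rewrite ler_wpM2r.
by have := le_trans h (lerD (lexx _) h1); lra.
Qed.

(** The translates of a small cell Q carrying mass of g have bounded overlap, so
that at almost every point the sum of the terms with active cell is at most N
times the largest one, hence at most N times the expectation over signs. *)
Lemma translates_lower_estimate : exists2 C : R, 0 <= C & forall n (a : nat -> K),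
  (\sum_(i < n | P i) modulus (a i) `^ p) *+ 2 ^ n <=
  C * sign_sum n (fun e => rnorm (\sum_(i < n) signed (e i) (a i *: f i)) `^ p).
Proof.
have [e [N [e0 N0 few]]] := few_close_translates.
have [Q [c [mQ diamQ c0 Qc]]] := small_cell g0 e0.
exists (N / c) => [|n a]; first by rewrite divr_ge0// ltW.
(* W i vanishes at the points where the i-th translate of the cell is not active. *)
pose act x i := P i && `[< Q (tr (l i) x) >].
have few_act x : \sum_(i < n | act x i) 1 <= N.
  have [[i0 act0]|noact] := pselect (exists i, act x i).
    apply: (few n (act x) (l i0)) => [i /andP[]//|i /andP[_ /asboolP Qi] j].
    move: act0 => /andP[_ /asboolP Q0].
    by have := diamQ _ _ j Qi Q0; rewrite !tnth_tr opprB addrC addrA subrK addrC.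
  by rewrite big1// => i acti; case: noact; exists i.
pose W i x := \1_Q (tr (l i) x) * modulus (a i * f i x) `^ p.
have mtrQ i : measurable (tr (l i) @^-1` Q).
  by rewrite -[X in measurable X]setTI; exact: measurable_tr.
have mf i : measurable_scalar_fun (fun x => a i * f i x).
  by apply: measurable_scalar_funZ; exact: measurable_Lp.
have mW i : measurable_fun setT (W i).
  apply: measurable_funM; last exact: measurable_modulus_powR.
  exact: measurable_indic (mtrQ i).
have W0 i x : 0 <= W i x by rewrite mulr_ge0// powR_ge0.
have iW i : P i -> (\int[mu]_x (W i x)%:E = (modulus (a i) `^ p * c)%:E)%E.
  move=> Pi; pose G x := \1_Q x * modulus (a i * g x) `^ p.
  have mag : measurable_scalar_fun (fun x => a i * g x).
    by apply: measurable_scalar_funZ; exact: measurable_Lp.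
  have mG : measurable_fun setT G.
    apply: measurable_funM; last exact: measurable_modulus_powR.
    exact: measurable_indic.
  rewrite (ae_eq_integral (fun x => (G (tr (l i) x))%:E)) //; last 3 first.
  - exact/measurable_EFinP.
  - by apply/measurable_EFinP; apply: measurableT_comp => //; exact: measurable_tr.
  - by apply: filterS (fP Pi) => x fx _; rewrite /W /G fx.
  rewrite (integral_translation (l i) (F := EFin \o G)); last exact/measurable_EFinP.
  rewrite integral_indicM// EFinM -Qc -ge0_integralZl ?lee_fin ?powR_ge0//; last 2 first.
  - apply/measurable_funTS/measurable_EFinP/measurable_modulus_powR; exact: measurable_Lp.
  - by move=> x _; rewrite lee_fin powR_ge0.
  by apply: eq_integral => x _; rewrite -EFinM modulusM powRM ?modulus_ge0.
pose F (s : nat -> bool) : L := \sum_(i < n) signed (s i) (a i *: f i).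
pose Phi s x := modulus (F s x) `^ p.
have [mS iS] : measurable_fun setT (fun x => sign_sum n (Phi^~ x)) /\
  (\int[mu]_x (sign_sum n (Phi^~ x))%:E = (sign_sum n (fun s => rnorm (F s) `^ p))%:E)%E.
  apply: integral_sign_sum => [s|s x|s].
  - by apply: measurable_modulus_powR; exact: measurable_Lp.
  - exact: powR_ge0.
  - by rewrite rnorm_energy.
have Fae s : {ae mu, forall x, Phi s x = rnorm (0 +
    \sum_(i < n) signed (s i) (a i * f i x : K^o)) `^ p}.
  have term i : {ae mu, forall x, Lp_repr (signed (s i) (a i *: f i)) x =
      signed (s i) (a i * f i x : K^o)}.
    case: (s i) => /=; last exact: Lp_scaleE.
    by apply: filterS2 (Lp_oppE (a i *: f i)) (Lp_scaleE (a i) (f i)) => x -> ->.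
  have := ae_foralln term.
  apply: filterS2 (Lp_sum_ae n xpredT (fun i => signed (s i) (a i *: f i))) => x Fx tx.
  rewrite add0r /Phi /F Fx; congr (_ `^ _); rewrite -/(modulus _).
  by congr modulus; apply: eq_bigr => i _; rewrite tx.
have point : {ae mu, forall x, setT x -> (((\sum_(i < n | P i) W i x *+ 2 ^ n)%R)%:E <=
    N%:E * (sign_sum n (Phi^~ x))%:E)%E}.
  apply: filterS (ae_sign_sum n Fae) => x -> _; rewrite -EFinM lee_fin.
  set S := sign_sum n _.
  have term i : (i < n)%N -> modulus (a i * f i x) `^ p *+ 2 ^ n <= S.
    exact: (@sign_sum_term _ _ (K^o) n p 0 (fun i => a i * f i x) i (ltW p1)).
  have S0 : 0 <= S.
    have := @sign_sum_le R n (fun=> 0) _ (fun s => powR_ge0 (rnorm (0 +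
      \sum_(i < n) signed (s i) (a i * f i x : K^o))) p).
    by rewrite sign_sum_cst mul0rn.
  apply: (@le_trans _ _ (\sum_(i < n | act x i) S)); last first.
    apply: le_trans (ler_wpM2r S0 (few_act x)); rewrite mulr_suml.
    by apply: ler_sum => i _; rewrite mul1r.
  rewrite (bigID (fun i : 'I_n => `[< Q (tr (l i) x) >]))/= [X in _ + X]big1 ?addr0.
    apply: ler_sum => i /andP[_ /asboolP Qi].
    by rewrite /W indicE mem_set// mul1r term.
  move=> i /andP[_ /asboolP nQi].
  by rewrite /W indicE memNset// mul0r mul0rn.
pose h (i : 'I_n) x := if P i then W i x else 0.
have mh i : measurable_fun setT (fun x => (h i x)%:E).
  by apply/measurable_EFinP; rewrite /h; case: (P i).
have h0 i x : (0 <= (h i x)%:E)%E by rewrite lee_fin /h; case: ifP.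
have hE x : (((\sum_(i < n | P i) W i x *+ 2 ^ n)%R)%:E =
    (2 ^ n)%:R%:E * \sum_(i < n) (h i x)%:E)%E.
  rewrite big_mkcond sumEFin -EFinM mulr_natl -sumrMnl; congr EFin.
  by apply: eq_bigr => i _; rewrite /h; case: ifP => // _; rewrite mul0rn.
have mSum : measurable_fun setT (fun x => \sum_(i < n) (h i x)%:E)%E.
  exact: emeasurable_sum.
have int_le : (\int[mu]_x ((2 ^ n)%:R%:E * \sum_(i < n) (h i x)%:E) <=
    \int[mu]_x (N%:E * (sign_sum n (Phi^~ x))%:E))%E.
  apply: ae_ge0_le_integral => //.
  - by move=> x _; rewrite mule_ge0 ?lee_fin ?ler0n// sume_ge0.
  - exact: measurable_funeM.
  - move=> x _; rewrite mule_ge0// lee_fin.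
    have := @sign_sum_le R n (fun=> 0) (Phi^~ x) (fun s => powR_ge0 _ _).
    by rewrite sign_sum_cst mul0rn.
  - by apply: measurable_funeM; exact/measurable_EFinP.
  - by apply: filterS point => x px _; rewrite -hE px.
move: int_le; rewrite ge0_integralZl ?lee_fin ?ler0n//; last first.
  by move=> x _; rewrite sume_ge0.
rewrite ge0_integral_sum// ge0_integralZl//; last 2 first.
- exact/measurable_EFinP.
- move=> x _; rewrite lee_fin.
  have := @sign_sum_le R n (fun=> 0) (Phi^~ x) (fun s => powR_ge0 _ _).
  by rewrite sign_sum_cst mul0rn.
rewrite iS (eq_bigr (fun i : 'I_n => (if P i then modulus (a i) `^ p * c else 0)%:E)); last first.
  move=> i _; rewrite /h; case Pi : (P i); first exact: iW.
  by rewrite integral0.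
rewrite sumEFin -!EFinM lee_fin -big_mkcond -mulr_suml mulr_natl -mulrnAl.
by move=> h_le; rewrite mulrAC ler_pdivlMr.
Qed.

End overlap.

(** * Operators from and into l_p *)

Section ellp_basics.
Context (R : realType) (k : scalar_kind) (p : R) (p1 : 1 <= p).
Local Notation K := (scalars R k).
Local Notation E := (ellp R k p1).
Implicit Types (x y : E) (a : nat -> K).

Let p0 : 0 < p. Proof. by rewrite (lt_le_trans ltr01). Qed.

Lemma ellp_rnorm_powR x : (rnorm x `^ p)%:E = (\sum_(i <oo) (modulus (x i) `^ p)%:E)%E.
Proof.
rewrite -poweR_EFin Lp_rnorm ellp_normE -poweRrM mulVf ?gt_eqF// poweRe1//.
by apply: nneseries_ge0 => i _ _; rewrite lee_fin powR_ge0.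
Qed.

Lemma ellp_partial_sum x n : \sum_(i < n) modulus (x i) `^ p <= rnorm x `^ p.
Proof.
rewrite -lee_fin ellp_rnorm_powR -sumEFin -(big_mkord xpredT (fun i => (modulus (x i) `^ p)%:E)).
by apply: nneseries_lim_ge => i _ _; rewrite lee_fin powR_ge0.
Qed.

Lemma ellp_rnorm_le x B : (forall n, \sum_(i < n) modulus (x i) `^ p <= B) ->
  rnorm x `^ p <= B.
Proof.
move=> xB; rewrite -lee_fin ellp_rnorm_powR; apply: nneseries_le => [i|n].
  by rewrite lee_fin powR_ge0.
by rewrite big_mkord sumEFin lee_fin.
Qed.

Lemma ellp_approx x e : 0 < e -> exists n, rnorm x `^ p <= \sum_(i < n) modulus (x i) `^ p + e.
Proof.
move=> e0; apply: contrapT => /forallNP h.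
have : rnorm x `^ p <= rnorm x `^ p - e.
  apply: ellp_rnorm_le => n; rewrite lerBrDr ltW// ltNge; apply/negP; exact: h.
by rewrite leNgt ltrBlDr ltrDl e0.
Qed.

Lemma ae_counting (P : nat -> Prop) : {ae (@counting nat R), forall i, P i} ->
  forall i, P i.
Proof.
move=> [A [_ A0 PA]] i; apply: contrapT => /PA Ai; move: A0; rewrite /= /counting.
case: ifPn => [/asboolP fA /eqP|_ //].
rewrite eqe pnatr_eq0 finmap.cardfs_eq0 => /eqP A0.
by have := @in_fset_set _ A fA i; rewrite A0 inE mem_set.
Qed.

Lemma ellp_linE c x y i : Lp_repr (c *: x + y) i = c * x i + y i.
Proof.
move: i; apply: ae_counting.
by apply: filterS2 (Lp_addE (c *: x) y) (Lp_scaleE c x) => i -> ->.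
Qed.

Lemma ellp0E i : Lp_repr (0 : E) i = 0.
Proof.
have := ellp_linE 1 0 0 i; rewrite scale1r addr0 mul1r => /eqP.
by rewrite -subr_eq subrr => /eqP.
Qed.

Lemma ellpDE x y i : Lp_repr (x + y) i = x i + y i.
Proof. by have := ellp_linE 1 x y i; rewrite scale1r mul1r. Qed.

Lemma ellpZE c x i : Lp_repr (c *: x) i = c * x i.
Proof. by have := ellp_linE c x 0 i; rewrite addr0 ellp0E addr0. Qed.

Lemma ellpBE x y i : Lp_repr (x - y) i = x i - y i.
Proof. by rewrite -scaleN1r ellpDE ellpZE mulN1r. Qed.

Lemma ellp_sumE (I : Type) (r : seq I) (P : pred I) (F : I -> E) i :
  Lp_repr (\sum_(j <- r | P j) F j) i = \sum_(j <- r | P j) F j i.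
Proof.
elim/big_ind2: _ => [|x y x' y' <- <-|//]; first exact: ellp0E.
exact: ellpDE.
Qed.

Lemma mk_ellp a B : (forall n, \sum_(i < n) modulus (a i) `^ p <= B) ->
  exists x : E, forall i, x i = a i.
Proof.
move=> aB; have ma : measurable_scalar_fun a by split; move=> _ Y mY.
have [|x xa] := @mk_Lp _ nat R k (@counting nat R) p p1 a ma.
  apply: (@le_lt_trans _ _ B%:E); last exact: ltry.
  rewrite /energy ge0_integral_count; last by move=> i; rewrite lee_fin powR_ge0.
  apply: nneseries_le => [i|n]; first by rewrite lee_fin powR_ge0.
  by rewrite big_mkord sumEFin lee_fin.
by exists x; exact: ae_counting.
Qed.

Lemma ellp_coord_le x i : modulus (x i) <= rnorm x.
Proof.
rewrite -(powR_mono p0) ?modulus_ge0 ?rnorm_ge0//.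
by apply: le_trans (ellp_partial_sum x i.+1); rewrite big_ord_recr/= lerDr sumr_ge0// => j _; exact: powR_ge0.
Qed.

Lemma analysis_operator (X : normedModType K) (F : nat -> X -> K) C :
  (forall i c u v, F i (c *: u + v) = c * F i u + F i v) -> 0 <= C ->
  (forall n u, \sum_(i < n) modulus (F i u) `^ p <= C `^ p * rnorm u `^ p) ->
  exists T : X -> E, [/\ bop T, forall u, rnorm (T u) <= C * rnorm u &
    forall u i, T u i = F i u].
Proof.
move=> lF C0 FC; have /choice[T TE] u : exists x : E, forall i, x i = F i u.
  by apply: (@mk_ellp _ (C `^ p * rnorm u `^ p)) => n; exact: FC.
have TC u : rnorm (T u) <= C * rnorm u.
  rewrite -(powR_mono p0) ?mulr_ge0 ?rnorm_ge0// powRM ?rnorm_ge0//.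
  by apply: ellp_rnorm_le => n; under eq_bigr do rewrite TE; exact: FC.
exists T; split=> //; split; last by exists C.
by move=> c u v; apply/ellp_eqP => i; rewrite ellp_linE !TE lF.
Qed.

Lemma sum_uniq_sub (I : eqType) (F : I -> R) (s t : seq I) : (forall i, 0 <= F i) ->
  uniq s -> {subset s <= t} -> \sum_(i <- s) F i <= \sum_(i <- t) F i.
Proof.
move=> F0; elim: s t => [|i s IH] t /=; first by rewrite big_nil sumr_ge0.
move=> /andP[si us] st; have it : i \in t by rewrite st ?mem_head.
rewrite big_cons (perm_big _ (perm_to_rem it)) big_cons lerD2l.
apply: IH => // j js; apply: rem_mem; last by rewrite st// inE js orbT.
by apply: contraNneq si => <-.
Qed.

Lemma sum_uniq_le (F : nat -> R) (s : seq nat) : (forall i, 0 <= F i) -> uniq s ->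
  forall n, (forall i, i \in s -> (i < n)%N) ->
  \sum_(i <- s) F i <= \sum_(i < n) F i.
Proof.
move=> F0 us n sn; rewrite -(big_mkord xpredT F); apply: sum_uniq_sub => // i /sn.
by rewrite mem_index_iota.
Qed.

(** Coordinate projections, shifts and the extraction or insertion of rows are all
of this form. *)
Lemma reindex_operator (tau : nat -> option nat) :
  (forall i j m, tau i = Some m -> tau j = Some m -> i = j) ->
  exists T : E -> E, [/\ bop T, forall x, rnorm (T x) <= rnorm x &
    forall x i, T x i = if tau i is Some m then x m else 0].
Proof.
move=> tinj; have [||n x|T [bT T1 TE]] := @analysis_operator E
    (fun i (x : E) => if tau i is Some m then x m else 0) 1.
- by move=> i c u v; case: (tau i) => [m|]; rewrite ?ellp_linE ?mulr0 ?addr0.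
- exact: ler01.
- rewrite powR1 mul1r.
  pose s := pmap tau (iota 0 n).
  have us : uniq s.
    rewrite /s; elim: (iota 0 n) (iota_uniq 0 n) => //= i r IH /andP[ir ur].
    case ti : (tau i) => [m|] /=; last exact: IH.
    rewrite IH// andbT; apply/negP; rewrite mem_pmap => /mapP[j jr tj].
    by move: ir; rewrite (tinj i j m) ?jr.
  have -> : \sum_(i < n) modulus (if tau i is Some m then Lp_repr x m else 0) `^ p =
      \sum_(m <- s) modulus (Lp_repr x m) `^ p.
    rewrite -(big_mkord xpredT (fun i => modulus (if tau i is Some m then Lp_repr x m else 0) `^ p)).
    rewrite /index_iota subn0 /s; elim: (iota 0 n) => [|i r IH]; first by rewrite !big_nil.
    rewrite big_cons IH /=; case: (tau i) => [m|] /=; first by rewrite big_cons.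
    by rewrite modulus0 powR0 ?add0r ?gt_eqF.
  apply: le_trans (ellp_partial_sum x (\sum_(m <- s) m).+1).
  apply: sum_uniq_le => // [i|i si]; first exact: powR_ge0.
  by rewrite ltnS (big_rem i)//= leq_addr.
by exists T; split=> // x; rewrite (le_trans (T1 x))// mul1r.
Qed.

Lemma ellp_basis n : exists x : E, (forall i, x i = (i == n)%:R) /\ rnorm x <= 1.
Proof.
have h m : \sum_(i < m) modulus ((val i == n)%:R : K) `^ p <= 1.
  apply: (@le_trans _ _ (\sum_(i < m) ((val i == n)%:R : R))).
    apply: ler_sum => i _; case: (_ == _); first by rewrite modulus1 powR1.
    by rewrite modulus0 powR0 ?gt_eqF.
  rewrite -(big_mkord xpredT (fun i => (i == n)%:R : R)).
  have [nm|mn] := ltnP n m.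
    rewrite (big_rem n) ?mem_index_iota//= eqxx big1_seq ?addr0// => i /andP[_].
    by rewrite rem_filter ?iota_uniq// mem_filter /= => /andP[/negbTE ->].
  rewrite big1_seq// => i /andP[_]; rewrite mem_index_iota => /andP[_ im].
  by rewrite ltn_eqF// (leq_trans im).
have [x xE] := @mk_ellp (fun i => (i == n)%:R) 1 h.
exists x; split=> //; rewrite -(powR_mono p0) ?rnorm_ge0// powR1.
by apply: ellp_rnorm_le => m; under eq_bigr do rewrite xE; exact: h.
Qed.

End ellp_basics.

Section synthesis.
Context (R : realType) (k : scalar_kind) (p : R) (p1 : 1 <= p).
Local Notation K := (scalars R k).
Local Notation E := (ellp R k p1).
Context (X : normedModType K) (cX : rcomplete X).

Let p0 : 0 < p. Proof. by rewrite (lt_le_trans ltr01). Qed.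

Variables (f : nat -> X) (M : R) (M0 : 0 <= M).
Hypothesis upper : forall n (a : nat -> K),
  rnorm (\sum_(i < n) a i *: f i) `^ p <= M `^ p * \sum_(i < n) modulus (a i) `^ p.

Lemma upper_subset n (P : pred nat) (a : nat -> K) :
  rnorm (\sum_(i < n | P i) a i *: f i) `^ p <=
  M `^ p * \sum_(i < n | P i) modulus (a i) `^ p.
Proof.
have := upper n (fun i => if P i then a i else 0); congr (_ <= _).
  rewrite [in RHS]big_mkcond; congr (rnorm _ `^ _); apply: eq_bigr => i _.
  by case: ifP => // _; rewrite scale0r.
rewrite [in RHS]big_mkcond; congr (_ * _); apply: eq_bigr => i _.
by case: ifP => // _; rewrite modulus0 powR0// gt_eqF.
Qed.

Lemma upper_seq (s : seq nat) (a : nat -> K) : uniq s ->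
  rnorm (\sum_(i <- s) a i *: f i) `^ p <= M `^ p * \sum_(i <- s) modulus (a i) `^ p.
Proof.
move=> us; pose n := (\sum_(m <- s) m).+1.
have sn i : i \in s -> (i < n)%N by move=> si; rewrite ltnS (big_rem i)//= leq_addr.
have E (V : nmodType) (F : nat -> V) : \sum_(i <- s) F i = \sum_(i < n | val i \in s) F i.
  rewrite -(big_mkord (fun i => i \in s)) -big_filter; apply: perm_big.
  apply: uniq_perm => //; first by rewrite filter_uniq// iota_uniq.
  move=> i; rewrite mem_filter mem_index_iota/=.
  by case si : (i \in s) => //=; rewrite sn.
by rewrite !E; exact: upper_subset.
Qed.

(** The upper estimate bounds the blocks of the rearranged series by the tails of
the series of the p-th powers of the coordinates of x. *)
Lemma synthesis_convergence (x : E) (s : nat -> nat) : injective s ->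
  rcauchy (fun n => \sum_(i < n) x (s i) *: f (s i)).
Proof.
move=> sinj e e0.
have M1 : 0 < M + 1 by rewrite ltr_wpDl.
pose eta := (e / (M + 1) / 2) `^ p; have eta0 : 0 < eta by rewrite powR_gt0// !divr_gt0.
have [N xN] := ellp_approx x eta0.
have [N' N'P] : exists N', forall i, (N' <= i)%N -> (N <= s i)%N.
  elim: N {xN} => [|N [N1 N1P]]; first by exists 0%N.
  have [[m sm]|nosm] := pselect (exists m, s m = N).
    exists (maxn N1 m.+1) => i; rewrite geq_max => /andP[/N1P h mi].
    rewrite ltn_neqAle h andbT -sm; apply/eqP => /sinj mE.
    by rewrite mE ltnn in mi.
  exists N1 => i /N1P h; rewrite ltn_neqAle h andbT; apply/eqP => sm.
  by apply: nosm; exists i.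
have tail m n : (N' <= m)%N -> (m <= n)%N ->
    rnorm (\sum_(i < n) x (s i) *: f (s i) - \sum_(i < m) x (s i) *: f (s i)) < e.
  move=> N'm mn.
  rewrite -!(big_mkord xpredT (fun i => x (s i) *: f (s i))).
  have -> : \sum_(0 <= i < n) x (s i) *: f (s i) - \sum_(0 <= i < m) x (s i) *: f (s i) =
      \sum_(m <= i < n) x (s i) *: f (s i).
    by rewrite (@big_cat_nat _ _ _ m 0 n)//= [X in X - _]addrC addrK.
  rewrite -(big_map s xpredT (fun i => x i *: f i)).
  set r := map s _.
  have ur : uniq r by rewrite map_inj_uniq// iota_uniq.
  have h := upper_seq x ur.
  have h2 : \sum_(i <- r) modulus (x i) `^ p <= eta.
    pose Q := (maxn N (\sum_(m <- r) m).+1).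
    have : \sum_(i < N) modulus (x i) `^ p + \sum_(i <- r) modulus (x i) `^ p <=
        rnorm x `^ p.
      apply: le_trans (ellp_partial_sum x Q).
      rewrite -(big_mkord xpredT (fun i => modulus (x i) `^ p)) -big_cat.
      apply: sum_uniq_le => [i||i]; first exact: powR_ge0.
        rewrite cat_uniq iota_uniq ur andbT/=; apply/hasPn => j /mapP[i + ->].
        rewrite mem_index_iota => /andP[mi _]; rewrite mem_index_iota/= -leqNgt.
        by apply: N'P; exact: leq_trans mi.
      rewrite mem_cat mem_index_iota/= leq_max => /orP[->//|ir].
      by rewrite [X in _ || X](_ : _ = true) ?orbT// ltnS (big_rem i)//= leq_addr.
    by move: xN; lra.
  apply: (@le_lt_trans _ _ (M * (e / (M + 1) / 2))).
    have q0 : 0 <= e / (M + 1) / 2 by rewrite ltW// !divr_gt0.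
    rewrite -(powR_mono p0) ?rnorm_ge0 ?(mulr_ge0 M0 q0)// powRM// (le_trans h)//.
    by rewrite ler_wpM2l// powR_ge0.
  have -> : M * (e / (M + 1) / 2) = e * (M / (M + 1) / 2) by ring.
  rewrite gtr_pMr// ltr_pdivrMr// ltr_pdivrMr// mul1r mulrDr mulr1.
  by move: M0; lra.
exists N' => m n hm hn; have [mn|/ltnW nm] := leqP m n.
  by rewrite rnormBC; exact: tail.
exact: tail.
Qed.

Lemma synthesis_operator : exists V : E -> X, [/\ bop V,
  forall x : E, rnorm (V x) <= M * rnorm x &
  forall x : E, rcvg (fun n => \sum_(i < n) x i *: f i) (V x)].
Proof.
have /choice[V VP] (x : E) : exists v, rcvg (fun n => \sum_(i < n) x i *: f i) v.
  by apply: cX; exact: (synthesis_convergence x (s := id)).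
have VM (x : E) : rnorm (V x) <= M * rnorm x.
  have := @rcvg_le _ _ _ _ _ 0 (M * rnorm x) 0 (VP x); rewrite subr0; apply => n _.
  rewrite subr0 -(powR_mono p0) ?rnorm_ge0 ?mulr_ge0 ?rnorm_ge0//.
  rewrite powRM ?rnorm_ge0// (le_trans (upper n x))// ler_wpM2l ?powR_ge0//.
  exact: ellp_partial_sum.
exists V; split=> //; split; last by exists M.
move=> c x y; apply: rcvg_unique (VP _) _.
have := rcvgD (rcvgZ c (VP x)) (VP y); congr (rcvg _ _).
apply/funext => n; rewrite scaler_sumr -big_split/=; apply: eq_bigr => i _.
by rewrite ellp_linE scalerDl scalerA.
Qed.

End synthesis.

(** * The decomposition method *)

Section pelczynski_decomposition.
Context (R : realType) (k : scalar_kind) (p : R) (p1 : 1 <= p).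
Local Notation K := (scalars R k).
Local Notation E := (ellp R k p1).

Let p0 : 0 < p. Proof. by rewrite (lt_le_trans ltr01). Qed.

Section rows.
Variables (pr : nat * nat -> nat) (up : nat -> nat * nat).
Hypotheses (prK : cancel pr up) (upK : cancel up pr).

Let pr_inj : injective pr := can_inj prK.

(** Through a bijection between pairs and indices, an element of l_p becomes the
sequence of its rows, an element of the l_p-sum of copies of l_p. *)
Lemma row_operators : exists row : nat -> E -> E,
  [/\ forall r, bop (row r), forall r e c, row r e c = e (pr (r, c)) &
  forall m e, \sum_(r < m) rnorm (row r e) `^ p <= rnorm e `^ p].
Proof.
have h : forall r, exists T : E -> E, bop T /\ forall e c, T e c = e (pr (r, c)).
  move=> r; have [|T [bT _ TE]] := @reindex_operator R k p p1 (fun c => Some (pr (r, c))).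
    by move=> i j m [<-] [/pr_inj[]].
  by exists T.
have [row rowP] := choice h; exists row; split=> [r|r e c|m e]; try by have [] := rowP r.
have key C : \sum_(r < m) \sum_(c < C) modulus (row r e c) `^ p <= rnorm e `^ p.
  pose s := [seq pr rc | rc <- [seq (r, c) | r <- iota 0 m, c <- iota 0 C]].
  have us : uniq s.
    rewrite map_inj_uniq// allpairs_uniq ?iota_uniq// => -[a b] [a' b'] _ _ /=.
    by case=> -> ->.
  apply: le_trans (ellp_partial_sum e (\sum_(i <- s) i).+1).
  apply: (@le_trans _ _ (\sum_(i <- s) modulus (e i) `^ p)); last first.
    apply: sum_uniq_le => // [i|i si]; first exact: powR_ge0.
    by rewrite ltnS (big_rem i)//= leq_addr.
  rewrite /s big_map big_allpairs -(big_mkord xpredT (fun r => \sum_(c < C) modulus (row r e c) `^ p)).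
  rewrite /index_iota subn0; apply: ler_sum => r _.
  rewrite -(big_mkord xpredT (fun c => modulus (row r e c) `^ p)) /index_iota subn0.
  by apply: ler_sum => c _; have [_ ->] := rowP r.
apply/ler_addgt0Pr => eta eta0.
have m1 : 0 < (m.+1%:R : R) by rewrite ltr0n.
have [C CP] : exists C, forall r : 'I_m,
    rnorm (row r e) `^ p <= \sum_(c < C) modulus (row r e c) `^ p + eta / m.+1%:R.
  have /choice[c cP] : forall r, exists C, rnorm (row r e) `^ p <=
      \sum_(c < C) modulus (row r e c) `^ p + eta / m.+1%:R.
    by move=> r; apply: ellp_approx; rewrite divr_gt0.
  exists (\sum_(r < m) c r)%N => r; rewrite (le_trans (cP r))// lerD2r.
  rewrite -!(big_mkord xpredT (fun c => modulus (row r e c) `^ p)).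
  apply: sum_uniq_sub => [i||i]; first exact: powR_ge0.
    exact: iota_uniq.
  rewrite !mem_index_iota/= => /leq_trans; apply.
  by rewrite (bigD1 r)//= leq_addr.
apply: (le_trans (ler_sum _ (fun r _ => CP r))); rewrite big_split/=; apply: lerD; first exact: key.
rewrite sumr_const card_ord -[_ *+ m]mulr_natr -mulrA ger_pMr// mulrC.
by rewrite ler_pdivrMr// mul1r ler_nat.
Qed.

(** The bound that makes it possible to glue a sequence of rows together. *)
Lemma assemble_bound (b : nat -> E) B : (forall m, \sum_(r < m) rnorm (b r) `^ p <= B) ->
  forall n, \sum_(i < n) modulus (b (up i).1 (up i).2) `^ p <= B.
Proof.
move=> bB n; pose F rc := modulus (b rc.1 rc.2) `^ p.
rewrite -(big_mkord xpredT (fun i => F (up i))) -(big_map up xpredT F).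
set s := map up _; pose m := (\sum_(rc <- s) (rc.1 + rc.2)).+1%N.
apply: le_trans (bB m).
apply: (@le_trans _ _ (\sum_(r < m) \sum_(c < m) F (val r, val c))); last first.
  by apply: ler_sum => r _; exact: (ellp_partial_sum (b r) m).
pose t := [seq (r, c) | r <- iota 0 m, c <- iota 0 m].
have -> : \sum_(r < m) \sum_(c < m) F (val r, val c) = \sum_(rc <- t) F rc.
  rewrite /t big_allpairs -(big_mkord xpredT (fun r => \sum_(c < m) F (r, val c))).
  rewrite /index_iota subn0; apply: eq_bigr => r _.
  by rewrite -(big_mkord xpredT (fun c => F (r, c))) /index_iota subn0.
apply: sum_uniq_sub => [i||[r c] rcs]; first exact: powR_ge0.
  by rewrite (map_inj_uniq (can_inj upK)) iota_uniq.
have h : (r + c < m)%N by rewrite ltnS (big_rem _ rcs)/= leq_addr.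
by apply/allpairsP; exists (r, c); rewrite !mem_iota/= !add0n
  (leq_ltn_trans (leq_addr c r) h) (leq_ltn_trans (leq_addl r c) h).
Qed.

Lemma diagonal_operator (row : nat -> E -> E) (Q : E -> E) :
  (forall r, bop (row r)) -> (forall r e c, row r e c = e (pr (r, c))) ->
  (forall m e, \sum_(r < m) rnorm (row r e) `^ p <= rnorm e `^ p) -> bop Q ->
  exists D : E -> E, bop D /\ forall r e, row r (D e) = Q (row r e).
Proof.
move=> brow rowE row_le [lQ [C C0 QC]].
have [||n e|D [bD _ DE]] := @analysis_operator R k p p1 E
  (fun i e => Q (row (up i).1 e) (up i).2) C.
- move=> i c u v; have [lr _] := brow (up i).1; by rewrite lr lQ ellp_linE.
- exact: C0.
- apply: (@assemble_bound (fun r => Q (row r e))) => m; apply: (@le_trans _ _ (\sum_(r < m) C `^ p * rnorm (row r e) `^ p)).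
    apply: ler_sum => r _; rewrite -powRM ?rnorm_ge0//.
    by rewrite powR_mono ?rnorm_ge0 ?mulr_ge0 ?rnorm_ge0.
  by rewrite -mulr_sumr ler_wpM2l ?powR_ge0.
by exists D; split=> // r e; apply/ellp_eqP => c; rewrite rowE DE prK.
Qed.

Lemma row_ext (row : nat -> E -> E) e e' :
  (forall r e c, row r e c = e (pr (r, c))) -> (forall r, row r e = row r e') -> e = e'.
Proof.
move=> rowE ee'; apply/ellp_eqP => i; rewrite -(upK i).
by case: (up i) => r c; rewrite -!rowE ee'.
Qed.

End rows.

Lemma pairing_exists : exists (pr : nat * nat -> nat) (up : nat -> nat * nat),
  cancel pr up /\ cancel up pr.
Proof.
have /card_set_bijP[f] := card_nat2; rewrite setTT_bijective => -[g fK gK].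
by exists f, g.
Qed.

Context (X : normedModType K).
Variables (U : X -> E) (V : E -> X).
Hypotheses (bU : bop U) (bV : bop V) (VU : forall x, V (U x) = x).

(** Since l_p is the l_p-sum of infinitely many copies of itself, an Eilenberg
swindle identifies the sum of l_p with a complemented subspace with l_p: the part
Q of each copy is left in place while its part P moves one place up, and the
complemented subspace fills the place so vacated in the first copy. *)
Lemma swindle : exists (W : X -> E -> E) (W1 : E -> X) (W2 : E -> E),
  [/\ forall x y a b c, W (c *: x + y) (c *: a + b) = c *: W x a + W y b,
      exists2 M, 0 <= M & forall x b, rnorm (W x b) <= M * (rnorm x + rnorm b),
      bop W1, bop W2 &
      [/\ forall x b, W1 (W x b) = x, forall x b, W2 (W x b) = b &
          forall e, W (W1 e) (W2 e) = e]].
Proof.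
have [pr [up [prK upK]]] := pairing_exists.
have [row [brow rowE row_le]] := row_operators prK.
pose P e := U (V e); pose Q e := e - P e.
have bP : bop P by exact: bop_comp.
have bQ : bop Q by apply: bopB => //; exact: bop_id.
have [DP [bDP DPE]] := diagonal_operator prK upK brow rowE row_le bP.
have [DQ [bDQ DQE]] := diagonal_operator prK upK brow rowE row_le bQ.
have [|sh [bsh _ shE]] := @reindex_operator R k p p1
    (fun i => Some (pr ((up i).1.+1, (up i).2))).
  move=> i j m [<-] [/(can_inj prK)[h1 h2]]; apply: (can_inj upK).
  by rewrite [up i]surjective_pairing [up j]surjective_pairing h1 h2.
(* sh moves all rows up by one and drops the first, un inserts a zero row, and inz
fills the first row and puts zeros in the others. *)
have [|un [bun _ unE]] := @reindex_operator R k p p1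
    (fun i => if (up i).1 is r.+1 then Some (pr (r, (up i).2)) else None).
  move=> i j m; case ui : (up i) => [[|r] c]//=; case uj : (up j) => [[|r'] c']//=.
  move=> [<-] [/(can_inj prK)[h1 h2]]; apply: (can_inj upK).
  by rewrite ui uj h1 h2.
have [|inz [binz _ inzE]] := @reindex_operator R k p p1
    (fun i => if (up i).1 is r.+1 then None else Some (up i).2).
  move=> i j m; case ui : (up i) => [[|r] c]//=; case uj : (up j) => [[|r'] c']//=.
  by move=> [<-] [h2]; apply: (can_inj upK); rewrite ui uj h2.
have rsh r e : row r (sh e) = row r.+1 e.
  by apply/ellp_eqP => c; rewrite !rowE shE prK.
have run0 e : row 0%N (un e) = 0.
  by apply/ellp_eqP => c; rewrite !rowE unE prK ellp0E.
have runS r e : row r.+1 (un e) = row r e.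
  by apply/ellp_eqP => c; rewrite !rowE unE prK.
have rin0 x : row 0%N (inz x) = x.
  by apply/ellp_eqP => c; rewrite !rowE inzE prK.
have rinS r x : row r.+1 (inz x) = 0.
  by apply/ellp_eqP => c; rewrite !rowE inzE prK ellp0E.
have lrow r := proj1 (brow r); have lP := proj1 bP; have lQ := proj1 bQ.
have lU := proj1 bU; have lV := proj1 bV.
have rowD r a b : row r (a + b) = row r a + row r b by exact: linopD.
have QD a b : Q (a + b) = Q a + Q b by exact: linopD.
have PD a b : P (a + b) = P a + P b by exact: linopD.
have PB a b : P (a - b) = P a - P b by exact: linopB.
have VD a b : V (a + b) = V a + V b by exact: linopD.
have VB a b : V (a - b) = V a - V b by exact: linopB.
have PU x : P (U x) = U x by rewrite /P VU.
have PP e : P (P e) = P e by rewrite {1}/P VU.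
have QP e : Q (P e) = 0 by rewrite /Q PP subrr.
have QU x : Q (U x) = 0 by rewrite /Q PU subrr.
have PQ e : P (Q e) = 0 by rewrite /Q PB PP subrr.
have QQ e : Q (Q e) = Q e by rewrite {1}/Q PQ subr0.
have VP e : V (P e) = V e by rewrite /P VU.
have VQ e : V (Q e) = 0 by rewrite /Q VB VP subrr.
have PQE e : P e + Q e = e by rewrite /Q addrC subrK.
pose W x b := inz (U x) + (DQ b + un (DP b)).
pose W1 e := V (row 0%N e); pose W2 e := DQ e + sh (DP e).
have bW1 : bop (fun x => inz (U x)) by exact: bop_comp.
have bW2 : bop (fun b => DQ b + un (DP b)) by apply: bopD => //; exact: bop_comp.
have rW0 x b : row 0%N (W x b) = U x + Q (row 0%N b).
  by rewrite /W !rowD rin0 DQE run0 addr0.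
have rWS r x b : row r.+1 (W x b) = Q (row r.+1 b) + P (row r b).
  by rewrite /W !rowD rinS add0r DQE runS DPE.
have rW2 r e : row r (W2 e) = Q (row r e) + P (row r.+1 e).
  by rewrite /W2 rowD DQE rsh DPE.
exists W, W1, W2; split.
- move=> x y a b c; have l1 := proj1 bW1 c x y; have l2 := proj1 bW2 c a b.
  by rewrite /W [X in X + _]l1 [X in _ + X]l2 [in RHS]scalerDr addrACA.
- have [_ [M M0 h1]] := bW1; have [_ [N N0 h2]] := bW2.
  exists (M + N) => [|x b]; first exact: addr_ge0.
  rewrite (le_trans (rnormD _ _))// (le_trans (lerD (h1 _) (h2 _)))//.
  by have := rnorm_ge0 x; have := rnorm_ge0 b; nra.
- exact: bop_comp.
- by apply: bopD => //; exact: bop_comp.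
split=> [x b|x b|e].
- by rewrite /W1 rW0 VD VU VQ addr0.
- apply: (row_ext upK rowE) => -[|r]; rewrite rW2 rWS.
    by rewrite rW0 QD PD QU add0r QQ PQ add0r PP addrC PQE.
  by rewrite rWS QD PD QQ QP addr0 PQ add0r PP addrC PQE.
- apply: (row_ext upK rowE) => -[|r].
    by rewrite rW0 rW2 QD QQ QP addr0 (_ : U (W1 e) = P (row 0%N e))// PQE.
  by rewrite rWS !rW2 QD PD QQ QP addr0 PQ add0r PP addrC PQE.
Qed.

Variables (A : E -> X) (B : X -> E).
Hypotheses (bA : bop A) (bB : bop B) (BA : forall e, B (A e) = e).

(** X absorbs a copy of l_p, because l_p is the sum of two copies of itself, and
l_p absorbs X. *)
Lemma pelczynski_decomposition : exists (T : X -> E) (T' : E -> X),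
  [/\ bop T, bop T', cancel T T' & cancel T' T].
Proof.
have [W [W1 [W2 [lW [M M0 WM] bW1 bW2 [W1K W2K WK]]]]] := swindle.
(* The even and the odd coordinates split l_p; X is the range of A B, a copy of
l_p, plus that of id - A B, and J re-inserts a sequence in the odd part. *)
have [|ev [bev _ evE]] := @reindex_operator R k p p1 (fun i => Some i.*2).
  by move=> i j m [<-] [/double_inj].
have [|od [bod _ odE]] := @reindex_operator R k p p1 (fun i => Some i.*2.+1).
  by move=> i j m [<-] [/double_inj].
have odd_half i : odd i -> i = i./2.*2.+1.
  by move=> oi; rewrite -[LHS]odd_double_half oi.
have even_half i : ~~ odd i -> i = i./2.*2.
  by move=> oi; rewrite -[LHS]odd_double_half (negbTE oi).
have [|iev [biev _ ievE]] := @reindex_operator R k p p1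
    (fun i => if odd i then None else Some i./2).
  move=> i j m; case: ifPn => // oi [<-]; case: ifPn => // oj [h].
  by rewrite (even_half i oi) (even_half j oj) h.
have [|iod [biod _ iodE]] := @reindex_operator R k p p1
    (fun i => if odd i then Some i./2 else None).
  move=> i j m; case: ifPn => // oi [<-]; case: ifPn => // oj [h].
  by rewrite (odd_half i oi) (odd_half j oj) h.
have ev_iev e : ev (iev e) = e.
  by apply/ellp_eqP => i; rewrite evE ievE odd_double doubleK.
have od_iod e : od (iod e) = e.
  by apply/ellp_eqP => i; rewrite odE iodE /= odd_double /= uphalf_double.
have ev_iod e : ev (iod e) = 0.
  by apply/ellp_eqP => i; rewrite evE iodE odd_double ellp0E.
have od_iev e : od (iev e) = 0.
  by apply/ellp_eqP => i; rewrite odE ievE /= odd_double ellp0E.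
have merge e : iev (ev e) + iod (od e) = e.
  apply/ellp_eqP => i; rewrite ellpDE ievE iodE.
  case: ifPn => oi; first by rewrite odE -odd_half// add0r.
  by rewrite evE -even_half// addr0.
have lA := proj1 bA; have lB := proj1 bB.
have BD a b : B (a + b) = B a + B b by exact: linopD.
have BBE a b : B (a - b) = B a - B b by exact: linopB.
have evD a b : ev (a + b) = ev a + ev b by exact: linopD (proj1 bev) _ _.
have odD a b : od (a + b) = od a + od b by exact: linopD (proj1 bod) _ _.
pose S1 x := x - A (B x) + A (ev (B x)); pose S2 x := od (B x).
pose J x b := x - A (B x) + A (iev (B x) + iod b).
have bAB : bop (fun x => A (B x)) by exact: bop_comp.
have bS1 : bop S1.
  apply: bopD; first by apply: bopB => //; exact: bop_id.
  by apply: (bop_comp bA); exact: bop_comp.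
have bS2 : bop S2 by exact: bop_comp.
have BS1 x : B (S1 x) = ev (B x).
  by rewrite /S1 BD BBE !BA subrr add0r.
have BJ x b : B (J x b) = iev (B x) + iod b.
  by rewrite /J BD BBE !BA subrr add0r.
have JS x : J (S1 x) (S2 x) = x.
  by rewrite /J BS1 merge /S1 addrK subrK.
have S1J x b : S1 (J x b) = x.
  rewrite /S1 BJ {1}/J addrK evD ev_iev ev_iod addr0 subrK //.
have S2J x b : S2 (J x b) = b.
  by rewrite /S2 BJ odD od_iev od_iod add0r.
have bW1' : bop (fun e => W1 e - A (B (W1 e))).
  by apply: bopB => //; exact: bop_comp bAB bW1.
exists (fun x => W (S1 x) (S2 x)), (fun e => J (W1 e) (W2 e)); split.
- split=> [c x y|]; first by rewrite (proj1 bS1) (proj1 bS2) lW.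
  have [_ [N N0 h1]] := bS1; have [_ [N' N'0 h2]] := bS2.
  exists (M * (N + N')) => [|x]; first by rewrite mulr_ge0// addr_ge0.
  by rewrite (le_trans (WM _ _))// -mulrA ler_wpM2l// mulrDl lerD.
- apply: bopD => //; apply: (bop_comp bA); apply: bopD.
    by apply: (bop_comp biev); exact: bop_comp.
  exact: bop_comp.
- by move=> x; rewrite W1K W2K JS.
- by move=> e; rewrite S1J S2J WK.
Qed.

End pelczynski_decomposition.

(** * Complemented subspaces of l_p *)

Section finite_dimension.
Context (K : numFieldType) (X : normedModType K) (l : nat -> X -> K).
Hypothesis ll : forall i c x y, l i (c *: x + y) = c * l i x + l i y.

(** One vector v j for each functional that does not vanish on the common kernel of
its predecessors: subtracting multiples of them makes the functionals vanish one
after the other. *)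
Lemma functional_residue N : exists m (v : nat -> X), forall x, exists a : nat -> K,
  forall i, (i < N)%N -> l i (x - \sum_(j < m) a j *: v j) = 0.
Proof.
elim: N => [|N [m [v IH]]]; first by exists 0%N, (fun=> 0) => x; exists (fun=> 0).
have lZB i c x y : l i (x - c *: y) = l i x - c * l i y.
  by rewrite addrC -scaleNr ll mulNr addrC.
have [[w [w0 wN]]|now] := pselect (exists w, (forall i, (i < N)%N -> l i w = 0) /\ l N w != 0).
  exists m.+1, (fun j => if j == m then w else v j) => x; have [a aP] := IH x.
  set r := x - _ in aP; exists (fun j => if j == m then l N r / l N w else a j) => i iN.
  rewrite big_ord_recr/= eqxx opprD addrA.
  rewrite (eq_bigr (fun j : 'I_m => a j *: v j)); last first.
    by move=> j _; rewrite ltn_eqF.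
  rewrite -/r lZB; move: iN; rewrite ltnS leq_eqVlt => /predU1P[->|iN].
    by rewrite divfK// subrr.
  by rewrite (aP i iN) (w0 i iN) mulr0 subr0.
exists m, v => x; have [a aP] := IH x; exists a => i.
rewrite ltnS leq_eqVlt => /predU1P[->|iN]; last exact: aP.
apply: contrapT => /eqP h; apply: now; exists (x - \sum_(j < m) a j *: v j); split=> //.
Qed.

Lemma infinite_dimensional_kernel N : ~ finite_dimensional X ->
  exists x, x != 0 /\ forall i, (i < N)%N -> l i x = 0.
Proof.
move=> infX; apply: contrapT => noker; apply: infX.
have [m [v vP]] := functional_residue N; exists m, (fun j => v j) => x.
have [a aP] := vP x; exists (fun j => a j); apply/eqP; rewrite -subr_eq0.
apply/negPn/negP => h; apply: noker; exists (x - \sum_(j < m) a j *: v j); split=> //.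
Qed.

End finite_dimension.

Section gliding_hump.
Context (R : realType) (k : scalar_kind) (p : R) (p1 : 1 <= p).
Local Notation K := (scalars R k).
Local Notation E := (ellp R k p1).

Let p0 : 0 < p. Proof. by rewrite (lt_le_trans ltr01). Qed.

Lemma powR_young (a b : R) : 0 <= a -> 0 <= b -> a `^ p / a * b <= a `^ p + b `^ p.
Proof.
move=> a0 b0; have [->|an0] := eqVneq a 0.
  by rewrite invr0 mulr0 mul0r addr_ge0// powR_ge0.
have [ba|ab] := leP b a.
  rewrite -[X in X <= _]mulrA (@le_trans _ _ (a `^ p))//; last by rewrite lerDl powR_ge0.
  rewrite -[X in _ <= X]mulr1 ler_wpM2l ?powR_ge0// mulrC ler_pdivrMr ?mul1r//.
  by rewrite lt_neqAle eq_sym an0.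
rewrite (@le_trans _ _ (b `^ p))//; last by rewrite lerDr powR_ge0.
rewrite (powR_mulr (gt_eqF p0) a0) (powR_mulr (gt_eqF p0) b0) [a * _]mulrC mulfK// mulrC ler_wpM2l//.
by rewrite ge0_ler_powR ?subr_ge0 ?nnegrE// ltW.
Qed.

(** Hoelder's inequality up to the factor 2, by homogeneity. *)
Lemma block_hoelder (r : seq nat) (z y : nat -> K) :
  \sum_(i <- r) modulus (z i) `^ p <= 1 ->
  \sum_(i <- r) modulus (z i) `^ p / modulus (z i) * modulus (y i) <=
  2 * (\sum_(i <- r) modulus (y i) `^ p) `^ p^-1.
Proof.
move=> z1; set S := \sum_(i <- r) modulus (y i) `^ p.
have S0 : 0 <= S by rewrite sumr_ge0// => i _; exact: powR_ge0.
have Y0 : 0 <= S `^ p^-1 by exact: powR_ge0.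
have [Yz|Yn0] := eqVneq (S `^ p^-1) 0.
  have S00 : S = 0 by rewrite -(@powRVK _ S p) ?gt_eqF// Yz powR0// gt_eqF.
  rewrite Yz mulr0 big_seq big1// => i ir.
  have : modulus (y i) `^ p <= S.
    by rewrite /S (big_rem i)//= lerDl sumr_ge0// => j _; exact: powR_ge0.
  rewrite S00 => h; have /eqP : modulus (y i) `^ p == 0 by rewrite eq_le h powR_ge0.
  by move=> /eqP; rewrite powR_eq0 => /andP[/eqP -> _]; rewrite mulr0.
have Yp : 0 < S `^ p^-1 by rewrite lt_neqAle eq_sym Yn0.
rewrite -ler_pdivrMr// mulr_suml.
apply: (@le_trans _ _ (\sum_(i <- r) (modulus (z i) `^ p + modulus (y i) `^ p / S))).
  apply: ler_sum => i _; rewrite -[_ * modulus (y i) / _]mulrA.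
  have yn : 0 <= modulus (y i) / S `^ p^-1 by rewrite divr_ge0 ?modulus_ge0.
  apply: (le_trans (powR_young (modulus_ge0 _) yn)).
  rewrite lerD2l powRM ?modulus_ge0 ?invr_ge0//.
  have Vp : (S `^ p^-1)^-1 `^ p = S^-1.
    rewrite -[X in X `^ p]powR_inv1// -powRrM mulN1r powRN powRVK// gt_eqF//.
  by rewrite Vp.
rewrite big_split/= -mulr_suml -/S divff.
  by rewrite (_ : 2 = 1 + 1 :> R)// lerD2r.
by apply: contraNneq Yn0 => ->; rewrite powR0// invr_eq0 gt_eqF.
Qed.

Lemma tail_operator N : exists T : E -> E, [/\ bop T, forall x, rnorm (T x) <= rnorm x,
  forall x i, T x i = if (i < N)%N then 0 else x i &
  forall x, rnorm (T x) `^ p <= rnorm x `^ p - \sum_(i < N) modulus (x i) `^ p].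
Proof.
have [|T [bT T1 TE]] := @reindex_operator R k p p1
    (fun i => if (i < N)%N then None else Some i).
  by move=> i j m; case: ifP => // _ [<-]; case: ifP => // _ [].
have {}TE x i : T x i = if (i < N)%N then 0 else x i by rewrite TE; case: ifP.
exists T; split=> // x; apply: ellp_rnorm_le => n; rewrite lerBrDr.
apply: le_trans (ellp_partial_sum x (maxn n N)).
rewrite -!(big_mkord xpredT (fun i => modulus (x i) `^ p)).
rewrite -(big_mkord xpredT (fun i => modulus (T x i) `^ p)).
have -> : \sum_(0 <= i < maxn n N) modulus (x i) `^ p =
    \sum_(N <= i < maxn n N) modulus (x i) `^ p + \sum_(0 <= i < N) modulus (x i) `^ p.
  by rewrite addrC -big_cat_nat// leq_maxr.
rewrite lerD2r.
have [nN|/ltnW Nn] := leqP n N.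
  rewrite big_nat_cond big1 ?sumr_ge0// => [i _|i]; first exact: powR_ge0.
  rewrite andbT => /andP[_ iN]; rewrite TE (leq_trans iN nN).
  by rewrite modulus0 powR0// gt_eqF.
rewrite (@big_cat_nat _ _ _ N 0 n)//= big_nat_cond big1 ?add0r.
  rewrite big_nat_cond [X in _ <= X]big_nat_cond; apply: ler_sum => i.
  by rewrite andbT => /andP[Ni _]; rewrite TE ltnNge Ni.
move=> i; rewrite andbT => /andP[_ iN]; rewrite TE iN.
by rewrite modulus0 powR0// gt_eqF.
Qed.

Lemma ellp_truncation (x : E) (e : nat -> E) :
  (forall n i, e n i = (i == n)%:R) -> rcvg (fun n => \sum_(i < n) x i *: e i) x.
Proof.
move=> eE eta eta0; have etap : 0 < (eta / 2) `^ p by rewrite powR_gt0// divr_gt0.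
have [N xN] := ellp_approx x etap; exists N => n Nn.
have [T [_ _ TE Tle]] := tail_operator n.
have -> : \sum_(i < n) x i *: e i - x = - T x.
  apply/ellp_eqP => i; rewrite -[- T x]sub0r !ellpBE ellp0E ellp_sumE TE.
  under eq_bigr do rewrite ellpZE eE.
  case: ifPn => [i_n|].
    rewrite (bigD1 (Ordinal i_n))//= eqxx mulr1 big1 ?addr0 ?subrr ?subr0// => j jn.
    have -> : (i == j) = false by apply: contraNF jn => /eqP ij; exact/eqP/val_inj.
    by rewrite mulr0.
  rewrite -leqNgt => ni; rewrite big1 ?sub0r// => j _.
  by rewrite gtn_eqF ?mulr0// (leq_trans _ ni).
rewrite rnormN (@le_lt_trans _ _ (eta / 2))//; last by rewrite ltr_pdivrMr// ltr_pMr// ltr1n.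
rewrite -(powR_mono p0) ?rnorm_ge0 ?divr_ge0 ?(ltW eta0)// (le_trans (Tle x))//.
have : \sum_(i < N) modulus (x i) `^ p <= \sum_(i < n) modulus (x i) `^ p.
  rewrite -!(big_mkord xpredT (fun i => modulus (x i) `^ p)).
  apply: sum_uniq_sub => [i||i]; [exact: powR_ge0|exact: iota_uniq|].
  by rewrite !mem_index_iota/= => /leq_trans; apply.
by move: xN; lra.
Qed.

Context (X : normedModType K) (cX : rcomplete X) (infX : ~ finite_dimensional X).
Variables (U : X -> E) (V : E -> X).
Hypotheses (bU : bop U) (bV : bop V) (VU : forall x, V (U x) = x).

(** In infinite dimension, N coordinates vanish together at some nonzero vector, and
the injectivity of U permits to normalize its image. *)
Lemma hump N (e : R) : 0 < e -> exists x N', [/\ (N < N')%N, rnorm (U x) = 1,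
  forall i, (i < N)%N -> U x i = 0 &
  1 - e <= \sum_(i < N') modulus (U x i) `^ p].
Proof.
move=> e0; have lU := proj1 bU.
have [|x [x0 xN]] := @infinite_dimensional_kernel K X (fun i x => U x i) _ N infX.
  by move=> i c x y; rewrite lU ellp_linE.
have Ux0 : U x != 0.
  by apply: contraNneq x0 => h; rewrite -(VU x) h (linop0 (proj1 bV)).
have rU := rnorm_gt0 Ux0.
pose x' := scalar_of k (rnorm (U x))^-1 *: x.
have Ux' : rnorm (U x') = 1.
  rewrite /x' linopZ// rnormZ modulus_of ger0_norm ?invr_ge0 ?(ltW rU)//.
  by rewrite mulVf// gt_eqF.
have [M xM] := ellp_approx (U x') e0.
exists x', (maxn M N.+1); split=> //; first by rewrite leq_max leqnn orbT.
  by move=> i iN; rewrite /x' linopZ// ellpZE xN// mulr0.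
rewrite Ux' powR1 in xM.
have : \sum_(i < M) modulus (U x' i) `^ p <= \sum_(i < maxn M N.+1) modulus (U x' i) `^ p.
  rewrite -!(big_mkord xpredT (fun i => modulus (U x' i) `^ p)).
  apply: sum_uniq_sub => [i||i]; [exact: powR_ge0|exact: iota_uniq|].
  by rewrite !mem_index_iota/= leq_max => ->.
by move: xM; lra.
Qed.

End gliding_hump.

Section complemented_copy.
Context (R : realType) (k : scalar_kind) (p : R) (p1 : 1 <= p).
Local Notation K := (scalars R k).
Local Notation E := (ellp R k p1).

Let p0 : 0 < p. Proof. by rewrite (lt_le_trans ltr01). Qed.

Lemma disjoint_sum_powR (n : nat) (c : nat -> K) :
  (forall i j, (i < n)%N -> (j < n)%N -> i <> j -> c i = 0 \/ c j = 0) ->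
  modulus (\sum_(i < n) c i) `^ p <= \sum_(i < n) modulus (c i) `^ p.
Proof.
move=> disj; have [[i [iltn ci]]|c0] := pselect (exists i, (i < n)%N /\ c i != 0); last first.
  rewrite big1; first by rewrite modulus0 powR0 ?gt_eqF// sumr_ge0// => i _; exact: powR_ge0.
  by move=> i _; apply: contrapT => /eqP h; apply: c0; exists i.
rewrite (bigD1 (Ordinal iltn))//= big1 ?addr0.
  by rewrite (bigD1 (Ordinal iltn))//= lerDl sumr_ge0// => j _; exact: powR_ge0.
move=> j /eqP ji; have [|ci0|//] := disj i j iltn (ltn_ord j).
  by move=> ij; apply: ji; apply/val_inj.
by rewrite ci0 eqxx in ci.
Qed.

Context (X : normedModType K) (cX : rcomplete X) (infX : ~ finite_dimensional X).
Variables (U : X -> E) (V : E -> X).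
Hypotheses (bU : bop U) (bV : bop V) (VU : forall x, V (U x) = x).

(** A sequence of unit vectors of U X which are, up to small errors t n, supported
in successive blocks. The span of the blocks z n is a copy of l_p, and the
functionals phi n norming the blocks form a bounded operator which maps z n to
the n-th basis vector. The errors perturb the identity by at most one half, and
this perturbation is undone by a Neumann series. *)
Lemma complemented_copy : exists (A : E -> X) (B : X -> E),
  [/\ bop A, bop B & forall e, B (A e) = e].
Proof.
pose del n : R := 2^-1 ^+ n / 16.
have half0 n : 0 < (2^-1 : R) ^+ n by rewrite exprn_gt0.
have half1 n : (2^-1 : R) ^+ n <= 1 by rewrite exprn_ile1// invf_le1 ?ler1n.
have del0 n : 0 < del n by rewrite divr_gt0.
have delp n : del n `^ p <= 1 / 16.
  apply: (@le_trans _ _ (del n `^ 1)).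
    by rewrite ger_powR// del0/= ler_pdivrMr// mul1r (le_trans (half1 n))// ler1n.
  by rewrite (powRr1 (ltW (del0 n))) ler_pM2r.
have /choice[st stP] (nN : nat * nat) : exists xN : X * nat, [/\ (nN.2 < xN.2)%N,
    rnorm (U xN.1) = 1, forall i, (i < nN.2)%N -> U xN.1 i = 0 &
    1 - del nN.1 `^ p <= \sum_(i < xN.2) modulus (U xN.1 i) `^ p].
  have [x [N' [h1 h2 h3 h4]]] := hump infX bU bV VU nN.2 (powR_gt0 p (del0 nN.1)).
  by exists (x, N').
pose N := fix N n := if n is m.+1 then (st (m, N m)).2 else 0%N.
pose x n := (st (n, N n)).1; pose y n : E := U (x n).
have NS n : (N n < N n.+1)%N by have [] := stP (n, N n).
have Nmon : {homo N : m n / (m <= n)%N}.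
  by apply: homo_leq => // [a b c|j]; [exact: leq_trans|exact: ltnW].
have y1 n : rnorm (y n) = 1 by have [] := stP (n, N n).
have ylow n i : (i < N n)%N -> y n i = 0 by have [_ _ h _] := stP (n, N n); exact: h.
have ymass n : 1 - del n `^ p <= \sum_(i < N n.+1) modulus (y n i) `^ p.
  by have [] := stP (n, N n).
have /choice[Tl TlP] := @tail_operator R k p p1.
pose t n : E := Tl (N n.+1) (y n); pose z n : E := y n - t n.
have tE n i : t n i = if (i < N n.+1)%N then 0 else y n i.
  by have [_ _ -> _] := TlP (N n.+1).
have zE n i : z n i = if (i < N n.+1)%N then y n i else 0.
  by rewrite ellpBE tE; case: ifP; rewrite ?subr0 ?subrr.
have tdel n : rnorm (t n) <= del n.
  rewrite -(powR_mono p0) ?rnorm_ge0 ?(ltW (del0 n))//.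
  have [_ _ _ h] := TlP (N n.+1); rewrite (le_trans (h (y n)))// y1 powR1.
  by rewrite lerBlDr -lerBlDl.
have z1 n : rnorm (z n) `^ p <= 1.
  apply: ellp_rnorm_le => m.
  apply: (@le_trans _ _ (rnorm (y n) `^ p)); last by rewrite y1 powR1.
  apply: le_trans (ellp_partial_sum (y n) m); apply: ler_sum => i _; rewrite zE.
  by case: ifP => // _; rewrite modulus0 powR0 ?powR_ge0// gt_eqF.
pose blk m := index_iota (N m) (N m.+1).
pose mass m := \sum_(i <- blk m) modulus (y m i) `^ p.
have massE m : mass m = \sum_(i < N m.+1) modulus (y m i) `^ p.
  rewrite /mass -(big_mkord xpredT (fun i => modulus (y m i) `^ p)).
  rewrite [RHS](@big_cat_nat _ _ _ (N m))//= ?(ltnW (NS m))//.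
  have -> : \sum_(0 <= i < N m) modulus (y m i) `^ p = 0.
    rewrite big_nat_cond big1// => i /andP[/andP[_ iN] _].
    by rewrite ylow// modulus0 powR0// gt_eqF.
  by rewrite add0r.
have mass_ge m : 1 / 2 <= mass m.
  by rewrite massE (le_trans _ (ymass m))//; have := delp m; lra.
have mass_gt0 m : 0 < mass m by apply: lt_le_trans (mass_ge m); rewrite divr_gt0.
have mass_le m : mass m <= 1.
  by rewrite massE (le_trans (ellp_partial_sum (y m) _))// y1 powR1.
(* Up to the normalization, the coefficients c m i on the block m are those of the
functional that norms y m in l_p. *)
pose c m i : K := scalar_of k (modulus (y m i) `^ p / mass m) / y m i.
pose phi m (v : E) : K := \sum_(i <- blk m) c m i * v i.
have phi_lin m a u v : phi m (a *: u + v) = a * phi m u + phi m v.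
  rewrite /phi mulr_sumr -big_split/=; apply: eq_bigr => i _.
  by rewrite ellp_linE mulrDr mulrCA.
have phi_le m v : modulus (phi m v) <= 4 * (\sum_(i <- blk m) modulus (v i) `^ p) `^ p^-1.
  rewrite (le_trans (modulus_sum _ _ _))//.
  have -> : \sum_(i <- blk m) modulus (c m i * v i) = (mass m)^-1 *
      \sum_(i <- blk m) modulus (y m i) `^ p / modulus (y m i) * modulus (v i).
    rewrite mulr_sumr; apply: eq_bigr => i _.
    rewrite !modulusM modulus_of modulusV ger0_norm; last by rewrite divr_ge0 ?powR_ge0// ltW.
    by ring.
  rewrite mulrC ler_pdivrMr//.
  apply: (le_trans (block_hoelder p1 _ (mass_le m))).
  rewrite mulrAC ler_wpM2r ?powR_ge0//.
  by have := mass_ge m; lra.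
have blocks_sum (v : E) m : \sum_(j < m) \sum_(i <- blk j) modulus (v i) `^ p =
    \sum_(i < N m) modulus (v i) `^ p.
  elim: m => [|m IH]; first by rewrite !big_ord0.
  rewrite big_ord_recr/= IH -!(big_mkord xpredT (fun i => modulus (v i) `^ p)).
  by rewrite -big_cat_nat//= ltnW.
have [||m v|B0 [bB0 B04 B0E]] := @analysis_operator R k p p1 E phi 4.
- exact: phi_lin.
- by [].
- have step (j : 'I_m) : true -> modulus (phi j v) `^ p <=
      4 `^ p * \sum_(i <- blk j) modulus (Lp_repr v i) `^ p.
    have S0 : 0 <= \sum_(i <- blk j) modulus (Lp_repr v i) `^ p.
      by rewrite sumr_ge0// => i _; exact: powR_ge0.
    rewrite -[X in _ <= _ * X](@powRVK _ _ p) ?gt_eqF// -powRM ?powR_ge0//.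
    by rewrite powR_mono ?modulus_ge0 ?mulr_ge0 ?powR_ge0.
  apply: (le_trans (ler_sum _ step)).
  rewrite -mulr_sumr blocks_sum ler_wpM2l ?powR_ge0//; exact: ellp_partial_sum.
have /choice[e /all_and2[eE e1]] := @ellp_basis R k p p1.
have B0z n : B0 (z n) = e n.
  apply/ellp_eqP => m; rewrite B0E eE /phi; have [mn|nm|->] := ltngtP m n.
  - rewrite big_seq big1// => i; rewrite mem_index_iota => /andP[_ iN].
    rewrite zE ylow ?if_same ?mulr0//; apply: leq_trans iN _; exact: Nmon.
  - rewrite big_seq big1// => i; rewrite mem_index_iota => /andP[Ni _].
    have -> : z n i = 0 by rewrite zE ltnNge (leq_trans _ Ni)//; exact: Nmon.
    by rewrite mulr0.
  - transitivity (\sum_(i <- blk n) scalar_of k (modulus (y n i) `^ p / mass n)).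
      rewrite big_seq [RHS]big_seq; apply: eq_bigr => i; rewrite mem_index_iota => /andP[_ iN].
      rewrite zE iN /c; have [y0|y0] := eqVneq (y n i) 0; last by rewrite divfK.
      by rewrite y0 modulus0 powR0 ?gt_eqF// mul0r mulr0 scalar_of0.
    rewrite -(big_morph _ (@scalar_ofD R k) (scalar_of0 R k)) -mulr_suml.
    by rewrite -/(mass n) divff ?gt_eqF// scalar_of1.
have [lU [MU MU0 UM]] := bU; have [lV [MV MV0 VM]] := bV; have lB0 := proj1 bB0.
have upper n (a : nat -> K) : rnorm (\sum_(i < n) a i *: x i) `^ p <=
    (2 * MV) `^ p * \sum_(i < n) modulus (a i) `^ p.
  set S := \sum_(i < n) modulus (a i) `^ p.
  have S0 : 0 <= S by rewrite sumr_ge0// => i _; exact: powR_ge0.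
  have SP : 0 <= S `^ p^-1 by exact: powR_ge0.
  rewrite -[S](@powRVK _ _ p) ?gt_eqF// -powRM ?mulr_ge0//.
  rewrite powR_mono ?rnorm_ge0 ?mulr_ge0//.
  have -> : \sum_(i < n) a i *: x i = V (\sum_(i < n) a i *: y i).
    rewrite (linop_sum lV); apply: eq_bigr => i _.
    by rewrite (linopZ lV) VU.
  rewrite (le_trans (VM _))// [2 * MV]mulrC -mulrA ler_wpM2l//.
  have -> : \sum_(i < n) a i *: y i = \sum_(i < n) a i *: z i + \sum_(i < n) a i *: t i.
    by rewrite -big_split/=; apply: eq_bigr => i _; rewrite -scalerDr subrK.
  rewrite (le_trans (rnormD _ _))//.
  rewrite (_ : 2 * S `^ p^-1 = S `^ p^-1 + S `^ p^-1); last by rewrite mulrDl mul1r.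
  apply: lerD.
    rewrite -(powR_mono p0) ?rnorm_ge0// powRVK ?gt_eqF//.
    apply: ellp_rnorm_le => m.
    apply: (@le_trans _ _ (\sum_(i < m) \sum_(j < n) modulus (a j * z j i) `^ p)).
      apply: ler_sum => i _; rewrite ellp_sumE.
      under eq_bigr do rewrite ellpZE.
      apply: (@disjoint_sum_powR n (fun j => a j * z j i)) => j j' _ _ jj'.
      have key u v : (u < v)%N -> a u * z u i = 0 \/ a v * z v i = 0.
        move=> uv; have [iN|Ni] := ltnP i (N u.+1); last first.
          by left; rewrite zE ltnNge Ni mulr0.
        right; rewrite zE ylow ?if_same ?mulr0//.
        exact: leq_trans (Nmon _ _ uv).
      have [/key//|/key[]|//] := ltngtP j j'; by [right|left].
    rewrite exchange_big/=; apply: ler_sum => j _.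
    rewrite (eq_bigr (fun i : 'I_m => modulus (a j) `^ p * modulus (z j i) `^ p)); last first.
      by move=> i _; rewrite modulusM powRM ?modulus_ge0.
    rewrite -mulr_sumr -[X in _ <= X]mulr1 ler_wpM2l ?powR_ge0//.
    exact: le_trans (ellp_partial_sum _ _) (z1 j).
  rewrite (le_trans (rnorm_sum _ _ _))//.
  apply: (@le_trans _ _ (\sum_(i < n) S `^ p^-1 * (2^-1 ^+ i / 16))).
    apply: ler_sum => i _; rewrite rnormZ ler_pM ?modulus_ge0 ?rnorm_ge0//.
      by apply: (powR_sum_le (a := fun i => modulus (a i))) => // j; exact: modulus_ge0.
  rewrite -mulr_sumr -[X in _ <= X]mulr1 ler_wpM2l// -mulr_suml.
  by have := @sum_half_powers R n; lra.
have [|A0 [bA0 _ A0cv]] := @synthesis_operator R k p p1 X cX x (2 * MV) _ upper.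
  by rewrite mulr_ge0.
pose B v := B0 (U v); have bB : bop B by exact: bop_comp.
have lB := proj1 bB; have lA0 := proj1 bA0.
(* B A0 maps the n-th basis vector to its sum with B0 (t n). *)
pose L a := B (A0 a) - a.
have bL : bop L by apply: bopB; [exact: bop_comp|exact: bop_id].
have L2 a : rnorm (L a) <= rnorm a / 2.
  have c1 := bop_cvg bB (A0cv a); have c2 := @ellp_truncation R k p p1 a e eE.
  have c3 := rcvgD c1 (rcvgZ (-1) c2); rewrite scaleN1r -/(L a) in c3.
  have := @rcvg_le _ _ _ _ _ 0 (rnorm a / 2) 0 c3; rewrite subr0; apply => n _.
  rewrite subr0 scaleN1r (linop_sum lB) -sumrB.
  rewrite (eq_bigr (fun i : 'I_n => a i *: B0 (t i))); last first.
    move=> i _; rewrite (linopZ lB) -scalerBr; congr (_ *: _).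
    by rewrite /B -/(y i) -(subrK (t i) (y i)) (linopD lB0) -/(z i) B0z addrC addKr.
  rewrite (le_trans (rnorm_sum _ _ _))//.
  apply: (@le_trans _ _ (\sum_(i < n) rnorm a * (2^-1 ^+ i / 4))).
    apply: ler_sum => i _; rewrite rnormZ ler_pM ?modulus_ge0 ?rnorm_ge0//.
      exact: ellp_coord_le.
    rewrite (le_trans (B04 _))//; have := tdel i; rewrite /del; lra.
  rewrite -mulr_sumr ler_wpM2l ?rnorm_ge0// -mulr_suml.
  by have := @sum_half_powers R n; lra.
have cE : rcomplete E by exact: Lp_complete.
have [Nm [N1 N2 bN]] := bop_neumann cE (proj1 bL) L2.
exists (fun a => A0 (Nm a)), B; split=> // [|a]; first exact: bop_comp.
by have := N2 a; rewrite /L addrC subrK.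
Qed.

(** U and V exhibit X as a complemented subspace of l_p. That such a space is
isomorphic to l_p is a theorem of Pelczynski. *)
Lemma complemented_isomorphic : exists (T : X -> E) (T' : E -> X),
  [/\ bop T, bop T', cancel T T' & cancel T' T].
Proof.
have [A [B [bA bB BA]]] := complemented_copy.
exact: (pelczynski_decomposition bU bV VU bA bB BA).
Qed.

End complemented_copy.

(** * Frames with an upper and a lower estimate *)

Section frames_with_upper_estimate.
Context (R : realType) (k : scalar_kind) (p : R) (p1 : 1 <= p).
Local Notation K := (scalars R k).
Local Notation E := (ellp R k p1).
Context (X : normedModType K) (cX : rcomplete X).

Let p0 : 0 < p. Proof. by rewrite (lt_le_trans ltr01). Qed.

Lemma isomorphism_bop (V W : normedModType K) (S : {linear V -> W}) : isomorphism S <->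
  bop S /\ exists S' : W -> V, [/\ cancel S S', cancel S' S & bop S'].
Proof.
split=> [[bS [S' [SK S'K bS']]]|[[lS bS] [S' [SK S'K [lS' bS']]]]]; last first.
  split; first exact/bounded_opP.
  by exists S'; split=> //; exact/bounded_opP.
split; first by split; [exact: linear_linop|exact/bounded_opP].
exists S'; split=> //; split; last exact/bounded_opP.
by move=> a x y; apply: (can_inj SK); rewrite linearP !S'K.
Qed.

Lemma dual_norm_ge0 (F : dual_space X) : 0 <= dual_norm F.
Proof.
apply: le_trans (modulus_ge0 (F 0)) _; apply: sup_upper_bound.
  exact: dual_norm_has_sup.
by exists 0 => //=; rewrite rnorm0.
Qed.

Lemma upper_lp_estimateP (f : nat -> X) : upper_lp_estimate p f ->
  exists2 M : R, 0 <= M & forall n (a : nat -> K),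
    rnorm (\sum_(i < n) a i *: f i) `^ p <= M `^ p * \sum_(i < n) modulus (a i) `^ p.
Proof.
move=> [M [M0 fM]]; exists M => [|n a]; first exact: ltW.
have S0 : 0 <= \sum_(i < n) modulus (a i) `^ p.
  by rewrite sumr_ge0// => i _; exact: powR_ge0.
have := fM n (fun i => a i); rewrite -(powR_mono p0) ?rnorm_ge0//; last first.
  by rewrite mulr_ge0 ?powR_ge0// ltW.
by rewrite powRM ?powR_ge0 ?(ltW M0)// powRVK// gt_eqF.
Qed.

Lemma closed_range (P : E -> E) : bop P -> closed [set y | P y = y].
Proof.
move=> bP y yP; have [lQ [M M0 QM]] := bopB bP (@bop_id R k E).
apply/eqP; rewrite /= -subr_eq0; apply/eqP/rnorm_eq0/eqP.
rewrite eq_le rnorm_ge0 andbT; apply/ler_addgt0Pl => e e0; rewrite addr0.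
have M1 : 0 < M + 1 by rewrite ltr_wpDl.
have d0 : (0 : K) < scalar_of k (e / (M + 1)).
  by rewrite -(scalar_of0 R k) scalar_of_lt divr_gt0.
have [z [/= Pz]] := yP _ (nbhsx_ballx y _ d0).
rewrite -ball_normE /ball_ /= -rnorm_of scalar_of_lt => yz.
have h := QM (y - z); rewrite (linopB lQ) Pz subrr subr0 in h.
rewrite (le_trans h)// (@le_trans _ _ ((M + 1) * rnorm (y - z)))//.
  by rewrite ler_wpM2r ?rnorm_ge0// lerDl.
by rewrite mulrC -ler_pdivlMr// ltW.
Qed.

Variables (f : nat -> X) (f' : nat -> dual_space X).
Hypothesis f_upper : upper_lp_estimate p f.
Variables (C : R) (C0 : 0 <= C).
Hypothesis f_lower : forall n g,
  \sum_(i < n) modulus (f' i g) `^ p <= C `^ p * rnorm g `^ p.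
Hypothesis f_frame : approximate_schauder_frame f f'.

(** The upper estimate makes the synthesis operator V bounded on l_p and the lower
one makes the analysis operator T bounded into l_p; V T is the frame operator
S. *)
Lemma frame_operators : exists (T : X -> E) (V : E -> X) (S' : X -> X),
  [/\ bop T, bop V & bop S'] /\
  [/\ forall g i, T g i = f' i g, forall x : E, rcvg (fun n => \sum_(i < n) x i *: f i) (V x),
      forall g, S' (V (T g)) = g & forall g, V (T (S' g)) = g].
Proof.
have [T [bT _ TE]] := analysis_operator p1 (fun i => @dual_linop _ _ _ (f' i)) C0 f_lower.
have [M M0 fM] := upper_lp_estimateP f_upper.
have [V [bV _ VE]] := synthesis_operator p1 cX M0 fM.
have [S [/isomorphism_bop[bS [S' [SK S'K bS']]] fS]] := f_frame.
have VT g : V (T g) = S g.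
  apply: rcvg_unique (VE _) _; have /rcvgP := fS g; congr rcvg.
  apply/funext => n; rewrite /series/= big_mkord.
  by apply: eq_bigr => i _; rewrite TE.
by exists T, V, S'; split=> //; split=> // g; rewrite VT ?SK ?S'K.
Qed.

(** T S' V is a projection onto the range of T. *)
Lemma frame_complemented : exists (Y : closed_subspace E) (T : {linear X -> Y}),
  [/\ complemented Y, isomorphism T &
      forall (g : X) (i : nat), Lp_repr (csub_val (T g)) i = f' i g].
Proof.
have [T [V [S' [[bT bV bS'] [TE _ S'VT VTS']]]]] := frame_operators.
pose P y := T (S' (V y)).
have bP : bop P by apply: (bop_comp bT); exact: bop_comp.
have lP := proj1 bP.
have PP y : P (P y) = P y by rewrite /P S'VT.
have Y0 : [set y | P y = y] 0 by exact: linop0.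
have YP (a : K) x y : [set y | P y = y] x -> [set y | P y = y] y ->
    [set y | P y = y] (a *: x + y).
  by move=> /= xY yY; rewrite lP xY yY.
pose Y := ClosedSubspace Y0 YP (closed_range bP).
have TY g : csub_pred Y (T g) by apply/asboolP => /=; rewrite /P S'VT.
pose TT g : Y := CSub (TY g).
have lTT : linop TT by move=> a x y; apply/val_inj; exact: (proj1 bT).
exists Y, (linop_linear lTT); split.
- exists (linop_linear lP); split=> [|x|y]; [|exact: PP|by []].
  by have [_ ?] := bP; apply/bounded_opP.
- apply/isomorphism_bop; split.
    by split=> //; have [] := bT.
  exists (fun y => S' (V (csub_val y))); split=> [g|y|].
  + exact: S'VT.
  + apply/val_inj => /=; exact: (csub_valP y).
  + have bSV : bop (fun y => S' (V y)) by exact: bop_comp.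
    split=> [a x y|]; first exact: (proj1 bSV a (csub_val x) (csub_val y)).
    have [_ [N N0 SVN]] := bSV; exists N => // y; exact: (SVN (csub_val y)).
- by move=> g i; exact: TE.
Qed.

Hypothesis X_infinite : ~ finite_dimensional X.

Lemma frame_isomorphic : isomorphic X E.
Proof.
have [T [V [S' [[bT bV bS'] [_ _ _ VTS']]]]] := frame_operators.
have bU : bop (fun x => T (S' x)) by exact: bop_comp.
have [W [W' [bW bW' WK W'K]]] := complemented_isomorphic cX X_infinite bU bV VTS'.
exists (linop_linear (proj1 bW)); apply/isomorphism_bop; split=> //.
by exists W'.
Qed.

(** Precomposing the coordinates with the inverse of V T gives a frame with dual
functionals G i, which need not be bounded below. A right inverse U of V stays
one when Z - U V Z is added to it. Let Z be a small multiple of an isomorphism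
onto l_p, with only those coordinates kept for which G i is small: these
functionals become large, and the others are composed with the operator
id - V Z, a small perturbation of the identity. *)
Lemma frame_seminormalized : exists F' : nat -> dual_space X,
  [/\ dual_seminormalized F', schauder_frame f F' & unconditional_frame f F'].
Proof.
have [T [V [S' [[bT bV bS'] [_ VE _ VTS']]]]] := frame_operators.
have [M M0 fM] := upper_lp_estimateP f_upper.
pose U x : E := T (S' x); have bU : bop U by exact: bop_comp.
have VU x : V (U x) = x by exact: VTS'.
have [W [W' [bW bW' WK W'K]]] := complemented_isomorphic cX X_infinite bU bV VU.
have [_ [CV CV0 VC]] := bV; have [_ [CW CW0 WC]] := bW; have [_ [CW' CW'0 W'C]] := bW'.
have coord_dual (Z : X -> E) : bop Z ->
    exists F : nat -> dual_space X, forall i x, F i x = Z x i.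
  move=> [lZ [N N0 ZN]].
  have h i : exists F : dual_space X, forall x, F x = Z x i.
    have [||F FE] := @mk_dual R k X (fun x => Z x i) N.
    - by move=> a x y; rewrite lZ ellp_linE.
    - by move=> x; rewrite (le_trans (ellp_coord_le _ i)).
    - by exists F => x; rewrite FE.
  by have [F FP] := choice h; exists F.
have [G GE] := coord_dual U bU.
pose c := CW' + 1; have c0 : 0 < c by rewrite ltr_wpDl.
have CWV : 0 < CW * CV + 1 by rewrite ltr_wpDl// mulr_ge0.
pose theta := (2 * (CW * CV + 1))^-1.
have theta0 : 0 < theta by rewrite invr_gt0 mulr_gt0.
have thetaWV : theta * (CW * CV) <= 1 / 2.
  by rewrite /theta mulrC ler_pdivrMr ?mulr_gt0//; lra.
pose eta := theta / (3 * c); have eta0 : 0 < eta by rewrite divr_gt0// mulr_gt0.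
have [|D [bD D1 DE]] := @reindex_operator R k p p1
    (fun i => if dual_norm (G i) < eta then Some i else None).
  by move=> i j m; case: ifP => // _ [<-]; case: ifP => // _ [].
pose Z x : E := scalar_of k theta *: D (W x).
have bZ : bop Z by apply: bopZ; exact: bop_comp.
have Zle x : rnorm (V (Z x)) <= rnorm x / 2.
  rewrite (le_trans (VC _))// rnormZ modulus_of gtr0_norm//.
  apply: (@le_trans _ _ (CV * (theta * (CW * rnorm x)))).
    by rewrite ler_wpM2l// ler_wpM2l ?(ltW theta0)// (le_trans (D1 _)).
  have -> : CV * (theta * (CW * rnorm x)) = theta * (CW * CV) * rnorm x by ring.
  by rewrite [X in _ <= X]mulrC ler_wpM2r ?rnorm_ge0// -div1r.
pose U' x : E := U x + (Z x - U (V (Z x))).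
have bU' : bop U'.
  by apply: bopD => //; apply: bopB => //; apply: (bop_comp bU); exact: bop_comp.
have VU' x : V (U' x) = x.
  rewrite /U' (linopD (proj1 bV)) (linopB (proj1 bV)) !VU.
  by rewrite subrr addr0.
have [F FE] := coord_dual U' bU'; exists F; split.
- have /choice[e /all_and2[eE e1]] := @ellp_basis R k p p1.
  pose r := Order.min (theta / 2 / c) (eta / 4).
  have r0 : 0 < r by rewrite lt_min (divr_gt0 (divr_gt0 theta0 _) c0)// divr_gt0.
  have [_ [N N0 UN]] := bU'.
  have FN i : dual_norm (F i) <= N.
    by apply: (dual_norm_le N0) => x; rewrite FE (le_trans (ellp_coord_le _ i)).
  exists r, (Order.max r N); split=> //; split; first by rewrite le_max lexx.
  move=> i; rewrite [X in _ && X]le_max FN orbT andbT.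
  have F_E x : F i x = G i (x - V (Z x)) + Z x i.
    rewrite FE /U' ellpDE ellpBE linearB /= !GE.
    by rewrite addrA addrAC.
  (* A small G i is compensated by Z: F i is tested at the vector that W maps to the
  i-th basis vector. For a large G i, the i-th coordinate of Z vanishes and V Z is
  a contraction by 1/2. *)
  have [small|large] := ltP (dual_norm (G i)) eta.
    pose x := W' (e i).
    have xc : rnorm x <= c.
      rewrite (le_trans (W'C _))// (@le_trans _ _ CW')//; last by rewrite lerDl.
      by rewrite -[X in _ <= X]mulr1 ler_wpM2l.
    have Zx : Z x i = scalar_of k theta.
      by rewrite /Z ellpZE DE small /x W'K eE eqxx mulr1.
    rewrite ge_min; apply/orP; left; rewrite ler_pdivrMr//.
    have h1 : modulus (G i (x - V (Z x))) <= eta * (3 / 2 * c).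
      rewrite (le_trans (dual_norm_ge _ _))//.
      apply: ler_pM; [exact: dual_norm_ge0|exact: rnorm_ge0|exact: ltW|].
      rewrite (le_trans (rnormD _ _))// rnormN.
      by have := Zle x; lra.
    have h2 : eta * (3 / 2 * c) = theta / 2 by rewrite /eta; field; rewrite gt_eqF.
    have h3 : theta <= modulus (F i x) + modulus (G i (x - V (Z x))).
      have := modulusD (F i x) (- G i (x - V (Z x))).
      by rewrite F_E addrAC subrr add0r Zx modulus_of gtr0_norm// modulusN.
    have h4 : modulus (F i x) <= dual_norm (F i) * c.
      apply: (le_trans (dual_norm_ge _ _)); apply: ler_wpM2l => //.
      exact: dual_norm_ge0.
    by move: h1 h3 h4; rewrite h2; lra.
  have Zx0 x : Z x i = 0 by rewrite /Z ellpZE DE ltNge large mulr0.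
  rewrite ge_min; apply/orP; right.
  set n := dual_norm (G i) in large.
  have n0 : 0 < n by exact: lt_le_trans large.
  have [|x x1 Gx] := @dual_norm_attained _ _ _ (G i) (3 / 4 * n).
    by rewrite -/n; lra.
  have h1 : modulus (G i (V (Z x))) <= n / 2.
    rewrite (le_trans (dual_norm_ge _ _))// (ler_wpM2l (ltW n0))//.
    by have := Zle x; lra.
  have h2 : modulus (G i x) <= modulus (F i x) + modulus (G i (V (Z x))).
    have := modulusD (F i x) (G i (V (Z x))).
    by rewrite F_E Zx0 addr0 linearB/= subrK.
  have h3 : modulus (F i x) <= dual_norm (F i).
    rewrite (le_trans (dual_norm_ge _ _))// -[X in _ <= X]mulr1 ler_wpM2l//.
    exact: dual_norm_ge0.
  by move: h1 h2 h3 Gx; lra.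
- move=> g; apply/rcvgP; have := VE (U' g); rewrite VU'; congr rcvg.
  apply/funext => n; rewrite /series/= big_mkord.
  by apply: eq_bigr => i _; rewrite /frame_term FE.
- move=> g s [s' sK _]; apply/cvg_ex.
  have [l ul] := cX (synthesis_convergence M0 fM (U' g) (can_inj sK)).
  exists l; apply/rcvgP; have := ul; congr rcvg.
  apply/funext => n; rewrite /series/= big_mkord.
  by apply: eq_bigr => i _; rewrite /frame_term FE.
Qed.

End frames_with_upper_estimate.

(** * Frames of translates *)

Section csub_sums.
Context (R : realType) (k : scalar_kind) (V : normedModType (scalars R k)).
Variable X : closed_subspace V.

Lemma csub_val_sum (I : Type) (r : seq I) (P : pred I) (x : I -> X) :
  csub_val (\sum_(i <- r | P i) x i) = \sum_(i <- r | P i) csub_val (x i).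
Proof. exact: (big_morph (@csub_val (scalars R k) V X)). Qed.

Lemma csub_val_signed (b : bool) (x : X) : csub_val (signed b x) = signed b (csub_val x).
Proof. by case: b. Qed.

End csub_sums.

Section frames_of_translates.
Context (R : realType) (k : scalar_kind) (p : R) (p1 : 1 < p) (d : nat).
Variable X : closed_subspace (LpRd R k d (ltW p1)).
Variables (f : nat -> X) (f' : nat -> dual_space X).

Let p0 : 0 < p. Proof. by rewrite (lt_trans ltr01). Qed.

(** Splitting a frame of translates according to the function that is translated
gives finitely many families to which the lower estimate for a single function
applies; the averages over signs that occur there are controlled by the
unconditional constant. *)
Lemma frame_lower_estimate : unconditional_frame f f' ->
  sequence_of_translates (fun i => csub_val (f i)) -> upper_lp_estimate p f ->
  exists2 C : R, 0 <= C & forall n g,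
    \sum_(i < n) modulus (f' i g) `^ p <= C `^ p * rnorm g `^ p.
Proof.
move=> uf' [k0 [g [l [_ g0 /choice[kappa kappaP]]]]] /(upper_lp_estimateP (ltW p1))[M M0 fM].
have upper n (Q : pred nat) :
    rnorm (\sum_(i < n | Q i) csub_val (f i)) `^ p <= M `^ p * (\sum_(i < n | Q i) 1).
  have := upper_subset (ltW p1) fM n Q (fun=> 1).
  under eq_bigr do rewrite scale1r.
  rewrite csub_rnorm csub_val_sum => /le_trans; apply.
  by under eq_bigr do rewrite modulus1 powR1.
have cX : rcomplete X := csub_complete (@Lp_complete _ _ _ _ _ _ _).
have [Cu Cu0 CuP] := frame_sign_bound cX uf'.
have /choice[C /all_and2[C0 CP]] (j : 'I_k0) : exists C : R, 0 <= C /\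
    forall n (a : nat -> scalars R k),
    (\sum_(i < n | kappa i == j) modulus (a i) `^ p) *+ 2 ^ n <=
    C * sign_sum n (fun e => rnorm (\sum_(i < n) signed (e i) (a i *: csub_val (f i))) `^ p).
  have [|C C0 CP] := @translates_lower_estimate _ _ _ _ p1 (g j) (g0 j)
    (fun i => csub_val (f i)) l (fun i => kappa i == j) _ (M `^ p) (powR_ge0 _ _) upper.
    by move=> i /eqP <-; exact: kappaP.
  by exists C.
have D0 : 0 <= \sum_j C j by exact: sumr_ge0.
exists ((\sum_j C j) `^ p^-1 * Cu) => [|n h]; first by rewrite mulr_ge0 ?powR_ge0.
rewrite powRM ?powR_ge0// powRVK//; last by rewrite gt_eqF.
have -> : \sum_(i < n) modulus (f' i h) `^ p =
    \sum_j \sum_(i < n | kappa i == j) modulus (f' i h) `^ p.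
  by rewrite (partition_big (fun i : 'I_n => kappa i) predT).
rewrite -mulrA mulr_suml; apply: ler_sum => j _.
rewrite -(ler_pMn2r (_ : 0 < 2 ^ n)%N) ?expn_gt0//.
apply: le_trans (CP j n (fun i => f' i h)) _; rewrite -mulrnAr ler_wpM2l//.
rewrite -sign_sum_cst; apply: sign_sum_le => e.
rewrite -powRM ?rnorm_ge0// powR_mono ?rnorm_ge0 ?mulr_ge0 ?rnorm_ge0//.
apply: le_trans (CuP n e h); rewrite csub_rnorm csub_val_sum.
by under [in leRHS]eq_bigr do rewrite csub_val_signed.
Qed.

End frames_of_translates.

Theorem theorem4p3 (R : realType) (k : scalar_kind) (p : R)
    (p1 : 1 < p) (p2 : p <= 2) (d : nat) (d0 : (0 < d)%N)
    (X : closed_subspace (LpRd R k d (ltW p1)))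
    (X_infinite : ~ finite_dimensional X)
    (f : nat -> X) (f' : nat -> dual_space X)
    (f_frame : approximate_schauder_frame f f')
    (f_unconditional : unconditional_frame f f')
    (f_translates : sequence_of_translates (fun i => csub_val (f i))) :
  ((exists F' : nat -> dual_space X, [/\ dual_seminormalized F',
      schauder_frame f F' & unconditional_frame f F'])
   <-> upper_lp_estimate p f)
  /\
  (upper_lp_estimate p f ->
   (exists (Y : closed_subspace (ellp R k (ltW p1))) (T : {linear X -> Y}),
      [/\ complemented Y, isomorphism T &
        forall (g : X) (i : nat), Lp_repr (csub_val (T g)) i = f' i g])
   /\ isomorphic X (ellp R k (ltW p1))).
Proof.
have cX : rcomplete X := csub_complete (@Lp_complete _ _ _ _ _ _ _).
have lower := frame_lower_estimate f_unconditional f_translates.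
split; [split=> [[F' [[r [s [r0 [_ rs]]]] _ uF']]|uf]|move=> uf].
- have clX : clarkson X p := csub_clarkson (Lp_clarkson p2).
  apply: (seminormalized_upper_estimate (ltW p1) clX cX uF' r0) => i.
  by case/andP: (rs i).
- have [C C0 fC] := lower uf.
  exact: (frame_seminormalized (ltW p1) cX uf C0 fC f_frame X_infinite).
- have [C C0 fC] := lower uf; split.
    exact: (frame_complemented (ltW p1) cX uf C0 fC f_frame).
  exact: (frame_isomorphic (ltW p1) cX uf C0 fC f_frame X_infinite).
Qed.
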